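(* Let $h,d_1,\dots,d_m\in C[0,T]$ and assume condition (C). Then the initial value problem consisting of equation (E) with the homogeneous initial conditions $(\delta_\phi^kx)(0+)=0$, $k=0,\dots,n_0-1$, has a unique solution $x\in C^{n_0-1,\beta_0}[0,T]$, and it is given by $x(t)=\sum_{k=0}^{\infty}(-1)^k\,I^{\beta_0,\phi}_{0+}\mathcal A^k h(t)$.
   Context: Fix $T>0$ and a real function $\phi\in C^1[0,T]$ with $\phi'(t)>0$ for all $t\in[0,T]$. Write $\delta_\phi:=\frac{1}{\phi'(t)}\frac{d}{dt}$. For $\alpha\in\mathbb C$ with $\mathrm{Re}\,\alpha>0$ and integrable $f$, $I^{\alpha,\phi}_{0+}f(t)=\frac{1}{\Gamma(\alpha)}\int_0^t\phi'(s)(\phi(t)-\phi(s))^{\alpha-1}f(s)\,ds$; $I^{0,\phi}_{0+}$ is the identity. For $\mathrm{Re}\,\alpha>0$ let $n=\lceil\mathrm{Re}\,\alpha\rceil$; $D^{\alpha,\phi}_{0+}f=\delta_\phi^{\,n}I^{n-\alpha,\phi}_{0+}f$ (for $\alpha=n\in\mathbb N$ this is $\delta_\phi^nf$) and ${}^{C}D^{\alpha,\phi}_{0+}f(t)=D^{\alpha,\phi}_{0+}\Big[f-\sum_{j=0}^{n-1}\frac{(\delta_\phi^jf)(0)}{j!}(\phi(\cdot)-\phi(0))^j\Big](t)$. For $\alpha=0$, $D^{0,\phi}_{0+}$ and ${}^{C}D^{0,\phi}_{0+}$ are the identity. Let $m\in\mathbb N$ and $\beta_0,\dots,\beta_m\in\mathbb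 C$ with $\mathrm{Re}\,\beta_0>\mathrm{Re}\,\beta_1>\dots>\mathrm{Re}\,\beta_m\ge0$, where $\mathrm{Re}\,\beta_i>0$ for $i<m$ and, if $\mathrm{Re}\,\beta_m=0$, then $\beta_m=0$. Let $n_i=\lceil\mathrm{Re}\,\beta_i\rceil$ (the nonnegative integer with $n_i-1<\mathrm{Re}\,\beta_i\le n_i$; $n_m=0$ if $\beta_m=0$). Equation (E) is ${}^{C}D^{\beta_0,\phi}_{0+}x(t)+\sum_{i=1}^m d_i(t)\,{}^{C}D^{\beta_i,\phi}_{0+}x(t)=h(t)$, $t\in[0,T]$. $C^{n_0-1,\beta_0}[0,T]$ is the space of functions $x$ on $[0,T]$ such that $\delta_\phi^kx$ exists and is continuous on $[0,T]$ for $k=0,\dots,n_0-1$ and ${}^{C}D^{\beta_0,\phi}_{0+}x\in C[0,T]$, with norm $\|x\|=\sum_{k=0}^{n_0-1}\|\delta_\phi^kx\|_{C[0,T]}+\|{}^{C}D^{\beta_0,\phi}_{0+}x\|_{C[0,T]}$. $\mathcal A$ is the operator $\mathcal Af(t)=\sum_{i=1}^m d_i(t)\,I^{\beta_0-\beta_i,\phi}_{0+}f(t)$; $\mathcal A^0$ is the identity and $\mathcal A^k$ the $k$-fold composition. Condition (C): there exist $\nu>0$ and a constant $C\in(0,1)$ independent of $t$ such that $\sum_{i=1}^m\|d_i\|_{\max}\frac{1}{|\Gamma(\beta_0-\beta_i)|}\int_0^t\phi'(s)(\phi(t)-\phi(s))^{\mathrm{Re}(\beta_0-\beta_i)-1}e^{\nu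 s}\,ds\le Ce^{\nu t}$ for all $t\in[0,T]$ (for real orders: $\sum_{i=1}^m\|d_i\|_{\max}I^{\beta_0-\beta_i,\phi}_{0+}e^{\nu t}\le Ce^{\nu t}$), where $\|d\|_{\max}=\max_{[0,T]}|d|$.
   Formalization: It is additionally assumed that every order β_i whose real part is an integer is real, since otherwise I^{n-β} would have a nonzero purely imaginary order, for which the fractional integral is undefined. *)

(* Defs.v *)
From Stdlib Require Import Reals ClassicalEpsilon ZArith.
From Coquelicot Require Import Coquelicot.
Open Scope R_scope.

Fixpoint gsum {G : AbelianGroup} (n : nat) (g : nat -> G) : G :=
  match n with
  | O => zero
  | S k => plus (gsum k g) (g k)
  end.

Definition inI (T t : R) : Prop := 0 <= t <= T.

Definition cont_on (T : R) (f : R -> C) : Prop :=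
  forall t, inI T t -> filterlim f (within (inI T) (locally t)) (locally (f t)).

Definition is_deriv_on_at (T : R) (f : R -> C) (t : R) (l : C) : Prop :=
  filterlim (fun s => Cmult (Cminus (f s) (f t)) (RtoC (/ (s - t))))
    (within (fun s => inI T s /\ s <> t) (locally t)) (locally l).

Definition is_rderiv_on_at (T : R) (f : R -> R) (t : R) (l : R) : Prop :=
  filterlim (fun s => (f s - f t) / (s - t))
    (within (fun s => inI T s /\ s <> t) (locally t)) (locally l).

Definition differentiable_on (T : R) (f : R -> C) : Prop :=
  forall t, inI T t -> exists l, is_deriv_on_at T f t l.

(* the (chosen) derivative; it is unique on a nondegenerate interval *)
Definition cderiv (T : R) (f : R -> C) (t : R) : C :=
  epsilon (inhabits (RtoC 0)) (fun l => is_deriv_on_at T f t l).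

Definition delta_phi (T : R) (phi' : R -> R) (f : R -> C) (t : R) : C :=
  Cmult (RtoC (/ phi' t)) (cderiv T f t).

Fixpoint delta_phi_n (T : R) (phi' : R -> R) (k : nat) (f : R -> C) : R -> C :=
  match k with
  | O => f
  | S j => delta_phi T phi' (delta_phi_n T phi' j f)
  end.

Definition cexp (z : C) : C :=
  (exp (Re z) * cos (Im z), exp (Re z) * sin (Im z)).

Definition cpow (a : R) (z : C) : C := cexp (Cmult z (RtoC (ln a))).

(* int_0^t g(s) ds as an improper integral at the upper end point (the integrands
   below may be singular at s = t); it is 0 for t <= 0. *)
Definition cint0 (g : R -> C) (t : R) : C :=
  if Rlt_dec 0 t then @RInt_gen C_R_CompleteNormedModule g (at_point 0) (at_left t)
  else RtoC 0.

Definition rint0 (g : R -> R) (t : R) : R :=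
  if Rlt_dec 0 t then RInt_gen g (at_point 0) (at_left t) else 0.

Definition CGamma (z : C) : C :=
  @RInt_gen C_R_CompleteNormedModule
    (fun s => Cmult (cpow s (Cminus z (RtoC 1))) (RtoC (exp (- s))))
    (at_right 0) (Rbar_locally p_infty).

Definition C_eq_dec (z w : C) : {z = w} + {z <> w}.
Proof.
  destruct z as [a b], w as [c d].
  destruct (Req_EM_T a c) as [H1|H1]; destruct (Req_EM_T b d) as [H2|H2];
    subst; [left; reflexivity | right; intro H; inversion H; contradiction ..].
Defined.

Definition frac_int (phi phi' : R -> R) (alpha : C) (f : R -> C) (t : R) : C :=
  if C_eq_dec alpha (RtoC 0) then f t
  else Cmult (Cinv (CGamma alpha))
         (cint0 (fun s => Cmult (Cmult (RtoC (phi' s))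
                                  (cpow (phi t - phi s) (Cminus alpha (RtoC 1))))
                                (f s)) t).

Definition nceil (x : R) : nat := Z.to_nat (- Int_part (- x)).

Definition RL_der (T : R) (phi phi' : R -> R) (alpha : C) (f : R -> C) : R -> C :=
  let n := nceil (Re alpha) in
  delta_phi_n T phi' n (frac_int phi phi' (Cminus (RtoC (INR n)) alpha) f).

Definition taylor (T : R) (phi phi' : R -> R) (n : nat) (f : R -> C) (s : R) : C :=
  @gsum C_AbelianGroup n (fun j =>
     Cmult (delta_phi_n T phi' j f 0)
           (RtoC ((phi s - phi 0) ^ j / INR (fact j)))).

Definition caputo (T : R) (phi phi' : R -> R) (alpha : C) (f : R -> C) : R -> C :=
  let n := nceil (Re alpha) in
  RL_der T phi phi' alpha (fun s => Cminus (f s) (taylor T phi phi' n f s)).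

Definition in_space (T : R) (phi phi' : R -> R) (beta0 : C) (x : R -> C) : Prop :=
  let n0 := nceil (Re beta0) in
  (* delta^k x exists and is continuous on [0,T] for k = 0..n0-1 *)
  (forall k, (k < n0)%nat -> cont_on T (delta_phi_n T phi' k x)) /\
  (forall k, (S k < n0)%nat -> differentiable_on T (delta_phi_n T phi' k x)) /\
  (* ^C D^{beta0} x exists and is continuous on [0,T] *)
  (let g := frac_int phi phi' (Cminus (RtoC (INR n0)) beta0)
              (fun s => Cminus (x s) (taylor T phi phi' n0 x s)) in
   (forall j, (j < n0)%nat -> differentiable_on T (delta_phi_n T phi' j g)) /\
   cont_on T (caputo T phi phi' beta0 x)).

Definition opA (phi phi' : R -> R) (m : nat) (beta : nat -> C) (d : nat -> R -> C)
  (f : R -> C) (t : R) : C :=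
  @gsum C_AbelianGroup m (fun j =>
     Cmult (d (S j) t) (frac_int phi phi' (Cminus (beta O) (beta (S j))) f t)).

Fixpoint opA_pow (phi phi' : R -> R) (m : nat) (beta : nat -> C) (d : nat -> R -> C)
  (k : nat) (f : R -> C) : R -> C :=
  match k with
  | O => f
  | S j => opA phi phi' m beta d (opA_pow phi phi' m beta d j f)
  end.

Definition norm_max (T : R) (d : R -> C) : R :=
  real (Lub_Rbar (fun r => exists t, inI T t /\ r = Cmod (d t))).

Definition condC (T : R) (phi phi' : R -> R) (m : nat) (beta : nat -> C)
  (d : nat -> R -> C) : Prop :=
  exists nu Cc : R, 0 < nu /\ 0 < Cc < 1 /\
    forall t, inI T t ->
      @gsum R_AbelianGroup m (fun j =>
        norm_max T (d (S j)) / Cmod (CGamma (Cminus (beta O) (beta (S j)))) *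
        rint0 (fun s => phi' s *
                 Rpower (phi t - phi s) (Re (Cminus (beta O) (beta (S j))) - 1) *
                 exp (nu * s)) t)
      <= Cc * exp (nu * t).

Definition solves_ivp (T : R) (phi phi' : R -> R) (m : nat) (beta : nat -> C)
  (d : nat -> R -> C) (h : R -> C) (x : R -> C) : Prop :=
  in_space T phi phi' (beta O) x /\
  (forall k, (k < nceil (Re (beta O)))%nat ->
     filterlim (delta_phi_n T phi' k x) (at_right 0) (locally (RtoC 0))) /\
  (forall t, inI T t ->
     Cplus (caputo T phi phi' (beta O) x t)
           (@gsum C_AbelianGroup m (fun j =>
              Cmult (d (S j) t) (caputo T phi phi' (beta (S j)) x t)))
     = h t).

(* Main.v *)
Require Import Defs.
From Stdlib Require Import Reals Lra Lia ZArith.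
From Stdlib Require Import ClassicalEpsilon FunctionalExtensionality PropExtensionality.
From Coquelicot Require Import Coquelicot.
Open Scope R_scope.

(** The unnormalised fractional integrals [J_alpha f (t) = int_0^t phi'(s) (phi t - phi s)^(alpha-1) f(s) ds]
    map a jump function to a power [(phi t - phi r)_+^alpha / alpha] and such powers to multiples of
    powers, by the substitution [u = (phi s - phi r) / (phi t - phi r)].  Since continuous functions are
    uniform limits of step functions, [J_alpha J_beta = c J_(alpha+beta)] on [C[0,T]], with [c] depending
    only on [alpha] and [beta].  Taking [phi = id] and [f = exp] and letting [t] tend to infinity
    identifies [c = Gamma(alpha) Gamma(beta) / Gamma(alpha+beta)], which is the semigroup law
    [I^alpha I^beta = I^(alpha+beta)].  The constants make sense because Gamma has no zeros in the right
    half plane: [Gamma(z+1) = z Gamma(z)] reduces this to large [Re z], where the weight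
    [u^(x-1) e^(-u)] concentrates at [u = x].

    By the semigroup law, [x = I^beta0 w] turns the initial value problem into [w + A w = h] with [w]
    continuous: every solution has this form with [w] its Caputo derivative of order [beta0].  Condition
    (C) makes [A] a contraction of [C[0,T]] for the norm [sup |f(t)| e^(-nu t)], so the equation for [w]
    is solved uniquely by the Neumann series. *)

Ltac Cring := match goal with |- @eq _ ?a ?b => change (@eq C a b) end; ring.

Notation CR := C_R_CompleteNormedModule.

Lemma norm_C_R (z : C) : @norm R_AbsRing C_R_NormedModule z = Cmod z.
Proof.
  unfold norm; simpl; unfold prod_norm, Cmod, norm; simpl.
  f_equal. unfold abs; simpl. rewrite !Rmult_1_r.
  rewrite <- !Rabs_mult, !Rabs_right; try reflexivity; apply Rle_ge, Rle_0_sqr.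
Qed.

Lemma scal_C_R (x : R) (z : C) : @scal R_AbsRing C_R_NormedModule x z = Cmult (RtoC x) z.
Proof.
  unfold scal; simpl; unfold prod_scal, Cmult, scal; simpl; unfold mult; simpl.
  destruct z; simpl; f_equal; ring.
Qed.

Lemma locally_C_Cmod (l : C) (P : C -> Prop) :
  locally l P <-> exists eps : posreal, forall z, Cmod (Cminus z l) < eps -> P z.
Proof.
  split; intro H.
  - apply (@locally_norm_le_locally R_AbsRing C_R_NormedModule l) in H.
    destruct H as [e He]. exists e. intros z Hz. apply He.
    unfold ball_norm. rewrite norm_C_R. exact Hz.
  - destruct H as [e He].
    apply (@locally_le_locally_norm R_AbsRing C_R_NormedModule l).
    exists e. intros z Hz. apply He. unfold ball_norm in Hz. rewrite norm_C_R in Hz. exact Hz.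
Qed.

Lemma filterlim_C_Cmod {U : Type} (F : (U -> Prop) -> Prop) {FF : Filter F} (f : U -> C) (l : C) :
  filterlim f F (locally l) <->
  forall eps : R, 0 < eps -> F (fun x => Cmod (Cminus (f x) l) < eps).
Proof.
  split; intro H.
  - intros eps He.
    apply (H (fun z => Cmod (Cminus z l) < eps)). apply locally_C_Cmod.
    exists (mkposreal eps He). auto.
  - intros P HP. apply locally_C_Cmod in HP. destruct HP as [e He].
    unfold filtermap. generalize (H e (cond_pos e)). apply filter_imp. intros x Hx. auto.
Qed.

Lemma filterlim_Cplus {U : Type} (F : (U -> Prop) -> Prop) {FF : Filter F} (f g : U -> C) (a b : C) :
  filterlim f F (locally a) -> filterlim g F (locally b) ->
  filterlim (fun x => Cplus (f x) (g x)) F (locally (Cplus a b)).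
Proof.
  intros Hf Hg.
  apply (filterlim_comp_2 f g Cplus Hf Hg).
  apply (@filterlim_plus R_AbsRing C_R_NormedModule a b).
Qed.

Lemma filterlim_Cmult {U : Type} (F : (U -> Prop) -> Prop) {FF : Filter F} (f g : U -> C) (a b : C) :
  filterlim f F (locally a) -> filterlim g F (locally b) ->
  filterlim (fun x => Cmult (f x) (g x)) F (locally (Cmult a b)).
Proof.
  intros Hf Hg.
  apply filterlim_C_Cmod; [exact FF|]. intros eps He.
  rewrite filterlim_C_Cmod in Hf, Hg; try exact FF.
  set (A := Cmod a + 1). set (B := Cmod b + 1).
  assert (0 < A) by (unfold A; pose proof (Cmod_ge_0 a); lra).
  assert (0 < B) by (unfold B; pose proof (Cmod_ge_0 b); lra).
  set (d := Rmin 1 (eps / (2 * (A + B)))).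
  assert (Hd : 0 < d).
  { unfold d. apply Rmin_pos; [lra|]. apply Rdiv_lt_0_compat; lra. }
  generalize (filter_and _ _ (Hf d Hd) (Hg d Hd)).
  apply filter_imp. intros x [H1 H2].
  replace (f x * g x - a * b)%C with ((f x - a) * g x + a * (g x - b))%C by ring.
  eapply Rle_lt_trans. apply Cmod_triangle. rewrite !Cmod_mult.
  assert (Cmod (g x) <= B).
  { replace (g x) with (g x - b + b)%C by ring.
    eapply Rle_trans. apply Cmod_triangle. unfold B.
    assert (d <= 1) by apply Rmin_l. lra. }
  assert (d <= eps / (2 * (A + B))) by apply Rmin_r.
  assert (d * (A + B) <= eps / 2).
  { apply Rle_trans with (eps / (2 * (A + B)) * (A+B)).
    apply Rmult_le_compat_r; lra. right; field; lra. }
  pose proof (Cmod_ge_0 (f x - a)). pose proof (Cmod_ge_0 (g x)).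
  pose proof (Cmod_ge_0 (g x - b)). pose proof (Cmod_ge_0 a).
  assert (Cmod (f x - a) * Cmod (g x) <= d * B) by (apply Rmult_le_compat; lra).
  assert (Cmod a * Cmod (g x - b) <= A * d) by (apply Rmult_le_compat; unfold A; lra).
  lra.
Qed.

Lemma filterlim_RtoC {U : Type} (F : (U -> Prop) -> Prop) {FF : Filter F} (f : U -> R) (a : R) :
  filterlim f F (locally a) -> filterlim (fun x => RtoC (f x)) F (locally (RtoC a)).
Proof.
  intro Hf. apply filterlim_C_Cmod; [exact FF|]. intros eps He.
  generalize (proj1 (filterlim_locally f a) Hf (mkposreal eps He)).
  apply filter_imp. intros x Hx. rewrite <- RtoC_minus, Cmod_R. exact Hx.
Qed.

Lemma continuous_Cmult {U : UniformSpace} (f g : U -> C) (x : U) :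
  @continuous U C_UniformSpace f x -> @continuous U C_UniformSpace g x ->
  @continuous U C_UniformSpace (fun y => Cmult (f y) (g y)) x.
Proof. intros; apply filterlim_Cmult; auto. apply locally_filter. Qed.

Lemma continuous_Cplus {U : UniformSpace} (f g : U -> C) (x : U) :
  @continuous U C_UniformSpace f x -> @continuous U C_UniformSpace g x ->
  @continuous U C_UniformSpace (fun y => Cplus (f y) (g y)) x.
Proof. intros; apply filterlim_Cplus; auto. apply locally_filter. Qed.

Lemma continuous_RtoC {U : UniformSpace} (f : U -> R) (x : U) :
  @continuous U R_UniformSpace f x -> @continuous U C_UniformSpace (fun y => RtoC (f y)) x.
Proof. intros; apply filterlim_RtoC; auto. apply locally_filter. Qed.

Lemma continuous_Cconst {U : UniformSpace} (c : C) (x : U) :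
  @continuous U C_UniformSpace (fun _ => c) x.
Proof. apply continuous_const. Qed.

Lemma RtoC_neq_0 (x : R) : x <> 0 -> RtoC x <> 0%C.
Proof. intros H E. apply RtoC_inj in E. contradiction. Qed.

(** * Complex powers *)

Lemma Cmod_cexp (z : C) : Cmod (cexp z) = exp (Re z).
Proof.
  unfold cexp, Cmod; simpl.
  replace (exp (Re z) * cos (Im z) * (exp (Re z) * cos (Im z) * 1) +
    exp (Re z) * sin (Im z) * (exp (Re z) * sin (Im z) * 1))
  with (exp (Re z) * exp (Re z) * (Rsqr (sin (Im z)) + Rsqr (cos (Im z)))) by (unfold Rsqr; ring).
  rewrite sin2_cos2, Rmult_1_r. apply sqrt_square. left; apply exp_pos.
Qed.

Lemma cexp_plus (z w : C) : cexp (z + w) = (cexp z * cexp w)%C.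
Proof.
  unfold cexp, Cmult; simpl. rewrite exp_plus, cos_plus, sin_plus. f_equal; unfold Re, Im; ring.
Qed.

Lemma cexp_0 : cexp 0 = 1%C.
Proof. unfold cexp; simpl. rewrite exp_0, cos_0, sin_0. unfold RtoC; f_equal; ring. Qed.

Lemma Cmod_cpow (a : R) (z : C) : Cmod (cpow a z) = Rpower a (Re z).
Proof.
  unfold cpow. rewrite Cmod_cexp. unfold Rpower. f_equal. unfold Re; simpl. ring.
Qed.

Lemma cpow_plus (a : R) (z w : C) : cpow a (z + w) = (cpow a z * cpow a w)%C.
Proof. unfold cpow. rewrite <- cexp_plus. f_equal. ring. Qed.

Lemma cpow_0 (a : R) : cpow a 0 = 1%C.
Proof. unfold cpow. rewrite <- cexp_0. f_equal. ring. Qed.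

Lemma cpow_mult_base (a b : R) (z : C) : 0 < a -> 0 < b -> cpow (a * b) z = (cpow a z * cpow b z)%C.
Proof.
  intros. unfold cpow. rewrite ln_mult, RtoC_plus, Cmult_plus_distr_l by assumption.
  apply cexp_plus.
Qed.

Lemma cpow_RtoC (a x : R) : cpow a (RtoC x) = RtoC (Rpower a x).
Proof.
  unfold cpow, cexp, Rpower, RtoC; simpl.
  replace (x * 0 + 0 * ln a) with 0 by ring.
  replace (x * ln a - 0 * 0) with (x * ln a) by ring.
  rewrite cos_0, sin_0. f_equal; ring.
Qed.

Lemma cpow_1 (a : R) : 0 < a -> cpow a 1 = RtoC a.
Proof. intro. rewrite cpow_RtoC, Rpower_1; auto. Qed.

Lemma cpow_split (a : R) (z : C) : 0 < a -> cpow a z = (RtoC a * cpow a (z - 1))%C.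
Proof.
  intro. rewrite <- (cpow_1 a) by assumption. rewrite <- cpow_plus. f_equal. ring.
Qed.

Lemma is_derive_pair_C (f g : R -> R) (x l m : R) :
  is_derive f x l -> is_derive g x m ->
  @is_derive R_AbsRing C_R_NormedModule (fun s => (f s, g s)) x (l, m).
Proof.
  intros Hf Hg.
  apply (filterdiff_ext_lin (fun s : R => (f s, g s) : C_R_NormedModule)
     (fun y : R => (scal y l, scal y m) : C_R_NormedModule)).
  - apply (filterdiff_comp'_2 f g (fun a b => (a,b) : C_R_NormedModule) x _ _ (fun a b => (a,b)) Hf Hg).
    apply filterdiff_linear.
    split.
    + intros [a b] [c d]; reflexivity.
    + intros k [a b]; reflexivity.
    + exists 1. split; [lra|]. intros [a b]. rewrite Rmult_1_l. apply Rle_refl.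
  - intro y. reflexivity.
Qed.

Lemma is_derive_cpow (z : C) (a : R) : 0 < a ->
  @is_derive R_AbsRing C_R_NormedModule (fun s => cpow s z) a (z * cpow a (z - 1))%C.
Proof.
  intro Ha.
  destruct z as [x y].
  apply (is_derive_ext (fun s => (exp (x * ln s) * cos (y * ln s), exp (x * ln s) * sin (y * ln s)))).
  { intro s. unfold cpow, cexp; simpl. f_equal; f_equal; f_equal; unfold Re, Im; simpl; ring. }
  assert (Hp : cpow a ((x,y) - 1)%C = ((/ a)%R * cpow a (x,y))%C).
  { rewrite (cpow_split a (x,y)) by assumption. rewrite RtoC_inv by lra. field.
    apply RtoC_neq_0; lra. }
  rewrite Hp.
  replace (Cmult (x,y) (((/ a)%R * cpow a (x,y))%C)) with
   ( (x / a * exp (x * ln a) * cos (y * ln a) - y / a * exp (x * ln a) * sin (y * ln a)),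
     (x / a * exp (x * ln a) * sin (y * ln a) + y / a * exp (x * ln a) * cos (y * ln a))).
  - apply is_derive_pair_C; auto_derive; auto; field; lra.
  - unfold cpow, cexp, Cmult; simpl. unfold Re, Im; simpl.
    replace (x * ln a - y * 0) with (x * ln a) by ring.
    replace (x * 0 + y * ln a) with (y * ln a) by ring.
    f_equal; field; lra.
Qed.

Lemma continuous_cpow (z : C) (a : R) : 0 < a ->
  @continuous R_UniformSpace C_UniformSpace (fun s => cpow s z) a.
Proof.
  intro Ha. apply (@ex_derive_continuous R_AbsRing C_R_NormedModule).
  eexists. apply is_derive_cpow, Ha.
Qed.

Definition cpow0 (x : R) (z : C) : C := if Rlt_dec 0 x then cpow x z else 0%C.

Lemma cpow0_pos (x : R) (z : C) : 0 < x -> cpow0 x z = cpow x z.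
Proof. intro. unfold cpow0. destruct Rlt_dec; [reflexivity|contradiction]. Qed.

Lemma cpow0_neg (x : R) (z : C) : x <= 0 -> cpow0 x z = 0%C.
Proof. intro. unfold cpow0. destruct Rlt_dec; [lra|reflexivity]. Qed.

Lemma Rpower_small (a eps : R) : 0 < a -> 0 < eps ->
  exists d : posreal, forall x, 0 < x < d -> Rpower x a < eps.
Proof.
  intros Ha He.
  exists (mkposreal (Rpower eps (/ a)) (exp_pos _)). simpl. intros x Hx.
  replace eps with (Rpower (Rpower eps (/ a)) a).
  - apply Rlt_Rpower_l; lra.
  - rewrite Rpower_mult, Rinv_l, Rpower_1; lra.
Qed.

Lemma continuous_cpow0 (z : C) (x : R) : 0 < Re z ->
  @continuous R_UniformSpace C_UniformSpace (fun s => cpow0 s z) x.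
Proof.
  intro Hz.
  destruct (Rtotal_order x 0) as [H|[H|H]].
  - apply (continuous_ext_loc _ (fun _ => RtoC 0)).
    + exists (mkposreal (-x) ltac:(lra)). intros y Hy.
      change (Rabs (y - x) < - x) in Hy. apply Rabs_def2 in Hy.
      symmetry; apply cpow0_neg. lra.
    + apply continuous_const.
  - subst x. unfold continuous. rewrite (cpow0_neg 0) by lra.
    apply filterlim_C_Cmod. apply locally_filter. intros eps He.
    destruct (Rpower_small (Re z) eps Hz He) as [d Hd].
    exists d. intros y Hy. change (Rabs (y - 0) < d) in Hy. apply Rabs_def2 in Hy.
    unfold Cminus. rewrite Copp_0, Cplus_0_r.
    destruct (Rlt_dec 0 y) as [Hp|Hp].
    + rewrite cpow0_pos, Cmod_cpow by assumption. apply Hd. lra.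
    + rewrite cpow0_neg, Cmod_0 by lra. exact He.
  - apply (continuous_ext_loc _ (fun s => cpow s z)).
    + exists (mkposreal x H). intros y Hy.
      change (Rabs (y - x) < x) in Hy. apply Rabs_def2 in Hy.
      symmetry; apply cpow0_pos. lra.
    + apply continuous_cpow, H.
Qed.

(** * Improper integrals *)

Lemma minus_plus_l {G : AbelianGroup} (x y : G) : minus (plus x y) x = y.
Proof.
  unfold minus. rewrite (plus_comm x y), <- plus_assoc.
  etransitivity; [apply (f_equal (plus y)), plus_opp_r|apply plus_zero_r].
Qed.

Lemma is_RInt_gen_right {V : NormedModule R_AbsRing} (f : R -> V) (I : R -> V) (a : R)
  (F : (R -> Prop) -> Prop) {FF : Filter F} (l : V) :
  F (fun b => is_RInt f a b (I b)) -> filterlim I F (locally l) ->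
  is_RInt_gen f (at_point a) F l.
Proof.
  intros HI Hl P HP.
  refine (Filter_prod _ _ _ (fun x => x = a)
     (fun b => is_RInt f a b (I b) /\ P (I b)) eq_refl _ _).
  - apply filter_and; [exact HI|exact (Hl P HP)].
  - intros x b -> [H1 H2]. exists (I b). auto.
Qed.

Lemma is_RInt_gen_left {V : NormedModule R_AbsRing} (f : R -> V) (I : R -> V) (b : R)
  (F : (R -> Prop) -> Prop) {FF : Filter F} (l : V) :
  F (fun a => is_RInt f a b (I a)) -> filterlim I F (locally l) ->
  is_RInt_gen f F (at_point b) l.
Proof.
  intros HI Hl P HP.
  refine (Filter_prod _ _ _ (fun a => is_RInt f a b (I a) /\ P (I a)) (fun x => x = b)
      _ eq_refl _).
  - apply filter_and; [exact HI|exact (Hl P HP)].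
  - intros x y [H1 H2] ->. exists (I x). auto.
Qed.

Lemma is_RInt_gen_right_lim {V : CompleteNormedModule R_AbsRing} (f : R -> V) (a : R)
  (F : (R -> Prop) -> Prop) {FF : Filter F} (l : V) :
  is_RInt_gen f (at_point a) F l -> filterlim (fun b => RInt f a b) F (locally l).
Proof.
  intros H P HP.
  destruct (H P HP) as [Q S HQ HS HQS].
  unfold filtermap. generalize HS. apply filter_imp. intros b Hb.
  destruct (HQS a b HQ Hb) as [y [H1 H2]].
  simpl in H1. rewrite (is_RInt_unique _ _ _ _ H1). exact H2.
Qed.

Lemma ex_RInt_gen_dominated {V : CompleteNormedModule R_AbsRing} (f : R -> V) (k : R -> R)
  (a : R) (F : (R -> Prop) -> Prop) {FF : ProperFilter F} (D : R -> Prop) (lk : R) :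
  F D -> (forall b, D b -> a <= b) -> (forall b, D b -> ex_RInt f a b) ->
  (forall b, D b -> ex_RInt k a b) ->
  (forall b x, D b -> a <= x <= b -> norm (f x) <= k x) ->
  is_RInt_gen k (at_point a) F lk ->
  exists l, is_RInt_gen f (at_point a) F l.
Proof.
  intros HD Hab Hf Hk Hfk Hlk.
  apply (is_RInt_gen_right_lim (V := R_CompleteNormedModule)) in Hlk; [|typeclasses eauto].
  assert (HK : exists l, filterlim (fun b => RInt f a b) F (locally l)).
  { apply filterlim_locally_cauchy. intro eps.
    pose proof (proj1 (filterlim_locally _ _) Hlk (pos_div_2 eps)) as He.
    exists (fun b => D b /\ ball lk (pos_div_2 eps) (RInt k a b)).
    split; [apply filter_and; assumption|].
    assert (Hmain : forall b c, D b -> D c -> b <= c -> Rabs (RInt k a c - RInt k a b) < eps ->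
       norm (minus (RInt f a c) (RInt f a b)) < eps).
    { intros b c Db Dc Hbc He'.
      pose proof (Hab b Db).
      assert (Ef : ex_RInt f b c).
      { apply (ex_RInt_Chasles_2 f a); [split; auto|apply Hf; auto]. }
      assert (Ek : ex_RInt k b c).
      { apply (ex_RInt_Chasles_2 (V := R_CompleteNormedModule) k a); [split; auto|apply Hk; auto]. }
      rewrite <- (RInt_Chasles f a b c) by auto.
      replace (minus (plus (RInt f a b) (RInt f b c)) (RInt f a b)) with (RInt f b c).
      2:{ symmetry; exact (@minus_plus_l (CompleteNormedModule.AbelianGroup R_AbsRing V) (RInt f a b) (RInt f b c)). }
      apply Rle_lt_trans with (RInt k b c).
      - apply (norm_RInt_le f k b c); auto.
        intros x Hx. apply (Hfk c); [auto|lra].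
        apply (RInt_correct f); auto.
        apply (RInt_correct (V:=R_CompleteNormedModule) k); auto.
      - rewrite <- (RInt_Chasles (V:=R_CompleteNormedModule) k a b c) in He' by auto.
        change (Rabs (RInt k a b + RInt k b c - RInt k a b) < eps) in He'.
        apply Rabs_def2 in He'. lra. }
    assert (Hball : forall b c, ball lk (pos_div_2 eps) (RInt k a b) -> ball lk (pos_div_2 eps) (RInt k a c) ->
       Rabs (RInt k a c - RInt k a b) < eps).
    { intros b c Hb Hc. change (Rabs (RInt k a b - lk) < eps / 2) in Hb.
      change (Rabs (RInt k a c - lk) < eps / 2) in Hc.
      apply Rabs_def2 in Hb; apply Rabs_def2 in Hc. apply Rabs_def1; lra. }
    intros b c [Db Bb] [Dc Bc].
    destruct (Rle_dec b c) as [Hbc|Hbc].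
    - apply (@norm_compat1 R_AbsRing V). apply Hmain; auto.
    - apply ball_sym. apply (@norm_compat1 R_AbsRing V). apply Hmain; auto. lra. }
  destruct HK as [l Hl]. exists l.
  apply is_RInt_gen_right with (I := fun b => RInt f a b); [typeclasses eauto| |exact Hl].
  generalize HD. apply filter_imp. intros b Hb. apply RInt_correct, Hf, Hb.
Qed.

Lemma is_RInt_Cmult (f : R -> C) (c : C) (a b : R) (l : C) :
  @is_RInt CR f a b l -> @is_RInt CR (fun x => Cmult c (f x)) a b (Cmult c l).
Proof.
  intro H.
  pose proof (is_RInt_fct_extend_fst (U := R_NormedModule) (V := R_NormedModule) f a b l H) as H1.
  pose proof (is_RInt_fct_extend_snd (U := R_NormedModule) (V := R_NormedModule) f a b l H) as H2.
  assert (Hi : @is_RInt CR (fun x => (- snd (f x), fst (f x))) a b (- snd l, fst l)).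
  { apply (is_RInt_fct_extend_pair (U := R_NormedModule) (V := R_NormedModule)).
    - apply (is_RInt_opp (V := R_NormedModule)), H2.
    - exact H1. }
  pose proof (is_RInt_plus _ _ _ _ _ _ (is_RInt_scal _ _ _ (fst c) _ H)
     (is_RInt_scal _ _ _ (snd c) _ Hi)) as H3.
  assert (E : forall z : C, plus (@scal R_AbsRing CR (fst c) z) (@scal R_AbsRing CR (snd c) (- snd z, fst z)) = Cmult c z).
  { intro z. destruct c, z. unfold Cmult, plus, scal; simpl; unfold prod_plus, prod_scal, scal, plus; simpl; unfold mult; simpl.
    f_equal; ring. }
  rewrite E in H3. revert H3. apply is_RInt_ext. intros x _. apply E.
Qed.

Lemma is_RInt_gen_Cmult (f : R -> C) (c : C) (Fa Fb : (R -> Prop) -> Prop) {HFa : Filter Fa} {HFb : Filter Fb} (l : C) :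
  @is_RInt_gen CR f Fa Fb l -> @is_RInt_gen CR (fun x => Cmult c (f x)) Fa Fb (Cmult c l).
Proof.
  intros H P HP.
  assert (HQ : locally l (fun z => P (Cmult c z))).
  { refine (filterlim_Cmult (locally l) (fun _ => c) (fun z => z) c l _ _ P HP).
    apply filterlim_const. apply filterlim_id. }
  generalize (H _ HQ). unfold filtermapi. apply filter_imp. intros ab [y [H1 H2]].
  exists (Cmult c y). split; [apply is_RInt_Cmult, H1|exact H2].
Qed.

Lemma ex_RInt_Cmult (f : R -> C) (c : C) (a b : R) :
  @ex_RInt CR f a b -> @ex_RInt CR (fun x => Cmult c (f x)) a b.
Proof. intros [l H]. exists (Cmult c l). apply is_RInt_Cmult, H. Qed.

Lemma at_left_between (a t : R) : a < t -> at_left t (fun b => a < b < t).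
Proof.
  intro H. exists (mkposreal (t - a) ltac:(lra)). intros y Hy Hlt.
  change (Rabs (y - t) < t - a) in Hy. apply Rabs_def2 in Hy. lra.
Qed.

Lemma is_RInt_gen_at_left_ext {V : NormedModule R_AbsRing} (f g : R -> V) (a t : R) (l : V) : a < t ->
  (forall s, a < s < t -> f s = g s) ->
  is_RInt_gen f (at_point a) (at_left t) l -> is_RInt_gen g (at_point a) (at_left t) l.
Proof.
  intros Hat E. apply is_RInt_gen_ext.
  refine (Filter_prod _ _ _ (fun x => x = a) (fun b => a < b < t) eq_refl (at_left_between a t Hat) _).
  intros x b -> Hb s. simpl. rewrite Rmin_left, Rmax_right by lra. intro; apply E; lra.
Qed.

Lemma cint0_ext (f g : R -> C) (t : R) :
  (forall s, 0 < s < t -> f s = g s) -> cint0 f t = cint0 g t.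
Proof.
  intro E. unfold cint0. destruct (Rlt_dec 0 t) as [Ht|]; [|reflexivity].
  unfold RInt_gen. f_equal. apply functional_extensionality. intro l.
  apply propositional_extensionality. split; apply is_RInt_gen_at_left_ext; auto.
  intros s Hs; symmetry; auto.
Qed.

Lemma rint0_ext (f g : R -> R) (t : R) :
  (forall s, 0 < s < t -> f s = g s) -> rint0 f t = rint0 g t.
Proof.
  intro E. unfold rint0. destruct (Rlt_dec 0 t) as [Ht|]; [|reflexivity].
  unfold RInt_gen. f_equal. apply functional_extensionality. intro l.
  apply propositional_extensionality. split; apply is_RInt_gen_at_left_ext; auto.
  intros s Hs; symmetry; auto.
Qed.

Lemma cint0_eq (f : R -> C) (t : R) (l : C) : 0 < t ->
  @is_RInt_gen CR f (at_point 0) (at_left t) l -> cint0 f t = l.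
Proof.
  intros Ht H. unfold cint0. destruct (Rlt_dec 0 t); [|contradiction].
  apply (is_RInt_gen_unique (V := CR)), H.
Qed.

Lemma cint0_0 (f : R -> C) : cint0 f 0 = 0%C.
Proof. unfold cint0. destruct Rlt_dec; [lra|reflexivity]. Qed.

Lemma rint0_eq (f : R -> R) (t : R) (l : R) : 0 < t ->
  @is_RInt_gen R_NormedModule f (at_point 0) (at_left t) l -> rint0 f t = l.
Proof.
  intros Ht H. unfold rint0. destruct (Rlt_dec 0 t); [|contradiction].
  apply (is_RInt_gen_unique (V := R_CompleteNormedModule)), H.
Qed.

Lemma Cmod_RInt_gen_at_left_le (f : R -> C) (k : R -> R) (a t : R) (l : C) (lk : R) : a < t ->
  (forall s, a <= s < t -> Cmod (f s) <= k s) ->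
  @is_RInt_gen CR f (at_point a) (at_left t) l ->
  @is_RInt_gen R_NormedModule k (at_point a) (at_left t) lk -> Cmod l <= lk.
Proof.
  intros Hat Hfk Hf Hk. rewrite <- norm_C_R.
  apply (RInt_gen_norm (V := CR) (Fa := at_point a) (Fb := at_left t) f k l lk); auto;
  refine (Filter_prod _ _ _ (fun x => x = a) (fun b => a < b < t) eq_refl (at_left_between a t Hat) _).
  - intros x b -> Hb; simpl; lra.
  - intros x b -> Hb s Hs; simpl in Hs. rewrite norm_C_R. apply Hfk. lra.
Qed.

(** * Continuous functions and step functions on [[0,T]] *)

Definition clamp (T s : R) : R := Rmax 0 (Rmin T s).

Lemma clamp_inI (T s : R) : 0 <= T -> inI T (clamp T s).
Proof.
  intro. unfold inI, clamp. split; [apply Rmax_l|]. apply Rmax_lub; [assumption|apply Rmin_l].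
Qed.

Lemma clamp_id (T s : R) : inI T s -> clamp T s = s.
Proof. unfold inI, clamp. intros. rewrite Rmin_right, Rmax_right; lra. Qed.

Lemma clamp_dist (T s t : R) : Rabs (clamp T s - clamp T t) <= Rabs (s - t).
Proof.
  unfold clamp, Rmax, Rmin.
  repeat (destruct Rle_dec; try lra); unfold Rabs; repeat destruct Rcase_abs; lra.
Qed.

Lemma clamp_filterlim (T x : R) : 0 <= T ->
  filterlim (clamp T) (locally x) (within (inI T) (locally (clamp T x))).
Proof.
  intros HT P [e He]. exists e. intros y Hy. apply He; [|apply clamp_inI, HT].
  eapply Rle_lt_trans; [apply clamp_dist|exact Hy].
Qed.

Lemma continuous_clamp (T : R) (f : R -> C) (x : R) : 0 <= T -> cont_on T f ->
  @continuous R_UniformSpace C_UniformSpace (fun s => f (clamp T s)) x.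
Proof.
  intros HT Hf. eapply filterlim_comp; [apply clamp_filterlim, HT|].
  apply Hf, clamp_inI, HT.
Qed.

Lemma continuous_cont_on (T : R) (f : R -> C) :
  (forall x, inI T x -> @continuous R_UniformSpace C_UniformSpace f x) -> cont_on T f.
Proof.
  intros H t Ht. eapply filterlim_filter_le_1; [|apply H, Ht].
  intros P HP. unfold within. revert HP. apply filter_imp. auto.
Qed.

Lemma cont_on_eps (T : R) (f : R -> C) : cont_on T f <->
  forall t eps, inI T t -> 0 < eps ->
  exists d, 0 < d /\ forall s, inI T s -> Rabs (s - t) < d -> Cmod (f s - f t) < eps.
Proof.
  split.
  - intros H t eps Ht He.
    destruct (proj1 (filterlim_C_Cmod _ f (f t)) (H t Ht) eps He) as [d Hd].
    exists d; split; [apply cond_pos|]. intros s Hs Hst. apply Hd; auto.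
  - intros H t Ht. apply filterlim_C_Cmod; [typeclasses eauto|].
    intros eps He. destruct (H t eps Ht He) as [d [Hd0 Hd]].
    exists (mkposreal d Hd0). intros s Hs HI. apply Hd; auto.
Qed.

Lemma cont_on_ext (T : R) (f g : R -> C) :
  (forall t, inI T t -> f t = g t) -> cont_on T f -> cont_on T g.
Proof.
  intros E H. rewrite cont_on_eps in *. intros t eps Ht He.
  destruct (H t eps Ht He) as [d [Hd0 Hd]]. exists d; split; auto.
  intros s Hs Hst. rewrite <- !E by assumption. auto.
Qed.

Lemma cont_on_const (T : R) (c : C) : cont_on T (fun _ => c).
Proof. intros t Ht. apply filterlim_const. Qed.

Lemma cont_on_plus (T : R) (f g : R -> C) : cont_on T f -> cont_on T g ->
  cont_on T (fun s => f s + g s)%C.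
Proof. intros Hf Hg t Ht. apply filterlim_Cplus; auto. typeclasses eauto. Qed.

Lemma cont_on_mult (T : R) (f g : R -> C) : cont_on T f -> cont_on T g ->
  cont_on T (fun s => f s * g s)%C.
Proof. intros Hf Hg t Ht. apply filterlim_Cmult; auto. typeclasses eauto. Qed.

Lemma cont_on_scal (T : R) (c : C) (f : R -> C) : cont_on T f -> cont_on T (fun s => c * f s)%C.
Proof. intro. apply cont_on_mult; [apply cont_on_const|assumption]. Qed.

Lemma cont_on_minus (T : R) (f g : R -> C) : cont_on T f -> cont_on T g ->
  cont_on T (fun s => f s - g s)%C.
Proof.
  intros Hf Hg. apply cont_on_ext with (fun s => f s + (-(1)) * g s)%C.
  - intros; ring.
  - apply cont_on_plus; [|apply cont_on_scal]; assumption.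
Qed.

Lemma cont_on_gsum (T : R) (n : nat) (f : nat -> R -> C) :
  (forall j, (j < n)%nat -> cont_on T (f j)) ->
  cont_on T (fun s => @gsum C_AbelianGroup n (fun j => f j s)).
Proof.
  induction n as [|n IH]; intro H; simpl.
  - apply cont_on_const.
  - apply (cont_on_plus T (fun s => @gsum C_AbelianGroup n (fun j => f j s)) (f n)).
    + apply IH. auto.
    + apply H. lia.
Qed.

Lemma cont_on_uniform_limit (T : R) (f : R -> C) :
  (forall eps, 0 < eps -> exists g, cont_on T g /\ forall s, inI T s -> Cmod (f s - g s) <= eps) ->
  cont_on T f.
Proof.
  intro H. apply cont_on_eps. intros t eps Ht He.
  destruct (H (eps / 4)) as [g [Hg Hfg]]; [lra|].
  destruct (proj1 (cont_on_eps _ _) Hg t (eps / 4) Ht) as [d [Hd0 Hd]]; [lra|].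
  exists d. split; [assumption|]. intros s Hs Hst.
  replace (f s - f t)%C with ((f s - g s) + ((g s - g t) + - (f t - g t)))%C by ring.
  eapply Rle_lt_trans; [apply Cmod_triangle|].
  eapply Rle_lt_trans; [apply Rplus_le_compat_l, Cmod_triangle|].
  rewrite Cmod_opp. pose proof (Hfg s Hs). pose proof (Hfg t Ht). pose proof (Hd s Hs Hst). lra.
Qed.

Lemma cont_on_bounded (T : R) (f : R -> C) : 0 <= T -> cont_on T f ->
  exists M, 0 <= M /\ forall t, inI T t -> Cmod (f t) <= M.
Proof.
  intros HT Hf.
  destruct (continuity_ab_maj (fun s => Cmod (f (clamp T s))) 0 T HT) as [x [Hx _]].
  - intros c _. apply continuity_pt_filterlim.
    apply (filterlim_comp R C R (fun s => f (clamp T s)) Cmod (locally c) (locally (f (clamp T c)))).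
    + apply continuous_clamp; assumption.
    + apply filterlim_locally. intro eps. apply locally_C_Cmod. exists eps.
      intros z Hz. change (Rabs (Cmod z - Cmod (f (clamp T c))) < eps).
      eapply Rle_lt_trans; [|exact Hz].
      pose proof (Cmod_triangle (z - f (clamp T c)) (f (clamp T c))) as H1.
      pose proof (Cmod_triangle (f (clamp T c) - z) z) as H2.
      replace (z - f (clamp T c) + f (clamp T c))%C with z in H1 by ring.
      replace (f (clamp T c) - z + z)%C with (f (clamp T c)) in H2 by ring.
      replace (f (clamp T c) - z)%C with (- (z - f (clamp T c)))%C in H2 by ring.
      rewrite Cmod_opp in H2. unfold Rabs; destruct Rcase_abs; lra.
  - exists (Cmod (f (clamp T x))). split; [apply Cmod_ge_0|].
    intros t Ht. rewrite <- (clamp_id T t) at 1 by assumption. apply Hx, Ht.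
Qed.

Lemma norm_max_ge (T : R) (f : R -> C) (t : R) : cont_on T f -> inI T t -> Cmod (f t) <= norm_max T f.
Proof.
  intros Hf Ht.
  destruct (cont_on_bounded T f) as [M [HM0 HM]]; [unfold inI in Ht; lra|assumption|].
  unfold norm_max.
  destruct (Lub_Rbar_correct (fun r => exists t, inI T t /\ r = Cmod (f t))) as [H1 H2].
  assert (Hu : Rbar_le (Cmod (f t)) (Lub_Rbar (fun r => exists t, inI T t /\ r = Cmod (f t)))).
  { apply H1. exists t; auto. }
  assert (Hl : Rbar_le (Lub_Rbar (fun r => exists t, inI T t /\ r = Cmod (f t))) M).
  { apply H2. intros r [s [Hs ->]]. simpl. auto. }
  destruct Lub_Rbar; simpl in *; try contradiction; auto.
Qed.

(* The test against all continuous [k] replaces a theorem on products of Riemann integrable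
   functions; both continuous and step functions satisfy it. *)
Definition admissible (T : R) (f : R -> C) : Prop :=
  (exists M, 0 <= M /\ forall s, inI T s -> Cmod (f s) <= M) /\
  forall b (k : R -> C), 0 <= b <= T ->
    (forall s, 0 <= s <= b -> @continuous R_UniformSpace C_UniformSpace k s) ->
    @ex_RInt CR (fun s => k s * f s)%C 0 b.

Lemma admissible_cont_on (T : R) (f : R -> C) : 0 <= T -> cont_on T f -> admissible T f.
Proof.
  intros HT Hf. split.
  - apply cont_on_bounded; assumption.
  - intros b k Hb Hk. apply (ex_RInt_ext (V := CR) (fun s => k s * f (clamp T s))%C).
    + intros x Hx. rewrite Rmin_left, Rmax_right in Hx by lra.
      rewrite clamp_id; [reflexivity|unfold inI; lra].
    + apply (ex_RInt_continuous (V := CR)). intros z Hz. rewrite Rmin_left, Rmax_right in Hz by lra.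
      apply continuous_Cmult; [apply Hk; lra|apply continuous_clamp; assumption].
Qed.

Lemma admissible_plus (T : R) (f g : R -> C) : admissible T f -> admissible T g ->
  admissible T (fun s => f s + g s)%C.
Proof.
  intros [[M [HM0 HM]] Hf] [[N [HN0 HN]] Hg]. split.
  - exists (M + N). split; [lra|]. intros s Hs.
    eapply Rle_trans; [apply Cmod_triangle|]. apply Rplus_le_compat; auto.
  - intros b k Hb Hk. apply (ex_RInt_ext (V := CR) (fun s => plus (k s * f s)%C (k s * g s)%C)).
    + intros x _. change ((k x * f x + k x * g x)%C = (k x * (f x + g x))%C). ring.
    + apply (ex_RInt_plus (V := CR)); auto.
Qed.

Lemma admissible_scal (T : R) (c : C) (f : R -> C) : admissible T f ->
  admissible T (fun s => c * f s)%C.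
Proof.
  intros [[M [HM0 HM]] Hf]. split.
  - exists (Cmod c * M). split; [apply Rmult_le_pos; [apply Cmod_ge_0|assumption]|].
    intros s Hs. rewrite Cmod_mult. apply Rmult_le_compat_l; [apply Cmod_ge_0|auto].
  - intros b k Hb Hk. apply (ex_RInt_ext (V := CR) (fun s => c * (k s * f s))%C).
    + intros x _. Cring.
    + apply ex_RInt_Cmult; auto.
Qed.

Lemma admissible_minus (T : R) (f g : R -> C) : admissible T f -> admissible T g ->
  admissible T (fun s => f s - g s)%C.
Proof.
  intros Hf Hg. apply (admissible_plus T f (fun s => - g s)%C); [exact Hf|].
  replace (fun s => - g s)%C with (fun s => (-(1)) * g s)%C by (apply functional_extensionality; intro; ring).
  apply admissible_scal, Hg.
Qed.

Definition jump (r s : R) : C := if Rle_dec r s then 1%C else 0%C.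

Lemma jump_ge (r s : R) : r <= s -> jump r s = 1%C.
Proof. intro. unfold jump. destruct Rle_dec; [reflexivity|contradiction]. Qed.

Lemma jump_lt (r s : R) : s < r -> jump r s = 0%C.
Proof. intro. unfold jump. destruct Rle_dec; [lra|reflexivity]. Qed.

Lemma admissible_jump (T r : R) : 0 <= r <= T -> admissible T (jump r).
Proof.
  intro Hr. split.
  - exists 1. split; [lra|]. intros s _. unfold jump. destruct Rle_dec; rewrite ?Cmod_1, ?Cmod_0; lra.
  - intros b k Hb Hk.
    assert (E0 : forall c, c <= r -> 0 <= c -> @ex_RInt CR (fun s => k s * jump r s)%C 0 c).
    { intros c Hc Hc0. apply (ex_RInt_ext (V := CR) (fun _ => RtoC 0)).
      - intros x Hx. rewrite Rmin_left, Rmax_right in Hx by lra. rewrite jump_lt by lra. Cring.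
      - apply (ex_RInt_const (V := CR)). }
    destruct (Rle_dec b r) as [H|H]; [apply E0; lra|].
    apply (ex_RInt_Chasles (V := CR) _ 0 r b); [apply E0; lra|].
    apply (ex_RInt_ext (V := CR) k).
    + intros x Hx. rewrite Rmin_left, Rmax_right in Hx by lra. rewrite jump_ge by lra. Cring.
    + apply (ex_RInt_continuous (V := CR)). intros z Hz. rewrite Rmin_left, Rmax_right in Hz by lra.
      apply Hk. lra.
Qed.

Inductive is_step (T : R) : (R -> C) -> Prop :=
| step_jump c r : 0 <= r <= T -> is_step T (fun s => c * jump r s)%C
| step_plus f g : is_step T f -> is_step T g -> is_step T (fun s => f s + g s)%C.

Lemma admissible_step (T : R) (f : R -> C) : is_step T f -> admissible T f.
Proof.
  induction 1.
  - apply admissible_scal, admissible_jump; assumption.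
  - apply admissible_plus; assumption.
Qed.

Lemma step_approx (T : R) (f : R -> C) (eps : R) : 0 < T -> cont_on T f -> 0 < eps ->
  exists g, is_step T g /\ forall s, inI T s -> Cmod (f s - g s) <= eps.
Proof.
  intros HT Hf He.
  destruct (unifcont_normed_1d (V := C_R_NormedModule) (fun s => f (clamp T s)) 0 T
    (fun x _ => continuous_clamp T f x (Rlt_le _ _ HT) Hf) (mkposreal eps He)) as [dl Hdl].
  destruct (archimed_cor1 (dl / T)) as [N [HN HN0]].
  { apply Rdiv_lt_0_compat; [apply cond_pos|assumption]. }
  set (h := T / INR N).
  assert (HNp : 0 < INR N) by (apply lt_0_INR; assumption).
  assert (Hh : 0 < h) by (apply Rdiv_lt_0_compat; lra).
  assert (Hhd : h < dl).
  { unfold h, Rdiv. apply Rmult_lt_reg_l with (/ T); [apply Rinv_0_lt_compat; lra|].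
    rewrite <- Rmult_assoc, Rinv_l, Rmult_1_l by lra. unfold Rdiv in HN. lra. }
  assert (HNh : INR N * h = T) by (unfold h; field; lra).
  assert (Hn : forall n, (n <= N)%nat -> exists g, is_step T g /\
     (forall s, INR n * h <= s -> g s = f (INR n * h)) /\
     (forall s, 0 <= s <= INR n * h + h -> exists r, 0 <= r <= INR n * h /\ g s = f r /\ r <= s <= r + h)).
  { induction n as [|n IH]; intro Hle.
    - exists (fun s => f 0 * jump 0 s)%C. split; [apply step_jump; lra|]. simpl. rewrite Rmult_0_l. split.
      + intros s Hs. rewrite jump_ge by assumption. ring.
      + intros s Hs. exists 0. rewrite jump_ge by lra. split; [lra|]. split; [ring|lra].
    - destruct IH as [g [Hg1 [Hg2 Hg3]]]; [lia|].
      pose proof (pos_INR n).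
      assert (HleR : INR (S n) <= INR N) by (apply le_INR; assumption).
      assert (HlT : INR (S n) * h <= T).
      { rewrite <- HNh. apply Rmult_le_compat_r; lra. }
      rewrite S_INR in *.
      assert (0 <= INR n * h) by (apply Rmult_le_pos; lra).
      exists (fun s => g s + (f ((INR n + 1) * h)%R - f (INR n * h)%R) * jump ((INR n + 1) * h)%R s)%C.
      split; [|split].
      + apply step_plus; [assumption|apply step_jump]. split; lra.
      + intros s Hs. rewrite jump_ge, Hg2 by lra. ring.
      + intros s Hs. destruct (Rle_dec ((INR n + 1) * h)%R s) as [H1|H1].
        * exists ((INR n + 1) * h)%R. split; [lra|]. split; [|lra].
          rewrite jump_ge, Hg2 by lra. ring.
        * destruct (Hg3 s) as [r [Hr1 [Hr2 Hr3]]]; [lra|].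
          exists r. split; [lra|]. split; [|assumption].
          rewrite jump_lt by lra. rewrite <- Hr2. ring. }
  destruct (Hn N (le_n N)) as [g [Hg1 [_ Hg3]]].
  exists g. split; [assumption|]. intros s Hs. unfold inI in Hs.
  destruct (Hg3 s) as [r [Hr1 [Hr2 Hr3]]]; [lra|].
  rewrite Hr2. left.
  assert (Hsr : ball r dl s).
  { change (Rabs (s - r) < dl). apply Rabs_def1; lra. }
  assert (0 <= r <= T) as HrT by lra.
  specialize (Hdl r s HrT Hs Hsr).
  unfold ball_norm in Hdl. rewrite norm_C_R in Hdl. rewrite !clamp_id in Hdl by (unfold inI; lra).
  exact Hdl.
Qed.

(** * Unnormalised fractional integrals *)

Lemma exp_monotone (x y : R) : x <= y -> exp x <= exp y.
Proof. intros [H| ->]; [left; apply exp_increasing, H|right; reflexivity]. Qed.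

Definition increasing_C1 (phi phi' : R -> R) : Prop :=
  forall s, is_derive phi s (phi' s) /\ continuous phi' s /\ 0 < phi' s.

Definition kernel (phi phi' : R -> R) (alpha : C) (t s : R) : C :=
  (RtoC (phi' s) * cpow (phi t - phi s) (alpha - 1))%C.

Definition kernel_mod (phi phi' : R -> R) (a t s : R) : R :=
  phi' s * Rpower (phi t - phi s) (a - 1).

Definition Jint (phi phi' : R -> R) (alpha : C) (f : R -> C) (t : R) : C :=
  cint0 (fun s => kernel phi phi' alpha t s * f s)%C t.

Section Jint.

Variables phi phi' : R -> R.
Hypothesis Hphi : increasing_C1 phi phi'.

Let kern := kernel phi phi'.
Let rkern := kernel_mod phi phi'.
Let J := Jint phi phi'.

Lemma phi_lt (s t : R) : s < t -> phi s < phi t.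
Proof.
  intro H. destruct (MVT_gen phi s t phi') as [c [Hc E]].
  - intros; apply Hphi.
  - intros x _. apply continuity_pt_filterlim.
    apply (ex_derive_continuous (V := R_NormedModule)). exists (phi' x). apply Hphi.
  - destruct (Hphi c) as [_ [_ Hp]].
    assert (0 < phi' c * (t - s)) by (apply Rmult_lt_0_compat; lra). lra.
Qed.

Lemma phi_le (s t : R) : s <= t -> phi s <= phi t.
Proof. intros [H| ->]; [left; apply phi_lt, H|right; reflexivity]. Qed.

Lemma phi_continuous (s : R) : continuous phi s.
Proof. apply (ex_derive_continuous (V := R_NormedModule)). exists (phi' s). apply Hphi. Qed.

Lemma continuous_phi_diff (t s : R) : continuous (fun u => phi t - phi u) s.
Proof.
  apply (continuous_minus (V := R_NormedModule)); [apply continuous_const|apply phi_continuous].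
Qed.

Lemma continuous_cpow_phi (z : C) (t s : R) : s < t ->
  @continuous R_UniformSpace C_UniformSpace (fun u => cpow (phi t - phi u) z) s.
Proof.
  intro H. apply (continuous_comp (fun u => phi t - phi u) (fun x => cpow x z)).
  - apply continuous_phi_diff.
  - apply continuous_cpow. pose proof (phi_lt s t H). lra.
Qed.

Lemma kern_continuous (alpha : C) (t s : R) : s < t ->
  @continuous R_UniformSpace C_UniformSpace (kern alpha t) s.
Proof.
  intro H. apply continuous_Cmult.
  - apply continuous_RtoC. apply Hphi.
  - apply continuous_cpow_phi, H.
Qed.

Lemma Cmod_kern (alpha : C) (t s : R) : Cmod (kern alpha t s) = rkern (Re alpha) t s.
Proof.
  unfold kern, rkern, kernel, kernel_mod. rewrite Cmod_mult, Cmod_R, Cmod_cpow.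
  rewrite Rabs_right; [|left; apply Hphi].
  do 2 f_equal.
Qed.

Lemma rkern_continuous (a t s : R) : s < t -> continuous (rkern a t) s.
Proof.
  intro H. unfold rkern, kernel_mod. apply (continuous_mult (K := R_AbsRing)).
  - apply Hphi.
  - apply (continuous_comp (fun u => phi t - phi u) (fun x => Rpower x (a - 1))).
    + apply continuous_phi_diff.
    + apply (ex_derive_continuous (V := R_NormedModule)). eexists.
      apply is_derive_Reals, derivable_pt_lim_power. pose proof (phi_lt s t H). lra.
Qed.

Lemma rkern_pos (a t s : R) : 0 < rkern a t s.
Proof. apply Rmult_lt_0_compat; [apply Hphi|apply exp_pos]. Qed.

Lemma is_derive_cpow_phi (z : C) (t s : R) : s < t ->
  @is_derive R_AbsRing C_R_NormedModule (fun u => cpow (phi t - phi u) z) s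
    (- (z * kern z t s))%C.
Proof.
  intro H.
  pose proof (phi_lt s t H).
  assert (D : is_derive (fun u => phi t - phi u) s (- phi' s)).
  { replace (- phi' s) with (@minus R_AbelianGroup 0 (phi' s)) by (unfold minus, plus, opp; simpl; ring).
    apply (is_derive_minus (V := R_NormedModule) (fun _ => phi t) phi); [apply @is_derive_const|apply Hphi]. }
  pose proof (is_derive_comp (V := C_R_NormedModule) (fun x => cpow x z) _ s _ _ (is_derive_cpow z (phi t - phi s) ltac:(lra)) D) as E.
  replace (- (z * kern z t s))%C with (@scal R_AbsRing C_R_NormedModule (- phi' s) (z * cpow (phi t - phi s) (z - 1))%C); [exact E|].
  rewrite scal_C_R, RtoC_opp. unfold kern, kernel. Cring.
Qed.

Lemma filterlim_cpow0_at_left (z : C) (t : R) : 0 < Re z ->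
  filterlim (fun b => cpow0 (phi t - phi b) z) (at_left t) (locally (RtoC 0)).
Proof.
  intro Hz. rewrite <- (cpow0_neg (phi t - phi t) z) by lra.
  eapply filterlim_filter_le_1.
  2:{ apply (continuous_comp (fun u => phi t - phi u) (fun x => cpow0 x z) t).
      - apply continuous_phi_diff.
      - apply continuous_cpow0, Hz. }
  intros P HP. unfold at_left, within. revert HP. apply filter_imp; auto.
Qed.

Lemma is_RInt_gen_kern (alpha : C) (r t : R) : 0 < Re alpha -> r < t ->
  @is_RInt_gen CR (kern alpha t) (at_point r) (at_left t) (cpow (phi t - phi r) alpha / alpha)%C.
Proof.
  intros Ha Hrt.
  assert (Ha0 : alpha <> 0%C).
  { intros ->. simpl in Ha. lra. }
  apply is_RInt_gen_right with (I := fun b => ((cpow (phi t - phi r) alpha - cpow0 (phi t - phi b) alpha) / alpha)%C).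
  - typeclasses eauto.
  - generalize (at_left_between r t Hrt). apply filter_imp. intros b Hb.
    pose proof (phi_lt b t (proj2 Hb)).
    rewrite cpow0_pos by lra.
    assert (E : @is_RInt CR (fun s => - (alpha * kern alpha t s))%C r b
        (minus (cpow (phi t - phi b) alpha) (cpow (phi t - phi r) alpha))).
    { apply (is_RInt_derive (V := CR) (fun u => cpow (phi t - phi u) alpha)).
      - intros x Hx. rewrite Rmin_left, Rmax_right in Hx by lra. apply is_derive_cpow_phi. lra.
      - intros x Hx. rewrite Rmin_left, Rmax_right in Hx by lra.
        apply (continuous_ext (fun s => - alpha * kern alpha t s)%C); [intro; Cring|].
        apply continuous_Cmult; [apply continuous_Cconst|apply kern_continuous; lra]. }
    apply (is_RInt_Cmult _ (- / alpha)%C) in E.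
    replace ((cpow (phi t - phi r) alpha - cpow (phi t - phi b) alpha) / alpha)%C
      with (- / alpha * minus (cpow (phi t - phi b) alpha) (cpow (phi t - phi r) alpha))%C.
    + revert E. apply is_RInt_ext. intros s _.
      change ((- / alpha * (- (alpha * kern alpha t s)))%C = kern alpha t s). field. exact Ha0.
    + change minus with Cminus. field. exact Ha0.
  - replace (cpow (phi t - phi r) alpha / alpha)%C with ((cpow (phi t - phi r) alpha + (-(1)) * 0) * / alpha)%C by (field; exact Ha0).
    apply filterlim_Cmult; [typeclasses eauto| |apply filterlim_const].
    apply (filterlim_ext (fun b => (cpow (phi t - phi r) alpha + (-(1)) * cpow0 (phi t - phi b) alpha)%C)); [intro; ring|].
    apply filterlim_Cplus; [typeclasses eauto|apply filterlim_const|].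
    apply filterlim_Cmult; [typeclasses eauto|apply filterlim_const|].
    apply filterlim_cpow0_at_left, Ha.
Qed.

Lemma is_RInt_gen_fst (f : R -> C) (Fa Fb : (R -> Prop) -> Prop) {HFa : Filter Fa} {HFb : Filter Fb} (l : C) :
  @is_RInt_gen CR f Fa Fb l -> @is_RInt_gen R_NormedModule (fun x => fst (f x)) Fa Fb (fst l).
Proof.
  intros H P [eps HP].
  assert (HQ : locally l (fun z : C => P (fst z))).
  { exists eps. intros z Hz. apply HP, Hz. }
  generalize (H _ HQ). unfold filtermapi. apply filter_imp. intros ab [y [H1 H2]].
  exists (fst y). split; [|exact H2].
  apply (is_RInt_fct_extend_fst (U := R_NormedModule) (V := R_NormedModule) f _ _ _ H1).
Qed.

Lemma is_RInt_gen_rkern (a r t : R) : 0 < a -> r < t ->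
  @is_RInt_gen R_NormedModule (rkern a t) (at_point r) (at_left t) (Rpower (phi t - phi r) a / a).
Proof.
  intros Ha Hrt.
  pose proof (is_RInt_gen_kern (RtoC a) r t Ha Hrt) as H.
  apply is_RInt_gen_fst in H; [|typeclasses eauto|typeclasses eauto].
  rewrite cpow_RtoC in H. unfold Cdiv in H. rewrite <- RtoC_inv, <- RtoC_mult in H by lra.
  revert H. apply is_RInt_gen_at_left_ext; [assumption|].
  intros s Hs. unfold kern, kernel. rewrite <- RtoC_minus, cpow_RtoC, <- RtoC_mult. reflexivity.
Qed.

Lemma is_RInt_gen_J (T : R) (alpha : C) (f : R -> C) (t : R) : 0 < t <= T -> 0 < Re alpha ->
  admissible T f ->
  @is_RInt_gen CR (fun s => kern alpha t s * f s)%C (at_point 0) (at_left t) (J alpha f t).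
Proof.
  intros Ht Ha [[M [HM0 HM]] Hf].
  assert (E : exists l, @is_RInt_gen CR (fun s => kern alpha t s * f s)%C (at_point 0) (at_left t) l).
  { apply (ex_RInt_gen_dominated (V := CR) _ (fun s => M * rkern (Re alpha) t s) 0 (at_left t)
      (fun b => 0 < b < t) (M * (Rpower (phi t - phi 0) (Re alpha) / Re alpha))).
    - apply at_left_between; lra.
    - intros b Hb; lra.
    - intros b Hb. apply Hf; [lra|]. intros s Hs. apply kern_continuous. lra.
    - intros b Hb. apply (ex_RInt_continuous (V := R_CompleteNormedModule)).
      intros z Hz. rewrite Rmin_left, Rmax_right in Hz by lra.
      apply (continuous_scal_r (V := R_NormedModule) M). apply rkern_continuous. lra.
    - intros b x Hb Hx. rewrite norm_C_R, Cmod_mult, Cmod_kern, Rmult_comm.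
      apply Rmult_le_compat_r; [left; apply rkern_pos|]. apply HM. unfold inI; lra.
    - apply (is_RInt_gen_scal (V := R_NormedModule) (rkern (Re alpha) t) M).
      apply is_RInt_gen_rkern; lra. }
  destruct E as [l Hl]. unfold J, Jint. rewrite (cint0_eq _ t l); [exact Hl|lra|exact Hl].
Qed.

Lemma is_RInt_gen_rkern_exp (a nu t : R) : 0 < a -> 0 < t -> 0 < nu ->
  @is_RInt_gen R_NormedModule (fun s => rkern a t s * exp (nu * s)) (at_point 0) (at_left t)
    (rint0 (fun s => phi' s * Rpower (phi t - phi s) (a - 1) * exp (nu * s)) t).
Proof.
  intros Ha Ht Hnu.
  assert (E : exists l, @is_RInt_gen R_NormedModule (fun s => rkern a t s * exp (nu * s)) (at_point 0) (at_left t) l).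
  { apply (ex_RInt_gen_dominated (V := R_CompleteNormedModule) _ (fun s => exp (nu * t) * rkern a t s) 0 (at_left t)
      (fun b => 0 < b < t) (exp (nu * t) * (Rpower (phi t - phi 0) a / a))).
    - apply at_left_between; lra.
    - intros b Hb; lra.
    - intros b Hb. apply (ex_RInt_continuous (V := R_CompleteNormedModule)).
      intros z Hz. rewrite Rmin_left, Rmax_right in Hz by lra.
      apply (continuous_mult (K := R_AbsRing)).
      + apply rkern_continuous. lra.
      + apply (ex_derive_continuous (V := R_NormedModule)). auto_derive. auto.
    - intros b Hb. apply (ex_RInt_continuous (V := R_CompleteNormedModule)).
      intros z Hz. rewrite Rmin_left, Rmax_right in Hz by lra.
      apply (continuous_scal_r (V := R_NormedModule) (exp (nu * t))). apply rkern_continuous. lra.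
    - intros b x Hb Hx.
      pose proof (rkern_pos a t x). pose proof (exp_pos (nu * x)).
      change (Rabs (rkern a t x * exp (nu * x)) <= exp (nu * t) * rkern a t x).
      rewrite Rabs_right; [|apply Rle_ge, Rmult_le_pos; lra].
      rewrite Rmult_comm. apply Rmult_le_compat_r; [lra|].
      apply exp_monotone. apply Rmult_le_compat_l; lra.
    - apply (is_RInt_gen_scal (V := R_NormedModule) (rkern a t) (exp (nu * t))).
      apply is_RInt_gen_rkern; lra. }
  destruct E as [l Hl]. rewrite (rint0_eq _ t l); [exact Hl|lra|exact Hl].
Qed.

Lemma Cmod_J_le (T : R) (alpha : C) (f : R -> C) (t M : R) : 0 < t <= T -> 0 < Re alpha ->
  admissible T f -> (forall s, 0 <= s < t -> Cmod (f s) <= M) ->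
  Cmod (J alpha f t) <= M * (Rpower (phi t - phi 0) (Re alpha) / Re alpha).
Proof.
  intros Ht Ha Hf HM.
  apply (Cmod_RInt_gen_at_left_le (fun s => kern alpha t s * f s)%C (fun s => M * rkern (Re alpha) t s) 0 t); [lra| | |].
  - intros s Hs. rewrite Cmod_mult, Cmod_kern, Rmult_comm.
    apply Rmult_le_compat_r; [left; apply rkern_pos|]. apply HM; lra.
  - apply (is_RInt_gen_J T); assumption.
  - apply (is_RInt_gen_scal (V := R_NormedModule) (rkern (Re alpha) t) M).
    apply is_RInt_gen_rkern; lra.
Qed.

Lemma Cmod_J_exp_le (T nu : R) (alpha : C) (f : R -> C) (t M : R) : 0 < t <= T -> 0 < nu -> 0 < Re alpha ->
  admissible T f -> (forall s, 0 <= s < t -> Cmod (f s) <= M * exp (nu * s)) ->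
  Cmod (J alpha f t) <=
    M * rint0 (fun s => phi' s * Rpower (phi t - phi s) (Re alpha - 1) * exp (nu * s)) t.
Proof.
  intros Ht Hnu Ha Hf HM.
  apply (Cmod_RInt_gen_at_left_le (fun s => kern alpha t s * f s)%C (fun s => M * (rkern (Re alpha) t s * exp (nu * s))) 0 t); [lra| | |].
  - intros s Hs. rewrite Cmod_mult, Cmod_kern.
    replace (M * (rkern (Re alpha) t s * exp (nu * s))) with (rkern (Re alpha) t s * (M * exp (nu * s))) by ring.
    apply Rmult_le_compat_l; [left; apply rkern_pos|]. apply HM; lra.
  - apply (is_RInt_gen_J T); assumption.
  - apply (is_RInt_gen_scal (V := R_NormedModule) (fun s => rkern (Re alpha) t s * exp (nu * s)) M).
    apply is_RInt_gen_rkern_exp; lra.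
Qed.

Lemma J_0 (alpha : C) (f : R -> C) : J alpha f 0 = 0%C.
Proof. apply cint0_0. Qed.

Lemma J_ext (alpha : C) (f g : R -> C) (t : R) : (forall s, 0 < s < t -> f s = g s) ->
  J alpha f t = J alpha g t.
Proof. intro E. apply cint0_ext. intros s Hs. rewrite E by assumption. reflexivity. Qed.

Lemma J_plus (T : R) (alpha : C) (f g : R -> C) (t : R) : inI T t -> 0 < Re alpha ->
  admissible T f -> admissible T g ->
  J alpha (fun s => f s + g s)%C t = (J alpha f t + J alpha g t)%C.
Proof.
  intros Ht Ha Hf Hg. unfold inI in Ht.
  destruct (Req_dec t 0) as [->|H0]; [rewrite !J_0; ring|].
  apply cint0_eq; [lra|].
  apply (is_RInt_gen_at_left_ext (fun s => @plus CR (kern alpha t s * f s)%C (kern alpha t s * g s)%C)); [lra| |].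
  - intros s _. change ((kern alpha t s * f s + kern alpha t s * g s)%C = (kern alpha t s * (f s + g s))%C). ring.
  - apply (is_RInt_gen_plus (V := CR)); apply (is_RInt_gen_J T); auto; lra.
Qed.

Lemma J_scal (T : R) (alpha c : C) (f : R -> C) (t : R) : inI T t -> 0 < Re alpha ->
  admissible T f -> J alpha (fun s => c * f s)%C t = (c * J alpha f t)%C.
Proof.
  intros Ht Ha Hf. unfold inI in Ht.
  destruct (Req_dec t 0) as [->|H0]; [rewrite !J_0; ring|].
  apply cint0_eq; [lra|].
  apply (is_RInt_gen_at_left_ext (V := CR) (fun s => c * (kern alpha t s * f s))%C); [lra| |].
  - intros s _. change ((c * (kern alpha t s * f s))%C = (kern alpha t s * (c * f s))%C). ring.
  - apply is_RInt_gen_Cmult; [typeclasses eauto|typeclasses eauto|]. apply (is_RInt_gen_J T); auto; lra.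
Qed.

Lemma J_minus (T : R) (alpha : C) (f g : R -> C) (t : R) : inI T t -> 0 < Re alpha ->
  admissible T f -> admissible T g ->
  J alpha (fun s => f s - g s)%C t = (J alpha f t - J alpha g t)%C.
Proof.
  intros Ht Ha Hf Hg.
  rewrite (J_ext alpha _ (fun s => f s + (-(1)) * g s)%C); [|intros; ring].
  rewrite (J_plus T), (J_scal T); auto using admissible_scal. ring.
Qed.

Lemma J_supported (alpha : C) (f : R -> C) (r t : R) (l : C) : 0 <= r < t ->
  @is_RInt_gen CR (fun s => kern alpha t s * f s)%C (at_point r) (at_left t) l ->
  (forall s, s < r -> f s = 0%C) -> J alpha f t = l.
Proof.
  intros Hr Hl H0. apply cint0_eq; [lra|].
  rewrite <- (Cplus_0_l l). apply (is_RInt_gen_Chasles (V := CR) _ r); [|exact Hl].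
  apply is_RInt_gen_at_point.
  apply (is_RInt_ext (V := CR) (fun _ => RtoC 0)).
  - intros x Hx. rewrite Rmin_left, Rmax_right in Hx by lra. rewrite H0 by lra. Cring.
  - pose proof (is_RInt_const (V := CR) 0 r (RtoC 0)) as E.
    rewrite scal_C_R in E. replace (RtoC (r - 0) * 0)%C with (RtoC 0) in E by ring. exact E.
Qed.

Lemma J_zero_below (alpha : C) (f : R -> C) (r t : R) : t <= r ->
  (forall s, s < r -> f s = 0%C) -> J alpha f t = 0%C.
Proof.
  intros Htr H0. destruct (Rlt_dec 0 t) as [Ht|Ht].
  - apply cint0_eq; [exact Ht|].
    apply (is_RInt_gen_at_left_ext (V := CR) (fun s => RtoC 0)); [exact Ht| |].
    + intros s Hs. rewrite H0 by lra. Cring.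
    + apply is_RInt_gen_right with (I := fun _ => RtoC 0); [typeclasses eauto| |apply filterlim_const].
      apply filter_forall. intro b. pose proof (is_RInt_const (V := CR) 0 b (RtoC 0)) as E.
      rewrite scal_C_R in E. replace (RtoC (b - 0) * 0)%C with (RtoC 0) in E by ring. exact E.
  - unfold J, Jint, cint0. destruct Rlt_dec; [contradiction|reflexivity].
Qed.

Lemma J_jump (alpha : C) (r t : R) : 0 <= r -> 0 < Re alpha ->
  J alpha (jump r) t = (cpow0 (phi t - phi r) alpha / alpha)%C.
Proof.
  intros Hr Ha. destruct (Rle_dec t r) as [H|H].
  - rewrite (J_zero_below _ _ r); auto using jump_lt.
    rewrite cpow0_neg; [unfold Cdiv; ring|]. pose proof (phi_le t r H). lra.
  - pose proof (phi_lt r t ltac:(lra)). rewrite cpow0_pos by lra.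
    apply J_supported with r; [lra| |auto using jump_lt].
    apply (is_RInt_gen_at_left_ext (V := CR) (kern alpha t)); [lra| |].
    + intros s Hs. rewrite jump_ge by lra. Cring.
    + apply is_RInt_gen_kern; [assumption|lra].
Qed.

End Jint.

Lemma increasing_C1_id : increasing_C1 (fun s => s) (fun _ => 1).
Proof.
  intro s. split; [apply (is_derive_id (K := R_AbsRing))|]. split; [apply continuous_const|lra].
Qed.

(* Euler's beta integral B(alpha, beta + 1); the shift keeps the integrand regular at 0. *)
Definition beta_succ (alpha beta : C) : C :=
  Jint (fun s => s) (fun _ => 1) alpha (fun s => cpow0 s beta) 1.

Section Composition.

Variables phi phi' : R -> R.
Hypothesis Hphi : increasing_C1 phi phi'.

Let kern := kernel phi phi'.
Let J := Jint phi phi'.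

Lemma J_cpow0 (alpha beta : C) (r t : R) : 0 <= r -> 0 < Re alpha -> 0 < Re beta ->
  J alpha (fun s => cpow0 (phi s - phi r) beta) t =
  (beta_succ alpha beta * cpow0 (phi t - phi r) (alpha + beta))%C.
Proof.
  intros Hr Ha Hb. destruct (Rle_dec t r) as [H|H].
  { unfold J. rewrite (J_zero_below _ _ _ _ r); auto.
    - rewrite cpow0_neg; [ring|]. pose proof (phi_le _ _ Hphi t r H). lra.
    - intros s Hs. apply cpow0_neg. pose proof (phi_lt _ _ Hphi s r Hs). lra. }
  assert (Hrt : r < t) by lra. clear H.
  pose proof (phi_lt _ _ Hphi r t Hrt) as HX.
  set (X := phi t - phi r). assert (X0 : 0 < X) by (unfold X; lra).
  rewrite cpow0_pos by exact X0.
  set (q := fun u => (kernel (fun s => s) (fun _ => 1) alpha 1 u * cpow0 u beta)%C).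
  set (g := fun s => (phi s - phi r) / X).
  assert (Hg : forall s, is_derive g s (phi' s / X)).
  { intro s. unfold g.
    replace (phi' s / X) with (@scal R_AbsRing R_NormedModule (/ X) (@minus R_AbelianGroup (phi' s) 0)).
    2:{ unfold scal, minus, plus, opp; simpl; unfold mult; simpl. field; lra. }
    apply (is_derive_ext (fun s => @scal R_AbsRing R_NormedModule (/ X) (phi s - phi r))).
    { intro u. unfold scal; simpl; unfold mult; simpl. field; lra. }
    apply is_derive_scal.
    apply (is_derive_minus (V := R_NormedModule) phi (fun _ => phi r)); [apply Hphi|apply @is_derive_const]. }
  assert (Hg1 : forall s, s < t -> g s < 1).
  { intros s Hs. pose proof (phi_lt _ _ Hphi s t Hs). unfold g.
    apply Rmult_lt_reg_r with X; [exact X0|]. unfold Rdiv. rewrite Rmult_assoc, Rinv_l; unfold X in *; lra. }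
  assert (Hgr : g r = 0) by (unfold g; field; lra).
  assert (Hgt : g t = 1) by (unfold g, X; field; unfold X in X0; lra).
  assert (Hq : @is_RInt_gen CR q (at_point 0) (at_left 1) (beta_succ alpha beta)).
  { apply (is_RInt_gen_J _ _ increasing_C1_id 1); [lra|assumption|].
    apply admissible_cont_on; [lra|]. apply continuous_cont_on. intros; apply continuous_cpow0, Hb. }
  apply (is_RInt_gen_right_lim (V := CR)) in Hq; [|typeclasses eauto].
  apply J_supported with r; [lra| |].
  2:{ intros s Hs. apply cpow0_neg. pose proof (phi_lt _ _ Hphi s r Hs). lra. }
  apply is_RInt_gen_right with (I := fun b => (@RInt CR q 0 (g b) * cpow X (alpha + beta))%C).
  - typeclasses eauto.
  - generalize (at_left_between r t Hrt). apply filter_imp. intros b Hb'.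
    assert (E : @is_RInt CR (fun y => scal (phi' y / X) (q (g y))) r b (@RInt CR q 0 (g b))).
    { rewrite <- Hgr. apply (is_RInt_comp (V := CR) q g (fun y => phi' y / X)).
      - intros x Hx. rewrite Rmin_left, Rmax_right in Hx by lra.
        apply continuous_Cmult; [|apply continuous_cpow0, Hb].
        apply kern_continuous; [apply increasing_C1_id|]. apply Hg1. lra.
      - intros x Hx. split; [apply Hg|].
        apply (continuous_mult (K := R_AbsRing)); [apply Hphi|apply continuous_const]. }
    apply (is_RInt_Cmult _ (cpow X (alpha + beta))) in E.
    rewrite Cmult_comm. revert E. apply is_RInt_ext. intros s Hs. rewrite Rmin_left, Rmax_right in Hs by lra.
    pose proof (phi_lt _ _ Hphi r s ltac:(lra)). pose proof (phi_lt _ _ Hphi s t ltac:(lra)).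
    rewrite scal_C_R. unfold q, kernel.
    assert (G0 : 0 < g s) by (unfold g; apply Rdiv_lt_0_compat; lra).
    pose proof (Hg1 s ltac:(lra)).
    replace (phi t - phi s) with (X * (1 - g s)) by (unfold g, X; field; unfold X in X0; lra).
    replace (phi s - phi r) with (X * g s) by (unfold g, X; field; unfold X in X0; lra).
    rewrite !cpow0_pos by (assumption || (apply Rmult_lt_0_compat; lra)).
    rewrite !cpow_mult_base by lra.
    rewrite cpow_plus, (cpow_split X alpha) by exact X0.
    unfold Rdiv. rewrite RtoC_mult, RtoC_inv by lra.
    match goal with |- @eq _ ?a ?b => change (@eq C a b) end. field. apply RtoC_neq_0. lra.
  - apply filterlim_Cmult; [typeclasses eauto| |apply filterlim_const].
    apply (filterlim_comp _ _ _ g (fun c => @RInt CR q 0 c) (at_left t) (at_left 1)); [|exact Hq].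
    intros P [e He].
    assert (Cg : continuous g t).
    { apply (ex_derive_continuous (V := R_NormedModule)). eexists. apply Hg. }
    pose proof (proj1 (filterlim_locally _ _) Cg e) as Hl. rewrite Hgt in Hl.
    unfold filtermap, at_left, within. revert Hl. apply filter_imp.
    intros s Hs Hst. apply He; [exact Hs|apply Hg1, Hst].
Qed.

Lemma neq_0_Re_pos (z : C) : 0 < Re z -> z <> 0%C.
Proof. intros H ->. simpl in H. lra. Qed.

Lemma cont_on_J_step (T : R) (alpha : C) (f : R -> C) : 0 < Re alpha -> is_step T f ->
  cont_on T (J alpha f).
Proof.
  intros Ha. induction 1 as [c r Hr|f g Hf IHf Hg IHg].
  - apply cont_on_ext with (fun t => c * (cpow0 (phi t - phi r) alpha * / alpha))%C.
    + intros t Ht. unfold J. rewrite (J_scal _ _ Hphi T), (J_jump _ _ Hphi); auto using admissible_jump; try lra.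
    + apply continuous_cont_on. intros x _.
      apply continuous_Cmult; [apply continuous_Cconst|].
      apply continuous_Cmult; [|apply continuous_Cconst].
      apply (continuous_comp (fun u => phi u - phi r) (fun x => cpow0 x alpha)).
      * apply (continuous_minus (V := R_NormedModule)); [apply (phi_continuous _ _ Hphi)|apply continuous_const].
      * apply continuous_cpow0, Ha.
  - apply cont_on_ext with (fun t => J alpha f t + J alpha g t)%C.
    + intros t Ht. symmetry. apply (J_plus _ _ Hphi T); auto using admissible_step.
    + apply cont_on_plus; assumption.
Qed.

Lemma Cmod_J_le_uniform (T : R) (alpha : C) : 0 < T -> 0 < Re alpha ->
  exists K, 0 < K /\ forall f M t, admissible T f -> 0 <= M ->
    (forall s, inI T s -> Cmod (f s) <= M) -> inI T t -> Cmod (J alpha f t) <= M * K.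
Proof.
  intros HT Ha. exists (Rpower (phi T - phi 0) (Re alpha) / Re alpha).
  split; [apply Rdiv_lt_0_compat; [apply exp_pos|assumption]|].
  intros f M t Hf HM0 HM Ht. unfold inI in *.
  assert (0 < Rpower (phi T - phi 0) (Re alpha) / Re alpha) by (apply Rdiv_lt_0_compat; [apply exp_pos|assumption]).
  destruct (Req_dec t 0) as [->|H0].
  { unfold J. rewrite J_0, Cmod_0. apply Rmult_le_pos; lra. }
  eapply Rle_trans; [apply (Cmod_J_le _ _ Hphi T alpha f t M); auto; try lra; intros; apply HM; lra|].
  apply Rmult_le_compat_l; [assumption|].
  apply Rmult_le_compat_r; [left; apply Rinv_0_lt_compat, Ha|].
  apply Rle_Rpower_l; [lra|].
  pose proof (phi_lt _ _ Hphi 0 t ltac:(lra)). pose proof (phi_le _ _ Hphi t T ltac:(lra)). lra.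
Qed.

Lemma cont_on_J (T : R) (alpha : C) (f : R -> C) : 0 < T -> 0 < Re alpha -> cont_on T f ->
  cont_on T (J alpha f).
Proof.
  intros HT Ha Hf. apply cont_on_uniform_limit. intros eps He.
  destruct (Cmod_J_le_uniform T alpha HT Ha) as [K [HK HKb]].
  destruct (step_approx T f (eps / K) HT Hf) as [g [Hg Hfg]].
  { apply Rdiv_lt_0_compat; lra. }
  exists (J alpha g). split; [apply cont_on_J_step; assumption|].
  intros s Hs. unfold J. rewrite <- (J_minus _ _ Hphi T); auto using admissible_step, admissible_cont_on, Rlt_le.
  replace eps with (eps / K * K) by (field; lra).
  apply HKb; auto.
  - apply admissible_minus; [apply admissible_cont_on; auto; lra|apply admissible_step, Hg].
  - left; apply Rdiv_lt_0_compat; lra.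
Qed.

Definition beta_const (alpha beta : C) : C := (beta_succ alpha beta * (alpha + beta) / beta)%C.

Lemma J_comp_step (T : R) (alpha beta : C) (f : R -> C) (t : R) : 0 < T ->
  0 < Re alpha -> 0 < Re beta -> is_step T f -> inI T t ->
  J alpha (J beta f) t = (beta_const alpha beta * J (alpha + beta) f t)%C.
Proof.
  intros HT Ha Hb Hf Ht.
  assert (Hab : 0 < Re (alpha + beta)%C) by (simpl; unfold Re in *; lra).
  induction Hf as [c r Hr|f g Hf IHf Hg IHg]; unfold J in *.
  - rewrite (J_scal _ _ Hphi T (alpha + beta)%C) by auto using admissible_jump.
    rewrite (J_ext _ _ alpha _ (fun s => (c / beta) * cpow0 (phi s - phi r) beta)%C).
    2:{ intros s Hs. rewrite (J_scal _ _ Hphi T); auto using admissible_jump; [|unfold inI in *; lra].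
        rewrite (J_jump _ _ Hphi) by (assumption || lra). unfold Cdiv. ring. }
    rewrite (J_scal _ _ Hphi T); auto.
    2:{ apply admissible_cont_on; [lra|]. apply continuous_cont_on. intros x _.
        apply (continuous_comp (fun u => phi u - phi r) (fun x => cpow0 x beta)).
        - apply (continuous_minus (V := R_NormedModule)); [apply (phi_continuous _ _ Hphi)|apply continuous_const].
        - apply continuous_cpow0, Hb. }
    rewrite J_cpow0, (J_jump _ _ Hphi) by (assumption || lra).
    unfold beta_const. field. split; apply neq_0_Re_pos; assumption.
  - rewrite (J_plus _ _ Hphi T (alpha + beta)%C) by auto using admissible_step.
    rewrite Cmult_plus_distr_l, <- IHf, <- IHg.
    rewrite <- (J_plus _ _ Hphi T); auto.
    + apply J_ext. intros s Hs. apply (J_plus _ _ Hphi T); auto using admissible_step.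
      unfold inI in *; lra.
    + apply admissible_cont_on; [lra|]. apply cont_on_J_step; assumption.
    + apply admissible_cont_on; [lra|]. apply cont_on_J_step; assumption.
Qed.

Lemma J_comp (T : R) (alpha beta : C) (f : R -> C) (t : R) : 0 < T ->
  0 < Re alpha -> 0 < Re beta -> cont_on T f -> inI T t ->
  J alpha (J beta f) t = (beta_const alpha beta * J (alpha + beta) f t)%C.
Proof.
  intros HT Ha Hb Hf Ht.
  assert (Hab : 0 < Re (alpha + beta)%C) by (simpl; unfold Re in *; lra).
  destruct (Cmod_J_le_uniform T alpha HT Ha) as [K1 [HK1 HKb1]].
  destruct (Cmod_J_le_uniform T beta HT Hb) as [K2 [HK2 HKb2]].
  destruct (Cmod_J_le_uniform T (alpha + beta)%C HT Hab) as [K3 [HK3 HKb3]].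
  set (c := beta_const alpha beta). pose proof (Cmod_ge_0 c) as Hc.
  set (K := K2 * K1 + Cmod c * K3).
  assert (HK : 0 < K).
  { unfold K. assert (0 < K2 * K1) by (apply Rmult_lt_0_compat; lra).
    assert (0 <= Cmod c * K3) by (apply Rmult_le_pos; lra). lra. }
  assert (Hle : forall eps, 0 < eps -> Cmod (J alpha (J beta f) t - c * J (alpha + beta) f t) <= eps * K).
  { intros eps He.
    destruct (step_approx T f eps HT Hf He) as [g [Hg Hfg]].
    assert (Ag : admissible T g) by (apply admissible_step, Hg).
    assert (Af : admissible T f) by (apply admissible_cont_on; [lra|assumption]).
    assert (Afg : admissible T (fun s => f s - g s)%C).
    { apply admissible_minus; assumption. }
    assert (CJf : cont_on T (J beta f)) by (apply cont_on_J; assumption).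
    assert (CJg : cont_on T (J beta g)) by (apply cont_on_J_step; assumption).
    assert (E : (J alpha (J beta f) t - c * J (alpha + beta) f t)%C =
      (J alpha (fun s => J beta f s - J beta g s)%C t - c * J (alpha + beta) (fun s => f s - g s)%C t)%C).
    { unfold J. rewrite (J_minus _ _ Hphi T alpha), (J_minus _ _ Hphi T (alpha + beta)%C); auto.
      - pose proof (J_comp_step T alpha beta g t HT Ha Hb Hg Ht) as Eg. unfold J in Eg.
        rewrite Eg. unfold c. ring.
      - apply admissible_cont_on; [lra|assumption].
      - apply admissible_cont_on; [lra|assumption]. }
    rewrite E. unfold Cminus at 1. eapply Rle_trans; [apply Cmod_triangle|]. rewrite Cmod_opp, Cmod_mult.
    unfold K. rewrite Rmult_plus_distr_l, <- (Rmult_assoc eps K2 K1).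
    apply Rplus_le_compat.
    - apply HKb1; auto.
      + apply admissible_cont_on; [lra|]. apply cont_on_minus; assumption.
      + apply Rmult_le_pos; lra.
      + intros s Hs. unfold J. rewrite <- (J_minus _ _ Hphi T) by assumption. apply HKb2; auto. lra.
    - rewrite <- Rmult_assoc, (Rmult_comm eps), Rmult_assoc. apply Rmult_le_compat_l; [assumption|].
      apply HKb3; auto. lra. }
  apply Ceq_minus. apply Cmod_eq_0.
  apply Rle_antisym; [|apply Cmod_ge_0].
  apply le_epsilon. intros e He. rewrite Rplus_0_l.
  replace e with (e / K * K) by (field; lra). apply Hle. apply Rdiv_lt_0_compat; lra.
Qed.

End Composition.

(** * The Gamma function *)

Definition gamma_integrand (z : C) (u : R) : C := (cpow u (z - 1) * RtoC (exp (- u)))%C.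

Lemma gamma_integrand_continuous (z : C) (u : R) : 0 < u ->
  @continuous R_UniformSpace C_UniformSpace (gamma_integrand z) u.
Proof.
  intro Hu. apply continuous_Cmult; [apply continuous_cpow, Hu|].
  apply continuous_RtoC. apply (ex_derive_continuous (V := R_NormedModule)). auto_derive. auto.
Qed.

Lemma Cmod_gamma_integrand (z : C) (u : R) :
  Cmod (gamma_integrand z u) = Rpower u (Re z - 1) * exp (- u).
Proof.
  unfold gamma_integrand. rewrite Cmod_mult, Cmod_cpow, Cmod_R, Rabs_right; [reflexivity|].
  left; apply exp_pos.
Qed.

Lemma Rpower_le_exp (p : R) : exists K, 0 < K /\ forall u, 1 <= u -> Rpower u p <= K * exp (u / 4).
Proof.
  set (P := Rabs p + 1). assert (HP : 0 < P) by (unfold P; pose proof (Rabs_pos p); lra).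
  exists (exp (P * ln (4 * P))). split; [apply exp_pos|]. intros u Hu.
  rewrite <- exp_plus. apply exp_monotone.
  assert (Hl : 0 <= ln u).
  { rewrite <- ln_1. destruct Hu as [H| <-]; [left; apply ln_increasing; lra|right; reflexivity]. }
  apply Rle_trans with (P * ln u).
  - apply Rmult_le_compat_r; [exact Hl|]. unfold P. pose proof (Rle_abs p). lra.
  - assert (E : ln u = ln (u / (4 * P)) + ln (4 * P)).
    { rewrite <- ln_mult; [f_equal; field; lra| |lra]. apply Rdiv_lt_0_compat; lra. }
    assert (ln (u / (4 * P)) <= u / (4 * P)).
    { assert (0 < u / (4 * P)) by (apply Rdiv_lt_0_compat; lra).
      pose proof (exp_ineq1_le (ln (u / (4 * P)))) as H1. rewrite exp_ln in H1 by assumption. lra. }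
    rewrite E, Rmult_plus_distr_l, Rplus_comm. apply Rplus_le_compat_l.
    replace (u / 4) with (P * (u / (4 * P))) by (field; lra).
    apply Rmult_le_compat_l; lra.
Qed.

Definition Jid : C -> (R -> C) -> R -> C := Jint (fun s => s) (fun _ => 1).

Definition cexpR (s : R) : C := RtoC (exp s).

Lemma cexpR_cont_on (T : R) : cont_on T cexpR.
Proof.
  apply continuous_cont_on. intros x _. apply continuous_RtoC.
  apply (ex_derive_continuous (V := R_NormedModule)). auto_derive. auto.
Qed.

Definition gamma_low (z : C) (t : R) : C := (RtoC (exp (- t)) * Jid z cexpR t)%C.

Lemma RtoC_m1 : RtoC (-1) = (- (1))%C.
Proof. unfold RtoC, Copp; simpl. f_equal; ring. Qed.

Lemma at_right_between (a t : R) : a < t -> at_right a (fun b => a < b < t).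
Proof.
  intro H. exists (mkposreal (t - a) ltac:(lra)). intros y Hy Hlt.
  change (Rabs (y - a) < t - a) in Hy. apply Rabs_def2 in Hy. lra.
Qed.

Lemma is_RInt_gen_gamma_low (z : C) (t : R) : 0 < Re z -> 0 < t ->
  @is_RInt_gen CR (gamma_integrand z) (at_right 0) (at_point t) (gamma_low z t).
Proof.
  intros Hz Ht.
  assert (Adm : admissible t cexpR) by (apply admissible_cont_on; [lra|apply cexpR_cont_on]).
  pose proof (is_RInt_gen_J _ _ increasing_C1_id t z cexpR t ltac:(lra) Hz Adm) as HJ.
  apply (is_RInt_gen_right_lim (V := CR)) in HJ; [|typeclasses eauto].
  set (k := fun s => (kernel (fun s => s) (fun _ => 1) z t s * cexpR s)%C) in HJ.
  apply is_RInt_gen_left with (I := fun x => (RtoC (exp (- t)) * @RInt CR k 0 (t - x))%C).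
  - typeclasses eauto.
  - generalize (at_right_between 0 t Ht). apply filter_imp. intros x Hx.
    assert (E : @is_RInt CR (fun y => scal (-1) (gamma_integrand z (t - y))) 0 (t - x)
        (@RInt CR (gamma_integrand z) (t - 0) (t - (t - x)))).
    { apply (is_RInt_comp (V := CR) (gamma_integrand z) (fun y => t - y) (fun _ => -1)).
      - intros y Hy. rewrite Rmin_left, Rmax_right in Hy by lra. apply gamma_integrand_continuous. lra.
      - intros y _. split; [auto_derive; [auto|ring]|apply continuous_const]. }
    replace (t - 0) with t in E by ring. replace (t - (t - x)) with x in E by ring.
    apply (is_RInt_Cmult _ (- exp t)%R) in E.
    assert (E2 : @is_RInt CR k 0 (t - x) (RtoC (- exp t) * @RInt CR (gamma_integrand z) t x)%C).
    { revert E. apply is_RInt_ext. intros s Hs. rewrite scal_C_R.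
      unfold k, kernel, gamma_integrand, cexpR.
      replace (exp s) with (exp t * exp (- (t - s))) by (rewrite <- exp_plus; f_equal; ring).
      rewrite RtoC_mult, RtoC_opp, RtoC_m1. Cring. }
    rewrite (is_RInt_unique (V := CR) _ _ _ _ E2).
    assert (E3 : @is_RInt CR (gamma_integrand z) t x (@RInt CR (gamma_integrand z) t x)).
    { apply (RInt_correct (V := CR)). apply (ex_RInt_continuous (V := CR)).
      intros y Hy. rewrite Rmin_right, Rmax_left in Hy by lra. apply gamma_integrand_continuous. lra. }
    apply (is_RInt_swap (V := CR)) in E3.
    replace (RtoC (exp (- t)) * (RtoC (- exp t) * @RInt CR (gamma_integrand z) t x))%C
     with (@opp CR (@RInt CR (gamma_integrand z) t x)); [exact E3|].
    rewrite Cmult_assoc, <- RtoC_mult.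
    replace (exp (- t) * - exp t) with (-1) by (rewrite Ropp_mult_distr_r_reverse, <- exp_plus; replace (-t + t) with 0 by ring; rewrite exp_0; ring).
    change (@opp CR (@RInt CR (gamma_integrand z) t x)) with (Copp (@RInt CR (gamma_integrand z) t x)).
    rewrite RtoC_m1. Cring.
  - apply filterlim_Cmult; [typeclasses eauto|apply filterlim_const|].
    apply (filterlim_comp _ _ _ (fun x => t - x) (fun c => @RInt CR k 0 c) (at_right 0) (at_left t)); [|exact HJ].
    intros P [e He]. exists e. intros x Hx Hx0. apply He; [|lra].
    change (Rabs (x - 0) < e) in Hx. change (Rabs (t - x - t) < e).
    replace (t - x - t) with (- (x - 0)) by ring. rewrite Rabs_Ropp. exact Hx.
Qed.

Lemma filterlim_exp_neg (k : R) : 0 < k ->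
  filterlim (fun u => exp (- (k * u))) (Rbar_locally p_infty) (locally 0).
Proof.
  intro Hk. apply filterlim_locally. intro eps.
  exists (/ (k * eps)). intros u Hu.
  assert (0 < k * eps) by (apply Rmult_lt_0_compat; [assumption|apply cond_pos]).
  assert (0 < / (k * eps)) by (apply Rinv_0_lt_compat; assumption).
  change (Rabs (exp (- (k * u)) - 0) < eps). rewrite Rminus_0_r, Rabs_right; [|left; apply exp_pos].
  assert (0 < k * u) by (apply Rmult_lt_0_compat; lra).
  rewrite exp_Ropp. apply Rlt_trans with (/ (k * u)).
  - apply Rinv_lt_contravar; [apply Rmult_lt_0_compat; [assumption|apply exp_pos]|].
    pose proof (exp_ineq1_le (k * u)). lra.
  - pose proof (cond_pos eps). apply Rmult_lt_reg_l with (k * u); [assumption|]. rewrite Rinv_r by lra.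
    apply Rmult_lt_reg_r with (/ (k * eps)); [assumption|].
    replace (k * u * eps * / (k * eps)) with u by (field; lra). lra.
Qed.

Lemma is_RInt_gen_exp_tail (t : R) :
  @is_RInt_gen R_NormedModule (fun u => exp (- (/2 * u))) (at_point t) (Rbar_locally p_infty)
    (2 * exp (- (/2 * t))).
Proof.
  apply is_RInt_gen_right with (I := fun b => 2 * exp (- (/2 * t)) - 2 * exp (- (/2 * b))).
  - typeclasses eauto.
  - apply filter_forall. intro b.
    replace (2 * exp (- (/2 * t)) - 2 * exp (- (/2 * b))) with
      (@minus R_AbelianGroup (-2 * exp (- (/2 * b))) (-2 * exp (- (/2 * t)))) by (unfold minus, plus, opp; simpl; ring).
    apply (is_RInt_derive (V := R_CompleteNormedModule) (fun b => -2 * exp (- (/2 * b)))).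
    + intros x _. auto_derive; [auto|field].
    + intros x _. apply (ex_derive_continuous (V := R_NormedModule)). auto_derive. auto.
  - replace (2 * exp (- (/2 * t))) with (2 * exp (- (/2 * t)) - 2 * 0) at 1 by ring.
    apply (filterlim_comp_2 (G := locally (2 * exp (- (/2 * t)))) (H := locally (2 * 0)) (fun _ => 2 * exp (- (/2 * t))) (fun b => 2 * exp (- (/2 * b))) Rminus).
    + apply filterlim_const.
    + apply (filterlim_comp _ _ _ (fun u => exp (- (/2 * u))) (fun y => 2 * y) _ (locally 0)).
      * apply filterlim_exp_neg. lra.
      * apply (continuous_scal_r (V := R_NormedModule) 2 (fun y : R => y)). apply continuous_id.
    + apply (filterlim_comp_2 (G := locally (2 * exp (- (/2 * t)))) (H := locally (- (2 * 0))) (fun x : R * R => fst x) (fun x : R * R => - snd x) Rplus).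
      * apply filterlim_fst.
      * apply (filterlim_comp _ _ _ snd Ropp _ (locally (2 * 0))); [apply filterlim_snd|apply (filterlim_opp (V := R_NormedModule))].
      * apply (filterlim_plus (V := R_NormedModule)).
Qed.

Lemma gamma_tail (z : C) : exists K, 0 < K /\ forall t, 1 <= t ->
  exists l : C, @is_RInt_gen CR (gamma_integrand z) (at_point t) (Rbar_locally p_infty) l /\
    Cmod l <= K * exp (- (/2 * t)).
Proof.
  destruct (Rpower_le_exp (Re z - 1)) as [K [HK HKb]].
  exists (2 * K). split; [lra|]. intros t Ht.
  set (k := fun u => K * exp (- (/2 * u))).
  assert (Hk : @is_RInt_gen R_NormedModule k (at_point t) (Rbar_locally p_infty) (2 * K * exp (- (/2 * t)))).
  { replace (2 * K * exp (- (/2 * t))) with (K * (2 * exp (- (/2 * t)))) by ring.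
    apply (is_RInt_gen_scal (V := R_NormedModule) (fun u => exp (- (/2 * u))) K). apply is_RInt_gen_exp_tail. }
  assert (Hqk : forall u, 1 <= u -> Cmod (gamma_integrand z u) <= k u).
  { intros u Hu. rewrite Cmod_gamma_integrand. unfold k.
    apply Rle_trans with (K * exp (u / 4) * exp (- u)).
    - apply Rmult_le_compat_r; [left; apply exp_pos|apply HKb, Hu].
    - rewrite Rmult_assoc, <- exp_plus. apply Rmult_le_compat_l; [lra|]. apply exp_monotone. lra. }
  assert (HD : Rbar_locally p_infty (fun b => t < b)) by (exists t; auto).
  assert (E : exists l, @is_RInt_gen CR (gamma_integrand z) (at_point t) (Rbar_locally p_infty) l).
  { apply (ex_RInt_gen_dominated (V := CR) _ k t _ (fun b => t < b) (2 * K * exp (- (/2 * t)))).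
    - exact HD.
    - intros; lra.
    - intros b Hb. apply (ex_RInt_continuous (V := CR)). intros y Hy.
      rewrite Rmin_left in Hy by lra. apply gamma_integrand_continuous. lra.
    - intros b Hb. apply (ex_RInt_continuous (V := R_CompleteNormedModule)). intros y Hy.
      apply (ex_derive_continuous (V := R_NormedModule)). unfold k. auto_derive. auto.
    - intros b x Hb Hx. rewrite norm_C_R. apply Hqk. lra.
    - exact Hk. }
  destruct E as [l Hl]. exists l. split; [exact Hl|].
  rewrite <- norm_C_R.
  apply (RInt_gen_norm (V := CR) (Fa := at_point t) (Fb := Rbar_locally p_infty) (gamma_integrand z) k); auto;
  refine (Filter_prod _ _ _ (fun x => x = t) (fun b => t < b) eq_refl HD _).
  - intros x b -> Hb; simpl; lra.
  - intros x b -> Hb s Hs; simpl in Hs. rewrite norm_C_R. apply Hqk. lra.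
Qed.

Lemma is_RInt_gen_CGamma (z : C) : 0 < Re z ->
  @is_RInt_gen CR (gamma_integrand z) (at_right 0) (Rbar_locally p_infty) (CGamma z).
Proof.
  intro Hz. destruct (gamma_tail z) as [K [_ HK]].
  destruct (HK 1 (Rle_refl 1)) as [l [Hl _]].
  apply (RInt_gen_correct (V := CR)).
  exists (@plus CR (gamma_low z 1) l).
  apply (is_RInt_gen_Chasles (V := CR) _ 1); [|exact Hl].
  apply is_RInt_gen_gamma_low; [exact Hz|lra].
Qed.

Lemma CGamma_eq (z l : C) :
  @is_RInt_gen CR (gamma_integrand z) (at_right 0) (Rbar_locally p_infty) l -> CGamma z = l.
Proof.
  intro H. exact (is_RInt_gen_unique (V := CR) (Fa := at_right 0) (Fb := Rbar_locally p_infty) (gamma_integrand z) l H).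
Qed.

Lemma CGamma_low_large (z : C) : 0 < Re z -> exists K, 0 < K /\ forall t, 1 <= t ->
  Cmod (CGamma z - gamma_low z t) <= K * exp (- (/2 * t)).
Proof.
  intro Hz. destruct (gamma_tail z) as [K [HK0 HK]]. exists K. split; [exact HK0|].
  intros t Ht. destruct (HK t Ht) as [l [Hl Hlb]].
  assert (E : CGamma z = @plus CR (gamma_low z t) l).
  { apply CGamma_eq.
    apply (is_RInt_gen_Chasles (V := CR) _ t); [|exact Hl].
    apply is_RInt_gen_gamma_low; [exact Hz|lra]. }
  rewrite E. replace (@plus CR (gamma_low z t) l - gamma_low z t)%C with l; [exact Hlb|].
  change (l = gamma_low z t + l - gamma_low z t)%C. Cring.
Qed.

Lemma Cmod_Jid_le (T : R) (z : C) (f : R -> C) (t M : R) : 0 < t <= T -> 0 < Re z ->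
  admissible T f -> (forall s, 0 <= s < t -> Cmod (f s) <= M) ->
  Cmod (Jid z f t) <= M * (Rpower t (Re z) / Re z).
Proof.
  intros Ht Hz Hf HM. pose proof (Cmod_J_le _ _ increasing_C1_id T z f t M Ht Hz Hf HM) as H.
  simpl in H. rewrite Rminus_0_r in H. exact H.
Qed.

Lemma CGamma_low (z : C) : 0 < Re z -> exists K, 0 < K /\ forall t, 0 <= t ->
  Cmod (CGamma z - gamma_low z t) <= K * exp (- (/2 * t)).
Proof.
  intro Hz. destruct (CGamma_low_large z Hz) as [K [HK0 HK]].
  set (L := (Cmod (CGamma z) + / Re z) * exp (/2)).
  assert (0 < / Re z) by (apply Rinv_0_lt_compat, Hz).
  pose proof (Cmod_ge_0 (CGamma z)). pose proof (exp_pos (/2)).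
  assert (HL : 0 < L) by (apply Rmult_lt_0_compat; lra).
  exists (K + L). split; [lra|]. intros t Ht.
  pose proof (exp_pos (- (/2 * t))).
  destruct (Rle_dec 1 t) as [Ht1|Ht1].
  { eapply Rle_trans; [apply HK, Ht1|]. apply Rmult_le_compat_r; lra. }
  assert (Hlow : Cmod (gamma_low z t) <= / Re z).
  { unfold gamma_low. rewrite Cmod_mult, Cmod_R, Rabs_right by (left; apply exp_pos).
    destruct (Req_dec t 0) as [->|Ht0].
    - unfold Jid. rewrite J_0, Cmod_0. lra.
    - assert (Hb : Cmod (Jid z cexpR t) <= exp t * (Rpower t (Re z) / Re z)).
      { apply (Cmod_Jid_le t); [lra|assumption|apply admissible_cont_on; [lra|apply cexpR_cont_on]|].
        intros s Hs. unfold cexpR. rewrite Cmod_R, Rabs_right by (left; apply exp_pos). apply exp_monotone; lra. }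
      assert (Hp : Rpower t (Re z) <= 1).
      { replace 1 with (Rpower 1 (Re z)) by (unfold Rpower; rewrite ln_1, Rmult_0_r, exp_0; reflexivity).
        apply Rle_Rpower_l; lra. }
      apply Rle_trans with (exp (- t) * (exp t * (1 * / Re z))).
      + apply Rmult_le_compat_l; [left; apply exp_pos|]. eapply Rle_trans; [exact Hb|].
        apply Rmult_le_compat_l; [left; apply exp_pos|]. apply Rmult_le_compat_r; lra.
      + rewrite <- Rmult_assoc, <- exp_plus. replace (- t + t) with 0 by ring. rewrite exp_0. lra. }
  unfold Cminus. eapply Rle_trans; [apply Cmod_triangle|]. rewrite Cmod_opp.
  apply Rle_trans with (L * exp (- (/2 * t))); [|apply Rmult_le_compat_r; lra].
  unfold L. rewrite Rmult_assoc, <- exp_plus.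
  assert (1 <= exp (/2 + - (/2 * t))).
  { rewrite <- exp_0 at 1. apply exp_monotone. lra. }
  apply Rle_trans with ((Cmod (CGamma z) + / Re z) * 1); [lra|]. apply Rmult_le_compat_l; lra.
Qed.

Lemma Jid_cexpR (z : C) (t : R) : Jid z cexpR t = (RtoC (exp t) * gamma_low z t)%C.
Proof.
  unfold gamma_low. rewrite Cmult_assoc, <- RtoC_mult, <- exp_plus.
  replace (t + - t) with 0 by ring. rewrite exp_0. ring.
Qed.

(* Compare both sides of the composition rule for f = exp and phi = id, and let t grow. *)
Lemma CGamma_mult (alpha beta : C) : 0 < Re alpha -> 0 < Re beta ->
  (CGamma alpha * CGamma beta)%C = (beta_const alpha beta * CGamma (alpha + beta))%C.
Proof.
  intros Ha Hb.
  assert (Hab : 0 < Re (alpha + beta)%C) by (simpl; unfold Re in *; lra).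
  set (c := beta_const alpha beta). set (GA := CGamma alpha). set (GB := CGamma beta).
  set (GC := CGamma (alpha + beta)).
  destruct (CGamma_low alpha Ha) as [Ka [HKa0 HKa]].
  destruct (CGamma_low beta Hb) as [Kb [HKb0 HKb]].
  destruct (CGamma_low (alpha + beta)%C Hab) as [Kc [HKc0 HKc]].
  destruct (Rpower_le_exp (Re alpha)) as [Kp [HKp0 HKp]].
  set (K := Cmod GB * Ka + Cmod c * Kc + Kb * (Kp / Re alpha)).
  assert (Hrem : forall t, 1 <= t ->
     Cmod (GB * gamma_low alpha t - c * gamma_low (alpha + beta) t) <= Kb * (Kp / Re alpha) * exp (- (t / 4))).
  { intros t Ht.
    set (err := fun s => (RtoC (exp s) * (GB - gamma_low beta s))%C).
    assert (Hcl : cont_on t (Jid beta cexpR)).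
    { apply (cont_on_J _ _ increasing_C1_id); [lra|assumption|apply cexpR_cont_on]. }
    assert (Herr : cont_on t err).
    { apply cont_on_ext with (fun s => GB * cexpR s - Jid beta cexpR s)%C.
      - intros s _. rewrite Jid_cexpR. unfold err, cexpR. ring.
      - apply cont_on_minus; [apply cont_on_scal, cexpR_cont_on|assumption]. }
    assert (Ac : admissible t cexpR) by (apply admissible_cont_on; [lra|apply cexpR_cont_on]).
    assert (E : Jid alpha err t = (RtoC (exp t) * (GB * gamma_low alpha t - c * gamma_low (alpha + beta) t))%C).
    { assert (Ht' : inI t t) by (unfold inI; lra).
      pose proof (J_comp _ _ increasing_C1_id t alpha beta cexpR t ltac:(lra) Ha Hb (cexpR_cont_on t) Ht') as Ecomp.
      change (Jid alpha (Jid beta cexpR) t = (beta_const alpha beta * Jid (alpha + beta) cexpR t)%C) in Ecomp.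
      transitivity (Jid alpha (fun s => GB * cexpR s - Jid beta cexpR s)%C t).
      - apply J_ext. intros s Hs. rewrite Jid_cexpR. unfold err, cexpR. ring.
      - unfold Jid at 1. rewrite (J_minus _ _ increasing_C1_id t); auto.
        + rewrite (J_scal _ _ increasing_C1_id t); auto. change (Jint (fun s => s) (fun _ => 1)) with Jid. rewrite Ecomp, !Jid_cexpR.
          fold c. ring.
        + apply admissible_scal, Ac.
        + apply admissible_cont_on; [lra|assumption]. }
    assert (Hle : Cmod (Jid alpha err t) <= Kb * exp (t / 2) * (Rpower t (Re alpha) / Re alpha)).
    { apply (Cmod_Jid_le t); [lra|assumption|apply admissible_cont_on; [lra|assumption]|].
      intros s Hs. unfold err. rewrite Cmod_mult, Cmod_R, Rabs_right by (left; apply exp_pos).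
      apply Rle_trans with (exp s * (Kb * exp (- (/2 * s)))).
      - apply Rmult_le_compat_l; [left; apply exp_pos|]. apply HKb. lra.
      - replace (exp s * (Kb * exp (- (/2 * s)))) with (Kb * (exp s * exp (- (/2 * s)))) by ring.
        rewrite <- exp_plus. apply Rmult_le_compat_l; [lra|]. apply exp_monotone. lra. }
    rewrite E, Cmod_mult, Cmod_R, Rabs_right in Hle by (left; apply exp_pos).
    apply Rmult_le_reg_l with (exp t); [apply exp_pos|].
    eapply Rle_trans; [exact Hle|].
    replace (exp t * (Kb * (Kp / Re alpha) * exp (- (t / 4)))) with
      (Kb * ((Kp * exp (t / 4)) / Re alpha) * exp (t / 2)).
    2:{ replace (exp t) with (exp (t / 2) * (exp (t / 4) * exp (t / 4))) by (rewrite <- !exp_plus; f_equal; field).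
        replace (exp (- (t / 4))) with (/ exp (t / 4)) by (rewrite exp_Ropp; reflexivity).
        pose proof (exp_pos (t / 4)). field. lra. }
    rewrite Rmult_assoc, (Rmult_comm (exp (t / 2))), <- Rmult_assoc.
    apply Rmult_le_compat_r; [left; apply exp_pos|]. apply Rmult_le_compat_l; [lra|].
    apply Rmult_le_compat_r; [left; apply Rinv_0_lt_compat, Ha|]. apply HKp, Ht. }
  assert (Hall : forall t, 1 <= t -> Cmod (GA * GB - c * GC) <= K * exp (- (t / 4))).
  { intros t Ht.
    assert (He : exp (- (/2 * t)) <= exp (- (t / 4))) by (apply exp_monotone; lra).
    replace (GA * GB - c * GC)%C with (GB * (GA - gamma_low alpha t) +
      ((GB * gamma_low alpha t - c * gamma_low (alpha + beta) t) - c * (GC - gamma_low (alpha + beta) t)))%C by ring.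
    eapply Rle_trans; [apply Cmod_triangle|].
    eapply Rle_trans; [apply Rplus_le_compat_l; unfold Cminus at 1; apply Cmod_triangle|].
    rewrite Cmod_opp, !Cmod_mult.
    pose proof (HKa t ltac:(lra)) as B1. pose proof (HKc t ltac:(lra)) as B2. pose proof (Hrem t Ht) as B3.
    fold GA in B1. fold GC in B2.
    assert (Cmod GB * Cmod (GA - gamma_low alpha t) <= Cmod GB * Ka * exp (- (t / 4))).
    { rewrite Rmult_assoc. apply Rmult_le_compat_l; [apply Cmod_ge_0|]. eapply Rle_trans; [exact B1|].
      apply Rmult_le_compat_l; lra. }
    assert (Cmod c * Cmod (GC - gamma_low (alpha + beta) t) <= Cmod c * Kc * exp (- (t / 4))).
    { rewrite Rmult_assoc. apply Rmult_le_compat_l; [apply Cmod_ge_0|]. eapply Rle_trans; [exact B2|].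
      apply Rmult_le_compat_l; lra. }
    unfold K. lra. }
  apply Ceq_minus, Cmod_eq_0, Rle_antisym; [|apply Cmod_ge_0].
  assert (HK0 : 0 <= K).
  { pose proof (Hall 1 (Rle_refl 1)). pose proof (Cmod_ge_0 (GA * GB - c * GC)).
    pose proof (exp_pos (- (1 / 4))). destruct (Rle_dec 0 K); [assumption|].
    assert (K * exp (- (1 / 4)) < 0) by (apply Ropp_lt_cancel; rewrite Ropp_0, Ropp_mult_distr_l; apply Rmult_lt_0_compat; lra).
    lra. }
  assert (Hlim : filterlim (fun t => K * exp (- (/4 * t))) (Rbar_locally p_infty) (locally (K * 0))).
  { apply (filterlim_comp _ _ _ (fun u => exp (- (/4 * u))) (fun y => K * y) _ (locally 0)).
    - apply filterlim_exp_neg. lra.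
    - apply (continuous_scal_r (V := R_NormedModule) K (fun y : R => y)). apply continuous_id. }
  rewrite Rmult_0_r in Hlim.
  apply (filterlim_le (F := Rbar_locally p_infty) (fun _ => Cmod (GA * GB - c * GC)) (fun t => K * exp (- (/4 * t)))
     (Cmod (GA * GB - c * GC)) 0).
  - exists 1. intros t Ht. replace (/4 * t) with (t / 4) by field. apply Hall. lra.
  - apply filterlim_const.
  - exact Hlim.
Qed.

Lemma is_RInt_gen_derive_pos (f df : R -> C) (la lb : C) :
  (forall u, 0 < u -> @is_derive R_AbsRing C_R_NormedModule f u (df u)) ->
  (forall u, 0 < u -> @continuous R_UniformSpace C_UniformSpace df u) ->
  filterlim f (at_right 0) (locally la) -> filterlim f (Rbar_locally p_infty) (locally lb) ->
  @is_RInt_gen CR df (at_right 0) (Rbar_locally p_infty) (lb - la)%C.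
Proof.
  intros Hd Hc Ha Hb.
  replace (lb - la)%C with (@plus CR (f 1 - la)%C (lb - f 1)%C).
  2:{ change ((f 1 - la) + (lb - f 1) = lb - la)%C. ring. }
  assert (HI : forall a b, 0 < a -> 0 < b -> @is_RInt CR df a b (f b - f a)%C).
  { intros a b Ha0 Hb0. apply (is_RInt_derive (V := CR) f df).
    - intros x Hx. apply Hd. eapply Rlt_le_trans; [|apply Hx]. apply Rmin_pos; assumption.
    - intros x Hx. apply Hc. eapply Rlt_le_trans; [|apply Hx]. apply Rmin_pos; assumption. }
  apply (is_RInt_gen_Chasles (V := CR) _ 1).
  - apply is_RInt_gen_left with (I := fun a => (f 1 - f a)%C); [typeclasses eauto| |].
    + generalize (at_right_between 0 1 Rlt_0_1). apply filter_imp. intros a Ha0. apply HI; lra.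
    + apply (filterlim_ext (fun a => f 1 + (-(1)) * f a)%C); [intro; ring|].
      replace (f 1 - la)%C with (f 1 + (-(1)) * la)%C by ring.
      apply filterlim_Cplus; [typeclasses eauto|apply filterlim_const|].
      apply filterlim_Cmult; [typeclasses eauto|apply filterlim_const|exact Ha].
  - apply is_RInt_gen_right with (I := fun b => (f b - f 1)%C); [typeclasses eauto| |].
    + exists 0. intros b Hb0. apply HI; lra.
    + apply (filterlim_ext (fun b => f b + (- f 1))%C); [intro; ring|].
      apply filterlim_Cplus; [typeclasses eauto|exact Hb|apply filterlim_const].
Qed.

Lemma is_derive_exp_opp (u : R) : is_derive (fun u => exp (- u)) u (- exp (- u)).
Proof. auto_derive; [auto|ring]. Qed.

Lemma gamma_integrand_succ (z : C) (u : R) : 0 < u ->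
  gamma_integrand (z + 1) u = (RtoC u * gamma_integrand z u)%C.
Proof.
  intro Hu. unfold gamma_integrand. rewrite (cpow_split u (z + 1 - 1)) by exact Hu.
  replace (z + 1 - 1 - 1)%C with (z - 1)%C by ring. ring.
Qed.

Lemma CGamma_succ (z : C) : 0 < Re z -> CGamma (z + 1) = (z * CGamma z)%C.
Proof.
  intro Hz.
  assert (Hz1 : 0 < Re (z + 1)%C) by (simpl; unfold Re in *; lra).
  set (H := fun u => (RtoC (exp (- u)) * cpow u z)%C).
  set (dH := fun u => (z * gamma_integrand z u + (-(1)) * gamma_integrand (z + 1) u)%C).
  assert (E : @is_RInt_gen CR dH (at_right 0) (Rbar_locally p_infty) (0 - 0)%C).
  { apply (is_RInt_gen_derive_pos H dH).
    - intros u Hu.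
      replace (dH u) with (@plus C_R_NormedModule (@scal R_AbsRing C_R_NormedModule (- exp (- u)) (cpow u z))
         (@scal R_AbsRing C_R_NormedModule (exp (- u)) (z * cpow u (z - 1))%C)).
      + apply (is_derive_ext (V := C_R_NormedModule) (fun u => @scal R_AbsRing C_R_NormedModule (exp (- u)) (cpow u z))).
        { intro s. apply scal_C_R. }
        apply (filterdiff_ext_lin _ _ _ (filterdiff_scal_fct (K := R_AbsRing) (V := C_R_NormedModule) u (fun u => exp (- u)) (fun u => cpow u z) _ _ Rmult_comm (is_derive_exp_opp u) (is_derive_cpow z u Hu))).
        intro y. rewrite !scal_C_R. unfold scal; simpl; unfold mult; simpl.
        change (Cplus (RtoC (y * - exp (- u)) * cpow u z)%C (RtoC (exp (- u)) * (RtoC y * (z * cpow u (z - 1))))%C =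
          (RtoC y * (Cplus (RtoC (- exp (- u)) * cpow u z)%C (RtoC (exp (- u)) * (z * cpow u (z - 1)))%C))%C).
        rewrite RtoC_mult. ring.
      + rewrite !scal_C_R. unfold dH. rewrite gamma_integrand_succ by exact Hu. unfold gamma_integrand.
        change (Cplus (RtoC (- exp (- u)) * cpow u z)%C (RtoC (exp (- u)) * (z * cpow u (z - 1)))%C =
           (z * (cpow u (z - 1) * RtoC (exp (- u))) + (-(1)) * (RtoC u * (cpow u (z - 1) * RtoC (exp (- u)))))%C).
        rewrite (cpow_split u z) by exact Hu. rewrite RtoC_opp. ring.
    - intros u Hu. apply continuous_Cplus; (apply continuous_Cmult; [apply continuous_Cconst|apply gamma_integrand_continuous, Hu]).
    - apply filterlim_C_Cmod; [typeclasses eauto|]. intros eps He.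
      destruct (Rpower_small (Re z) eps Hz He) as [d Hd].
      generalize (at_right_between 0 d (cond_pos d)). apply filter_imp. intros u Hu.
      unfold H. unfold Cminus. rewrite Copp_0, Cplus_0_r, Cmod_mult, Cmod_cpow, Cmod_R, Rabs_right by (left; apply exp_pos).
      apply Rle_lt_trans with (1 * Rpower u (Re z)); [|rewrite Rmult_1_l; apply Hd, Hu].
      apply Rmult_le_compat_r; [left; apply exp_pos|]. rewrite <- exp_0. apply exp_monotone; lra.
    - apply filterlim_C_Cmod; [typeclasses eauto|]. intros eps He.
      destruct (Rpower_le_exp (Re z)) as [K [HK0 HK]].
      assert (H2 : 0 < /2) by lra. assert (H3 : 0 < eps / K) by (apply Rdiv_lt_0_compat; lra).
      pose proof (proj1 (filterlim_locally _ _) (filterlim_exp_neg (/2) H2) (mkposreal _ H3)) as Hl.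
      assert (H1 : Rbar_locally p_infty (fun u => 1 < u)) by (exists 1; auto).
      generalize (filter_and _ _ H1 Hl). apply filter_imp. intros u [Hu1 Hu2].
      change (Rabs (exp (- (/2 * u)) - 0) < eps / K) in Hu2. rewrite Rminus_0_r, Rabs_right in Hu2 by (left; apply exp_pos).
      unfold H. unfold Cminus. rewrite Copp_0, Cplus_0_r, Cmod_mult, Cmod_cpow, Cmod_R, Rabs_right by (left; apply exp_pos).
      apply Rle_lt_trans with (exp (- u) * (K * exp (u / 4))).
      + apply Rmult_le_compat_l; [left; apply exp_pos|apply HK; lra].
      + apply Rle_lt_trans with (K * exp (- (/2 * u))).
        * replace (exp (- u) * (K * exp (u / 4))) with (K * (exp (- u) * exp (u / 4))) by ring.
          rewrite <- exp_plus. apply Rmult_le_compat_l; [lra|apply exp_monotone; lra].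
        * replace eps with (K * (eps / K)) by (field; lra). apply Rmult_lt_compat_l; lra. }
  assert (E2 : @is_RInt_gen CR dH (at_right 0) (Rbar_locally p_infty) (@plus CR (z * CGamma z)%C ((-(1)) * CGamma (z + 1))%C)).
  { apply (is_RInt_gen_plus (V := CR)); apply is_RInt_gen_Cmult; try typeclasses eauto; apply is_RInt_gen_CGamma; assumption. }
  apply (is_RInt_gen_unique (V := CR)) in E. apply (is_RInt_gen_unique (V := CR)) in E2.
  rewrite E in E2. change ((0 - 0)%C = (z * CGamma z + (-(1)) * CGamma (z + 1))%C) in E2.
  symmetry. apply Ceq_minus. transitivity (z * CGamma z + (-(1)) * CGamma (z + 1))%C; [ring|].
  rewrite <- E2. ring.
Qed.

Lemma CGamma_1 : CGamma 1 = 1%C.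
Proof.
  assert (E : @is_RInt_gen CR (gamma_integrand 1) (at_right 0) (Rbar_locally p_infty) (0 - RtoC (-1))%C).
  { apply (is_RInt_gen_derive_pos (fun u => RtoC (- exp (- u)))).
    - intros u Hu.
      replace (gamma_integrand 1 u) with (exp (- u), 0).
      + apply is_derive_pair_C; [auto_derive; [auto|ring]|apply @is_derive_const].
      + unfold gamma_integrand. replace (1 - 1)%C with (RtoC 0) by ring. rewrite cpow_0, Cmult_1_l. reflexivity.
    - intros u Hu. apply gamma_integrand_continuous, Hu.
    - apply filterlim_RtoC; [typeclasses eauto|].
      replace (-1) with (- exp (- 0)) by (rewrite Ropp_0, exp_0; reflexivity).
      eapply filterlim_filter_le_1.
      2:{ apply (ex_derive_continuous (V := R_NormedModule) (fun u => - exp (- u)) 0). auto_derive. auto. }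
      intros P HP. unfold at_right, within. revert HP. apply filter_imp; auto.
    - apply filterlim_RtoC; [typeclasses eauto|].
      replace 0 with (- 0) by ring.
      apply (filterlim_comp _ _ _ (fun u => exp (- u)) Ropp _ (locally 0)); [|apply (filterlim_opp (V := R_NormedModule))].
      apply (filterlim_ext (fun u => exp (- (1 * u)))); [intro; f_equal; ring|]. apply filterlim_exp_neg. lra. }
  rewrite (CGamma_eq _ _ E), RtoC_m1. Cring.
Qed.

Lemma Re_RInt_gen_nonneg (f : R -> C) (l : C) :
  (forall u, 0 < u -> 0 <= Re (f u)) ->
  @is_RInt_gen CR f (at_right 0) (Rbar_locally p_infty) l -> 0 <= Re l.
Proof.
  intros Hf H. destruct (Rle_dec 0 (Re l)) as [Hl|Hl]; [exact Hl|exfalso].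
  assert (HP : locally l (fun z : C => Re z < 0)).
  { exists (mkposreal (- Re l) ltac:(lra)). intros z [Hz _].
    change (Rabs (Re z - Re l) < - Re l) in Hz. apply Rabs_def2 in Hz. lra. }
  assert (HQ : filter_prod (at_right 0) (Rbar_locally p_infty) (fun ab : R * R => 0 < fst ab /\ fst ab < snd ab)).
  { apply (Filter_prod _ _ _ (fun a => 0 < a < 1) (fun b => 1 < b)).
    - apply at_right_between; lra.
    - exists 1; auto.
    - intros x y Hx Hy; simpl; lra. }
  specialize (H _ HP). unfold filtermapi in H.
  destruct (filter_ex _ (filter_and _ _ H HQ)) as [[a b] [[y [H1 H2]] [H3 H4]]].
  simpl in *.
  pose proof (is_RInt_fct_extend_fst (U := R_NormedModule) (V := R_NormedModule) f a b y H1) as H5.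
  assert (0 <= Re y); [|lra].
  apply (is_RInt_ge_0 (fun u => fst (f u)) a b); [lra|exact H5|].
  intros u Hu. apply Hf. lra.
Qed.

Lemma sin_sqr_le (v : R) : sin v * sin v <= v * v.
Proof.
  assert (Hp : forall v, 0 <= v -> sin v * sin v <= v * v).
  { intros w Hw. destruct (Req_dec w 0) as [->|H0]; [rewrite sin_0; lra|].
    pose proof (sin_lt_x w ltac:(lra)). pose proof (SIN_bound w).
    destruct (Rle_dec 1 w) as [Hw1|Hw1]; [nra|].
    pose proof PI2_1. assert (0 <= sin w) by (apply sin_ge_0; lra). nra. }
  destruct (Rle_dec 0 v) as [H|H]; [apply Hp, H|].
  pose proof (Hp (- v) ltac:(lra)) as H1. rewrite sin_neg in H1. lra.
Qed.

Lemma cos_ge (v : R) : 1 - v * v / 2 <= cos v.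
Proof.
  replace v with (2 * (v / 2)) at 3 by field. rewrite cos_2a_sin.
  pose proof (sin_sqr_le (v / 2)). lra.
Qed.

Lemma ln_sqr_le (u : R) : 0 < u -> ln u * ln u <= 4 * (u - 2 + / u).
Proof.
  intro Hu. set (L := ln u / 2).
  replace u with (exp L * exp L) at 3 4.
  2:{ rewrite <- exp_plus. unfold L. replace (ln u / 2 + ln u / 2) with (ln u) by field. apply exp_ln, Hu. }
  replace (ln u) with (2 * L) by (unfold L; field).
  set (p := exp L). set (q := exp (- L)).
  assert (Hpq : p * q = 1) by (unfold p, q; rewrite <- exp_plus; replace (L + - L) with 0 by ring; apply exp_0).
  pose proof (exp_pos L). pose proof (exp_pos (- L)).
  replace (/ (p * p)) with (q * q).
  2:{ apply Rmult_eq_reg_r with (p * p); [|apply Rgt_not_eq, Rmult_lt_0_compat; assumption].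
      rewrite Rinv_l; [|apply Rgt_not_eq, Rmult_lt_0_compat; assumption].
      transitivity ((p * q) * (p * q)); [ring|rewrite Hpq; ring]. }
  pose proof (exp_ineq1_le L) as H1. pose proof (exp_ineq1_le (- L)) as H2. fold p in H1. fold q in H2.
  fold p in H. fold q in H0.
  replace (4 * (p * p - 2 + q * q)) with (4 * ((p - q) * (p - q))) by (replace 2 with (2 * (p * q)) by lra; ring).
  assert (L * L <= (p - q) * (p - q)); [|lra].
  destruct (Rle_dec 0 L) as [HL|HL].
  - assert (q <= 1). { unfold q. rewrite <- exp_0. apply exp_monotone; lra. }
    apply Rmult_le_compat; lra.
  - assert (p <= 1). { unfold p. rewrite <- exp_0. apply exp_monotone; lra. }
    replace (L * L) with ((- L) * (- L)) by ring. replace ((p - q) * (p - q)) with ((q - p) * (q - p)) by ring.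
    apply Rmult_le_compat; lra.
Qed.

Lemma gamma_integrand_RtoC (x u : R) :
  gamma_integrand (RtoC x) u = RtoC (Rpower u (x - 1) * exp (- u)).
Proof. unfold gamma_integrand. rewrite <- RtoC_minus, cpow_RtoC, <- RtoC_mult. reflexivity. Qed.

Lemma Re_scal (r : R) (z : C) : Re (RtoC r * z)%C = r * Re z.
Proof. unfold Re; simpl. ring. Qed.

Lemma Re_plus (z w : C) : Re (z + w)%C = Re z + Re w.
Proof. reflexivity. Qed.

Lemma Re_RtoC (r : R) : Re (RtoC r) = r.
Proof. reflexivity. Qed.

(* [u^(x-1) >= u^2 - 1] for all u > 0, so Gamma(x) >= Gamma(3) - Gamma(1) = 1. *)
Lemma CGamma_ge_1 (x : R) : 3 <= x -> 1 <= Re (CGamma (RtoC x)).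
Proof.
  intro Hx.
  assert (G2 : CGamma (RtoC 2) = 1%C).
  { replace (RtoC 2) with (RtoC 1 + 1)%C by (rewrite <- RtoC_plus; f_equal; ring).
    rewrite CGamma_succ, CGamma_1 by (simpl; lra). ring. }
  assert (G3 : CGamma (RtoC 3) = RtoC 2).
  { replace (RtoC 3) with (RtoC 2 + 1)%C by (rewrite <- RtoC_plus; f_equal; ring).
    rewrite CGamma_succ, G2 by (simpl; lra). ring. }
  assert (E : @is_RInt_gen CR (fun u => @plus CR (gamma_integrand (RtoC x) u)
      (@plus CR (RtoC (-1) * gamma_integrand (RtoC 3) u)%C (gamma_integrand (RtoC 1) u)))
      (at_right 0) (Rbar_locally p_infty)
      (@plus CR (CGamma (RtoC x)) (@plus CR (RtoC (-1) * CGamma (RtoC 3))%C (CGamma (RtoC 1))))).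
  { apply (is_RInt_gen_plus (V := CR)); [|apply (is_RInt_gen_plus (V := CR)); [apply is_RInt_gen_Cmult; [typeclasses eauto|typeclasses eauto|]|]];
    apply is_RInt_gen_CGamma; simpl; lra. }
  apply Re_RInt_gen_nonneg in E.
  - rewrite G3, CGamma_1 in E.
    change (0 <= Re (CGamma (RtoC x) + (RtoC (-1) * RtoC 2 + 1))%C) in E.
    rewrite <- RtoC_mult, <- RtoC_plus, Re_plus, Re_RtoC in E. lra.
  - intros u Hu. rewrite !gamma_integrand_RtoC.
    change (0 <= Re (RtoC (Rpower u (x - 1) * exp (- u)) + (RtoC (-1) * RtoC (Rpower u (3 - 1) * exp (- u)) + RtoC (Rpower u (1 - 1) * exp (- u))))%C).
    rewrite <- RtoC_mult, <- !RtoC_plus. simpl.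
    replace (Rpower u (1 - 1)) with 1 by (replace (1 - 1) with 0 by ring; rewrite Rpower_O; auto).
    replace (Rpower u (x - 1) * exp (- u) + (-1 * (Rpower u (3 - 1) * exp (- u)) + 1 * exp (- u)))
      with ((Rpower u (x - 1) - Rpower u (3 - 1) + 1) * exp (- u)) by ring.
    apply Rmult_le_pos; [|left; apply exp_pos].
    destruct (Rle_dec 1 u) as [H|H].
    + assert (Rpower u (3 - 1) <= Rpower u (x - 1)) by (apply Rle_Rpower; lra). lra.
    + assert (Rpower u (3 - 1) <= Rpower 1 (3 - 1)) by (apply Rle_Rpower_l; lra).
      replace (Rpower 1 (3 - 1)) with 1 in * by (unfold Rpower; rewrite ln_1, Rmult_0_r, exp_0; reflexivity).
      pose proof (exp_pos ((x - 1) * ln u)). fold (Rpower u (x - 1)) in *. lra.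
Qed.

(* The weight [u^(x-1) e^(-u)] concentrates near u = x, where the phase [(u/x)^(iy)] is close to 1. *)
Lemma CGamma_neq_0_large (x y : R) : 3 <= x -> 1 + 2 * (y * y) < x -> CGamma (x, y) <> 0%C.
Proof.
  intros Hx Hxy H0.
  set (k0 := - (1 + 4 * (y * y))). set (k1 := 2 * (y * y) / x). set (k2 := 2 * (y * y) * x).
  set (c := cpow x (0, - y)).
  assert (E : @is_RInt_gen CR (fun u => @plus CR (c * gamma_integrand (x, y) u)%C
      (@plus CR (RtoC k0 * gamma_integrand (RtoC x) u)%C
        (@plus CR (RtoC k1 * gamma_integrand (RtoC (x + 1)) u)%C (RtoC k2 * gamma_integrand (RtoC (x - 1)) u)%C)))
      (at_right 0) (Rbar_locally p_infty)
      (@plus CR (c * CGamma (x, y))%C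
      (@plus CR (RtoC k0 * CGamma (RtoC x))%C
        (@plus CR (RtoC k1 * CGamma (RtoC (x + 1)))%C (RtoC k2 * CGamma (RtoC (x - 1)))%C)))).
  { apply (is_RInt_gen_plus (V := CR)); [|apply (is_RInt_gen_plus (V := CR)); [|apply (is_RInt_gen_plus (V := CR))]]; (apply is_RInt_gen_Cmult; [typeclasses eauto|typeclasses eauto|]);
    apply is_RInt_gen_CGamma; simpl; lra. }
  apply Re_RInt_gen_nonneg in E.
  - set (G := CGamma (RtoC x)) in *.
    assert (G1 : CGamma (RtoC (x + 1)) = (RtoC x * G)%C).
    { rewrite RtoC_plus, CGamma_succ by (simpl; lra). reflexivity. }
    assert (G2 : CGamma (RtoC (x - 1)) = (RtoC (/ (x - 1)) * G)%C).
    { unfold G. replace (RtoC x) with (RtoC (x - 1) + 1)%C by (rewrite <- RtoC_plus; f_equal; ring).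
      rewrite CGamma_succ by (simpl; lra). rewrite Cmult_assoc, <- RtoC_mult, Rinv_l by lra. ring. }
    rewrite G1, G2, H0 in E.
    change (0 <= Re (c * 0 + (RtoC k0 * G + (RtoC k1 * (RtoC x * G) + RtoC k2 * (RtoC (/ (x - 1)) * G))))%C) in E.
    replace (c * 0 + (RtoC k0 * G + (RtoC k1 * (RtoC x * G) + RtoC k2 * (RtoC (/ (x - 1)) * G))))%C
      with (RtoC (- (1 - 2 * (y * y) / (x - 1))) * G)%C in E.
    + rewrite Re_scal in E. pose proof (CGamma_ge_1 x Hx) as HG. fold G in HG.
      assert (0 < 1 - 2 * (y * y) / (x - 1)).
      { replace (1 - 2 * (y * y) / (x - 1)) with ((x - 1 - 2 * (y * y)) / (x - 1)) by (field; lra).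
        apply Rdiv_lt_0_compat; lra. }
      nra.
    + replace (- (1 - 2 * (y * y) / (x - 1))) with (k0 + (k1 * x + k2 * / (x - 1))).
      * rewrite !RtoC_plus, !RtoC_mult. ring.
      * unfold k0, k1, k2. field. lra.
  - intros u Hu.
    set (P := Rpower u (x - 1) * exp (- u)).
    assert (HP : 0 < P) by (apply Rmult_lt_0_compat; apply exp_pos).
    assert (E0 : gamma_integrand (RtoC x) u = RtoC P) by apply gamma_integrand_RtoC.
    assert (E1 : gamma_integrand (RtoC (x + 1)) u = RtoC (u * P)).
    { rewrite RtoC_plus, gamma_integrand_succ, E0, RtoC_mult by exact Hu. reflexivity. }
    assert (E2 : gamma_integrand (RtoC (x - 1)) u = RtoC (/ u * P)).
    { rewrite RtoC_mult, <- E0.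
      replace (RtoC x) with (RtoC (x - 1) + 1)%C by (rewrite <- RtoC_plus; f_equal; ring).
      rewrite gamma_integrand_succ by exact Hu. rewrite Cmult_assoc, <- RtoC_mult, Rinv_l by lra. ring. }
    assert (E3 : (c * gamma_integrand (x, y) u)%C = (RtoC P * cexp (0%R, (y * ln (u / x))%R))%C).
    { unfold c, gamma_integrand, P.
      replace ((x, y) - 1)%C with (RtoC (x - 1) + (0, y))%C.
      2:{ unfold Cplus, Cminus, RtoC, Copp; simpl. unfold Cplus; simpl. f_equal; ring. }
      rewrite cpow_plus, cpow_RtoC, RtoC_mult.
      replace (cexp (0%R, (y * ln (u / x))%R)) with (cpow x (0%R, (- y)%R) * cpow u (0%R, y))%C.
      - ring.
      - unfold cpow. rewrite <- cexp_plus. f_equal. unfold Rdiv. rewrite ln_mult, ln_Rinv by (try apply Rinv_0_lt_compat; lra).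
        unfold Cplus, Cmult, RtoC; simpl. f_equal; ring. }
    rewrite E0, E1, E2, E3.
    change (0 <= Re (RtoC P * cexp (0%R, (y * ln (u / x))%R) + (RtoC k0 * RtoC P + (RtoC k1 * RtoC (u * P) + RtoC k2 * RtoC (/ u * P))))%C).
    rewrite <- !RtoC_mult, <- !RtoC_plus.
    assert (Hux : 0 < u / x) by (apply Rdiv_lt_0_compat; lra).
    set (L := ln (u / x)) in *.
    replace (Re (RtoC P * cexp (0%R, (y * L)%R) + RtoC (k0 * P + (k1 * (u * P) + k2 * (/ u * P))))%C)
      with (P * (cos (y * L) + k0 + k1 * u + k2 * / u)).
    2:{ unfold Re, cexp; simpl. rewrite exp_0. ring. }
    apply Rmult_le_pos; [lra|].
    pose proof (cos_ge (y * L)) as Hcos.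
    pose proof (ln_sqr_le (u / x) Hux) as HL. fold L in HL.
    assert (HyL : y * L * (y * L) / 2 <= 2 * (y * y) * (u / x - 2 + / (u / x))).
    { replace (y * L * (y * L) / 2) with ((y * y) / 2 * (L * L)) by field.
      replace (2 * (y * y) * (u / x - 2 + / (u / x))) with (y * y / 2 * (4 * (u / x - 2 + / (u / x)))) by (field; lra).
      apply Rmult_le_compat_l; [pose proof (Rle_0_sqr y); unfold Rsqr in *; lra|exact HL]. }
    replace (k0 + k1 * u + k2 * / u) with (- (1) + 2 * (y * y) * (u / x - 2 + / (u / x))) in *
      by (unfold k0, k1, k2; field; lra).
    replace (cos (y * L) + k0 + k1 * u + k2 * / u) with
      (cos (y * L) + (- (1) + 2 * (y * y) * (u / x - 2 + / (u / x)))) by (unfold k0, k1, k2; field; lra).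
    lra.
Qed.

Lemma CGamma_neq_0 (z : C) : 0 < Re z -> CGamma z <> 0%C.
Proof.
  destruct z as [x y]. simpl. intro Hx.
  assert (Hn : forall n x, 0 < x -> CGamma (x + INR n, y) <> 0%C -> CGamma (x, y) <> 0%C).
  { induction n as [|n IH]; intros x0 Hx0 H.
    - simpl in H. rewrite Rplus_0_r in H. exact H.
    - apply IH; [exact Hx0|]. intro H1. apply H.
      pose proof (pos_INR n).
      replace (x0 + INR (S n), y) with (((x0 + INR n)%R, y) + 1)%C.
      2:{ rewrite S_INR. unfold Cplus, RtoC; simpl. f_equal; ring. }
      rewrite CGamma_succ, H1 by (simpl; lra). ring. }
  destruct (INR_unbounded (3 + 2 * (y * y))) as [n Hn'].
  apply (Hn n x Hx). assert (0 <= y * y) by apply Rle_0_sqr.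
  apply CGamma_neq_0_large; lra.
Qed.

(** * Derivatives on a closed interval *)

Lemma is_deriv_on_at_eps (T : R) (f : R -> C) (t : R) (l : C) : is_deriv_on_at T f t l <->
  forall eps, 0 < eps -> exists d, 0 < d /\ forall s, inI T s -> s <> t -> Rabs (s - t) < d ->
    Cmod ((f s - f t) * RtoC (/ (s - t)) - l) < eps.
Proof.
  split.
  - intros H eps He.
    destruct (proj1 (filterlim_C_Cmod _ _ l) H eps He) as [d Hd].
    exists d; split; [apply cond_pos|]. intros s Hs Hne Hst. apply Hd; auto.
  - intros H. apply filterlim_C_Cmod; [typeclasses eauto|].
    intros eps He. destruct (H eps He) as [d [Hd0 Hd]].
    exists (mkposreal d Hd0). intros s Hs [HI Hne]. apply Hd; auto.
Qed.

Lemma inI_near (T t d : R) : 0 < T -> inI T t -> 0 < d ->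
  exists s, inI T s /\ s <> t /\ Rabs (s - t) < d.
Proof.
  unfold inI. intros HT Ht Hd.
  set (e := Rmin (d / 2) (T / 2)).
  assert (He : 0 < e) by (apply Rmin_pos; lra).
  assert (e <= d / 2) by apply Rmin_l. assert (e <= T / 2) by apply Rmin_r.
  destruct (Rle_dec t (T / 2)) as [H'|H'].
  - exists (t + e). split; [lra|]. split; [lra|]. apply Rabs_def1; lra.
  - exists (t - e). split; [lra|]. split; [lra|]. apply Rabs_def1; lra.
Qed.

Lemma is_deriv_on_at_unique (T : R) (f : R -> C) (t : R) (l1 l2 : C) : 0 < T -> inI T t ->
  is_deriv_on_at T f t l1 -> is_deriv_on_at T f t l2 -> l1 = l2.
Proof.
  intros HT Ht H1 H2. apply Ceq_minus, Cmod_eq_0, Rle_antisym; [|apply Cmod_ge_0].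
  apply le_epsilon. intros eps He. rewrite Rplus_0_l.
  destruct (proj1 (is_deriv_on_at_eps _ _ _ _) H1 (eps / 2)) as [d1 [Hd1 K1]]; [lra|].
  destruct (proj1 (is_deriv_on_at_eps _ _ _ _) H2 (eps / 2)) as [d2 [Hd2 K2]]; [lra|].
  destruct (inI_near T t (Rmin d1 d2) HT Ht) as [s [Hs [Hne Hst]]]; [apply Rmin_pos; assumption|].
  specialize (K1 s Hs Hne (Rlt_le_trans _ _ _ Hst (Rmin_l _ _))).
  specialize (K2 s Hs Hne (Rlt_le_trans _ _ _ Hst (Rmin_r _ _))).
  set (q := ((f s - f t) * RtoC (/ (s - t)))%C) in *.
  replace (l1 - l2)%C with ((q - l2) + - (q - l1))%C by ring.
  eapply Rle_trans; [apply Cmod_triangle|]. rewrite Cmod_opp. lra.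
Qed.

Lemma cderiv_eq (T : R) (f : R -> C) (t : R) (l : C) : 0 < T -> inI T t ->
  is_deriv_on_at T f t l -> cderiv T f t = l.
Proof.
  intros HT Ht H. apply (is_deriv_on_at_unique T f t); auto.
  unfold cderiv. apply epsilon_spec. exists l. exact H.
Qed.

Lemma is_deriv_on_at_ext (T : R) (f g : R -> C) (t : R) (l : C) : inI T t ->
  (forall s, inI T s -> f s = g s) -> is_deriv_on_at T f t l -> is_deriv_on_at T g t l.
Proof.
  intros Ht E H. apply is_deriv_on_at_eps. intros eps He.
  destruct (proj1 (is_deriv_on_at_eps _ _ _ _) H eps He) as [d [Hd K]].
  exists d. split; [exact Hd|]. intros s Hs. rewrite <- !E by assumption. apply K, Hs.
Qed.

Lemma differentiable_on_ext (T : R) (f g : R -> C) : (forall s, inI T s -> f s = g s) ->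
  differentiable_on T f -> differentiable_on T g.
Proof.
  intros E H t Ht. destruct (H t Ht) as [l Hl]. exists l. eapply is_deriv_on_at_ext; eauto.
Qed.

Lemma delta_phi_ext (T : R) (p q : R -> R) (f g : R -> C) (t : R) : inI T t ->
  p t = q t -> (forall s, inI T s -> f s = g s) -> delta_phi T p f t = delta_phi T q g t.
Proof.
  intros Ht Ep E. unfold delta_phi. rewrite Ep. f_equal. unfold cderiv. f_equal.
  apply functional_extensionality. intro l. apply propositional_extensionality.
  split; apply is_deriv_on_at_ext; auto. intros; symmetry; auto.
Qed.

Lemma delta_phi_n_ext (T : R) (p q : R -> R) (k : nat) (f g : R -> C) :
  (forall s, inI T s -> p s = q s) -> (forall s, inI T s -> f s = g s) ->
  forall t, inI T t -> delta_phi_n T p k f t = delta_phi_n T q k g t.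
Proof.
  intros Ep E. induction k as [|k IH]; intros t Ht; simpl; [auto|].
  apply delta_phi_ext; auto.
Qed.

Lemma is_derive_is_deriv_on_at (T : R) (f : R -> C) (t : R) (l : C) :
  @is_derive R_AbsRing C_R_NormedModule f t l -> is_deriv_on_at T f t l.
Proof.
  intros [_ H]. apply is_deriv_on_at_eps. intros eps He.
  specialize (H t (fun P HP => HP)).
  assert (He2 : 0 < eps / 2) by lra.
  destruct (H (mkposreal _ He2)) as [d Hd].
  exists d. split; [apply cond_pos|]. intros s Hs Hne Hst.
  specialize (Hd s Hst). simpl in Hd. rewrite norm_C_R, scal_C_R in Hd.
  change (Cmod ((f s - f t) - RtoC (s - t) * l)%C <= eps / 2 * Rabs (s - t)) in Hd.
  assert (Hst0 : s - t <> 0) by lra.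
  replace ((f s - f t) * RtoC (/ (s - t)) - l)%C with
    (((f s - f t) - RtoC (s - t) * l) * RtoC (/ (s - t)))%C.
  2:{ rewrite RtoC_inv by assumption. field. apply RtoC_neq_0, Hst0. }
  rewrite Cmod_mult, Cmod_R, Rabs_inv.
  apply Rle_lt_trans with (eps / 2); [|lra].
  pose proof (Rabs_pos_lt _ Hst0).
  apply Rmult_le_reg_r with (Rabs (s - t)); [assumption|].
  rewrite Rmult_assoc, Rinv_l by lra. rewrite Rmult_1_r. exact Hd.
Qed.

Lemma is_rderiv_on_at_eps (T : R) (f : R -> R) (t l : R) : is_rderiv_on_at T f t l <->
  forall eps, 0 < eps -> exists d, 0 < d /\ forall s, inI T s -> s <> t -> Rabs (s - t) < d ->
    Rabs ((f s - f t) / (s - t) - l) < eps.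
Proof.
  split.
  - intros H eps He.
    destruct (proj1 (filterlim_locally _ l) H (mkposreal eps He)) as [d Hd].
    exists d; split; [apply cond_pos|]. intros s Hs Hne Hst. apply Hd; auto.
  - intros H. apply filterlim_locally.
    intros eps. destruct (H eps (cond_pos eps)) as [d [Hd0 Hd]].
    exists (mkposreal d Hd0). intros s Hs [HI Hne]. apply Hd; auto.
Qed.

Lemma rderiv_zero_const (T : R) (F : R -> R) : 0 < T ->
  (forall t, inI T t -> is_rderiv_on_at T F t 0) -> forall t, inI T t -> F t = F 0.
Proof.
  intros HT H t Ht. unfold inI in Ht.
  set (G := fun s => F (clamp T s)).
  assert (HG : forall x, 0 < x < T -> is_derive G x 0).
  { intros x Hx. assert (HxI : inI T x) by (unfold inI; lra).
    apply is_derive_Reals. intros eps He.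
    destruct (proj1 (is_rderiv_on_at_eps _ _ _ _) (H x HxI) eps He) as [d [Hd K]].
    assert (Hm : 0 < Rmin d (Rmin x (T - x))) by (apply Rmin_pos; [assumption|apply Rmin_pos; lra]).
    exists (mkposreal _ Hm). intros h Hh0 Hh. simpl in Hh.
    assert (Rabs h < d) by (eapply Rlt_le_trans; [exact Hh|apply Rmin_l]).
    assert (Rabs h < x) by (eapply Rlt_le_trans; [exact Hh|eapply Rle_trans; [apply Rmin_r|apply Rmin_l]]).
    assert (Rabs h < T - x) by (eapply Rlt_le_trans; [exact Hh|eapply Rle_trans; [apply Rmin_r|apply Rmin_r]]).
    assert (HI : inI T (x + h)).
    { apply Rabs_def2 in H1. apply Rabs_def2 in H2. unfold inI; lra. }
    unfold G. rewrite !clamp_id by assumption.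
    specialize (K (x + h) HI ltac:(lra)). replace (x + h - x) with h in K by ring. auto. }
  assert (HGc : forall x, continuity_pt G x).
  { intro x. apply continuity_pt_filterlim. apply filterlim_locally. intro eps.
    set (y := clamp T x). assert (Hy : inI T y) by (apply clamp_inI; lra).
    destruct (proj1 (is_rderiv_on_at_eps _ _ _ _) (H y Hy) 1 Rlt_0_1) as [d [Hd K]].
    assert (Hm : 0 < Rmin d eps) by (apply Rmin_pos; [assumption|apply cond_pos]).
    exists (mkposreal _ Hm). intros z Hz. change (Rabs (z - x) < Rmin d eps) in Hz.
    change (Rabs (F (clamp T z) - F y) < eps).
    pose proof (Rle_lt_trans _ _ _ (clamp_dist T z x) Hz) as Hzy. fold y in Hzy.
    assert (Hz' : inI T (clamp T z)) by (apply clamp_inI; lra).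
    destruct (Req_dec (clamp T z) y) as [->|Hne].
    { unfold Rminus. rewrite Rplus_opp_r, Rabs_R0. apply cond_pos. }
    specialize (K _ Hz' Hne (Rlt_le_trans _ _ _ Hzy (Rmin_l _ _))).
    rewrite Rminus_0_r in K. unfold Rdiv in K. rewrite Rabs_mult, Rabs_inv in K.
    assert (Hp : 0 < Rabs (clamp T z - y)) by (apply Rabs_pos_lt; lra).
    apply Rlt_le_trans with (Rabs (clamp T z - y)).
    - apply Rmult_lt_reg_r with (/ Rabs (clamp T z - y)); [apply Rinv_0_lt_compat, Hp|].
      rewrite Rinv_r by lra. exact K.
    - left. eapply Rlt_le_trans; [exact Hzy|apply Rmin_r]. }
  destruct (MVT_gen G 0 t (fun _ => 0)) as [c [_ Hc]].
  - rewrite Rmin_left, Rmax_right by lra. intros x Hx. apply HG. lra.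
  - intros; apply HGc.
  - unfold G in Hc. rewrite !clamp_id in Hc by (unfold inI; lra). lra.
Qed.

Lemma deriv_zero_const (T : R) (F : R -> C) : 0 < T ->
  (forall t, inI T t -> is_deriv_on_at T F t 0%C) -> forall t, inI T t -> F t = F 0.
Proof.
  intros HT H.
  assert (Hc : forall p : C -> R, (forall z w r, p ((z - w) * RtoC r)%C = (p z - p w) * r) ->
     (forall z, Rabs (p z) <= Cmod z) -> forall t, inI T t -> p (F t) = p (F 0)).
  { intros p Hp1 Hp2. apply (rderiv_zero_const T (fun s => p (F s)) HT).
    intros t Ht. apply is_rderiv_on_at_eps. intros eps He.
    destruct (proj1 (is_deriv_on_at_eps _ _ _ _) (H t Ht) eps He) as [d [Hd K]].
    exists d. split; [exact Hd|]. intros s Hs Hne Hst. specialize (K s Hs Hne Hst).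
    rewrite Rminus_0_r. unfold Rdiv. rewrite <- Hp1.
    eapply Rle_lt_trans; [apply Hp2|]. unfold Cminus in K at 1. rewrite Copp_0, Cplus_0_r in K. exact K. }
  intros t Ht. apply injective_projections.
  - apply (Hc fst); auto.
    + intros z w r. unfold Cmult, Cminus, Cplus, Copp, RtoC; simpl. ring.
    + intro z. eapply Rle_trans; [apply Rmax_l|apply Rmax_Cmod].
  - apply (Hc snd); auto.
    + intros z w r. unfold Cmult, Cminus, Cplus, Copp, RtoC; simpl. ring.
    + intro z. eapply Rle_trans; [apply Rmax_r|apply Rmax_Cmod].
Qed.

Lemma is_deriv_on_at_minus (T : R) (f g : R -> C) (t : R) (l m : C) :
  is_deriv_on_at T f t l -> is_deriv_on_at T g t m ->
  is_deriv_on_at T (fun s => f s - g s)%C t (l - m)%C.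
Proof.
  intros Hf Hg. unfold is_deriv_on_at in *.
  apply (filterlim_ext (fun s => (f s - f t) * RtoC (/ (s - t)) + (-(1)) * ((g s - g t) * RtoC (/ (s - t))))%C); [intro; ring|].
  replace (l - m)%C with (l + (-(1)) * m)%C by ring.
  apply filterlim_Cplus; [typeclasses eauto|exact Hf|].
  apply filterlim_Cmult; [typeclasses eauto|apply filterlim_const|exact Hg].
Qed.

(** * Calculus of fractional integrals *)

Definition is_order (alpha : C) : Prop := alpha = 0%C \/ 0 < Re alpha.

Section FracInt.

Variables (T : R) (phi phi' : R -> R).
Hypothesis HT : 0 < T.
Hypothesis Hphi : increasing_C1 phi phi'.

Let I := frac_int phi phi'.
Let J := Jint phi phi'.

Lemma frac_int_pos (alpha : C) (f : R -> C) (t : R) : 0 < Re alpha ->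
  I alpha f t = (/ CGamma alpha * J alpha f t)%C.
Proof.
  intro Ha. unfold I, frac_int. destruct C_eq_dec as [E|_]; [|reflexivity].
  subst alpha. simpl in Ha. lra.
Qed.

Lemma frac_int_zero (f : R -> C) (t : R) : I 0 f t = f t.
Proof. unfold I, frac_int. destruct C_eq_dec as [_|E]; [reflexivity|congruence]. Qed.

Lemma frac_int_at_0 (alpha : C) (f : R -> C) : 0 < Re alpha -> I alpha f 0 = 0%C.
Proof. intro Ha. rewrite frac_int_pos by exact Ha. unfold J. rewrite J_0. ring. Qed.

Lemma frac_int_ext (alpha : C) (f g : R -> C) (t : R) : inI T t ->
  (forall s, inI T s -> f s = g s) -> I alpha f t = I alpha g t.
Proof.
  intros Ht E. unfold I, frac_int. destruct C_eq_dec; [auto|]. f_equal.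
  apply cint0_ext. intros s Hs. rewrite E; [reflexivity|unfold inI in *; lra].
Qed.

Lemma frac_int_cont_on (alpha : C) (f : R -> C) : is_order alpha -> cont_on T f ->
  cont_on T (I alpha f).
Proof.
  intros [->|Ha] Hf.
  - apply cont_on_ext with f; [|exact Hf]. intros; symmetry; apply frac_int_zero.
  - apply cont_on_ext with (fun t => / CGamma alpha * J alpha f t)%C.
    + intros; symmetry; apply frac_int_pos, Ha.
    + apply cont_on_scal. apply cont_on_J; assumption.
Qed.

Lemma frac_int_plus (alpha : C) (f g : R -> C) (t : R) : is_order alpha -> inI T t ->
  cont_on T f -> cont_on T g -> I alpha (fun s => f s + g s)%C t = (I alpha f t + I alpha g t)%C.
Proof.
  intros [->|Ha] Ht Hf Hg; [rewrite !frac_int_zero; reflexivity|].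
  rewrite !frac_int_pos by exact Ha. unfold J. rewrite (J_plus _ _ Hphi T); auto using admissible_cont_on, Rlt_le. ring.
Qed.

Lemma frac_int_scal (alpha c : C) (f : R -> C) (t : R) : is_order alpha -> inI T t ->
  cont_on T f -> I alpha (fun s => c * f s)%C t = (c * I alpha f t)%C.
Proof.
  intros [->|Ha] Ht Hf; [rewrite !frac_int_zero; reflexivity|].
  rewrite !frac_int_pos by exact Ha. unfold J. rewrite (J_scal _ _ Hphi T); auto using admissible_cont_on, Rlt_le. ring.
Qed.

Lemma frac_int_comp (alpha beta : C) (f : R -> C) (t : R) : is_order alpha -> is_order beta ->
  cont_on T f -> inI T t -> I alpha (I beta f) t = I (alpha + beta) f t.
Proof.
  intros [->|Ha] Hb Hf Ht.
  { rewrite frac_int_zero. f_equal. ring. }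
  destruct Hb as [->|Hb].
  { replace (alpha + 0)%C with alpha by ring. apply frac_int_ext; [exact Ht|]. intros; apply frac_int_zero. }
  assert (Hab : 0 < Re (alpha + beta)%C) by (simpl; unfold Re in *; lra).
  rewrite (frac_int_ext alpha _ (fun s => / CGamma beta * J beta f s)%C).
  2:{ exact Ht. } 2:{ intros; apply frac_int_pos, Hb. }
  rewrite frac_int_scal; [|right; exact Ha|exact Ht|apply cont_on_J; assumption].
  rewrite !frac_int_pos by assumption. unfold J. rewrite (J_comp _ _ Hphi T) by assumption.
  pose proof (CGamma_mult alpha beta Ha Hb) as E.
  pose proof (CGamma_neq_0 _ Ha). pose proof (CGamma_neq_0 _ Hb). pose proof (CGamma_neq_0 _ Hab).
  replace (beta_const alpha beta) with (CGamma alpha * CGamma beta / CGamma (alpha + beta))%C by (rewrite E; field; assumption).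
  field. auto.
Qed.

Lemma is_order_1 : is_order 1.
Proof. right. simpl. lra. Qed.

Lemma is_order_INR (n : nat) : is_order (RtoC (INR n)).
Proof.
  destruct n; [left; reflexivity|right]. rewrite Re_RtoC. apply lt_0_INR. lia.
Qed.

Lemma is_deriv_frac_int_1 (f : R -> C) (t : R) : cont_on T f -> inI T t ->
  is_deriv_on_at T (I 1 f) t (RtoC (phi' t) * f t)%C.
Proof.
  intros Hf Ht.
  set (g := fun s => (RtoC (phi' s) * f (clamp T s))%C).
  assert (Hg : forall s, @continuous R_UniformSpace C_UniformSpace g s).
  { intro s. apply continuous_Cmult; [apply continuous_RtoC, Hphi|apply continuous_clamp; [lra|exact Hf]]. }
  assert (HR : forall b, @is_RInt CR g 0 b (@RInt CR g 0 b)).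
  { intro b. apply (RInt_correct (V := CR)), (ex_RInt_continuous (V := CR)). intros; apply Hg. }
  assert (HD : forall b, @is_derive R_AbsRing C_R_NormedModule (fun x => @RInt CR g 0 x) b (g b)).
  { intro b. apply (is_derive_RInt (V := C_R_NormedModule) g (fun x => @RInt CR g 0 x) 0 b); [|apply Hg].
    apply filter_forall. exact HR. }
  apply is_deriv_on_at_ext with (fun x => @RInt CR g 0 x); [exact Ht| |].
  - intros s Hs. rewrite frac_int_pos, CGamma_1 by (simpl; lra).
    replace (/ 1)%C with (RtoC 1) by (field; apply RtoC_neq_0; lra). rewrite Cmult_1_l. symmetry.
    destruct (Req_dec s 0) as [->|H0].
    + unfold J. rewrite J_0. symmetry. apply (RInt_point (V := CR)).
    + unfold inI in Hs. apply cint0_eq; [lra|].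
      apply is_RInt_gen_at_left_ext with g; [lra| |].
      * intros u Hu. unfold g, kernel. rewrite clamp_id by (unfold inI; lra).
        replace (1 - 1)%C with (RtoC 0) by ring. rewrite cpow_0. Cring.
      * apply is_RInt_gen_right with (I := fun b => @RInt CR g 0 b); [typeclasses eauto|apply filter_forall, HR|].
        eapply filterlim_filter_le_1.
        2:{ apply (ex_derive_continuous (V := C_R_NormedModule) (fun x => @RInt CR g 0 x) s). exists (g s). apply HD. }
        intros P HP. unfold at_left, within. revert HP. apply filter_imp; auto.
  - replace (RtoC (phi' t) * f t)%C with (g t) by (unfold g; rewrite clamp_id by exact Ht; reflexivity).
    apply is_derive_is_deriv_on_at, HD.
Qed.

Lemma RtoC_phi'_neq_0 (t : R) : RtoC (phi' t) <> 0%C.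
Proof. apply RtoC_neq_0, Rgt_not_eq, Hphi. Qed.

Lemma delta_phi_eq (f : R -> C) (t : R) (w : C) : inI T t ->
  is_deriv_on_at T f t (RtoC (phi' t) * w)%C -> delta_phi T phi' f t = w.
Proof.
  intros Ht H. unfold delta_phi. rewrite (cderiv_eq T f t _ HT Ht H).
  pose proof (RtoC_phi'_neq_0 t). rewrite RtoC_inv by (apply Rgt_not_eq, Hphi). field. assumption.
Qed.

Lemma is_deriv_frac_int_succ (alpha : C) (f : R -> C) (t : R) : is_order alpha -> cont_on T f -> inI T t ->
  is_deriv_on_at T (I (alpha + 1) f) t (RtoC (phi' t) * I alpha f t)%C.
Proof.
  intros Ha Hf Ht. apply is_deriv_on_at_ext with (I 1 (I alpha f)); [exact Ht| |].
  - intros s Hs. rewrite frac_int_comp; auto using is_order_1. f_equal. ring.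
  - apply is_deriv_frac_int_1; [apply frac_int_cont_on; assumption|exact Ht].
Qed.

Lemma delta_phi_n_frac_int (k : nat) (alpha gamma : C) (f : R -> C) : is_order alpha ->
  cont_on T f -> gamma = (alpha + RtoC (INR k))%C ->
  forall t, inI T t -> delta_phi_n T phi' k (I gamma f) t = I alpha f t.
Proof.
  intros Ha Hf. revert alpha gamma Ha. induction k as [|k IH]; intros alpha gamma Ha Eg t Ht; simpl delta_phi_n.
  - subst gamma. f_equal. simpl. ring.
  - transitivity (delta_phi T phi' (I (alpha + 1) f) t).
    + apply delta_phi_ext; [exact Ht|reflexivity|]. apply IH.
      * right. destruct Ha as [->|Ha]; simpl; unfold Re in *; simpl in *; lra.
      * subst gamma. rewrite S_INR, RtoC_plus. ring.
    + apply delta_phi_eq; [exact Ht|]. apply is_deriv_frac_int_succ; assumption.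
Qed.

Lemma differentiable_on_delta_phi_n_frac_int (k : nat) (alpha gamma : C) (f : R -> C) : is_order alpha ->
  cont_on T f -> gamma = (alpha + RtoC (INR (S k)))%C ->
  differentiable_on T (delta_phi_n T phi' k (I gamma f)).
Proof.
  intros Ha Hf Eg. apply differentiable_on_ext with (I (alpha + 1) f).
  - intros s Hs. symmetry. apply delta_phi_n_frac_int; auto.
    + right. destruct Ha as [->|Ha]; simpl; unfold Re in *; simpl in *; lra.
    + subst gamma. rewrite S_INR, RtoC_plus. ring.
  - intros t Ht. eexists. apply is_deriv_frac_int_succ; assumption.
Qed.

Lemma frac_int_delta_phi (g : R -> C) : differentiable_on T g -> cont_on T (delta_phi T phi' g) ->
  g 0 = 0%C -> forall t, inI T t -> g t = I 1 (delta_phi T phi' g) t.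
Proof.
  intros Hg Hw H0 t Ht.
  assert (H0' : inI T 0) by (unfold inI; lra).
  assert (E : (g t - I 1 (delta_phi T phi' g) t)%C = (g 0 - I 1 (delta_phi T phi' g) 0)%C).
  { apply (deriv_zero_const T (fun s => g s - I 1 (delta_phi T phi' g) s)%C HT); [|exact Ht].
    intros s Hs. destruct (Hg s Hs) as [l Hl].
    replace (RtoC 0) with (l - RtoC (phi' s) * delta_phi T phi' g s)%C.
    - apply is_deriv_on_at_minus; [exact Hl|]. apply is_deriv_frac_int_1; assumption.
    - unfold delta_phi. rewrite (cderiv_eq T g s l HT Hs Hl), RtoC_inv by (apply Rgt_not_eq, Hphi).
      field. apply RtoC_phi'_neq_0. }
  rewrite H0, frac_int_at_0 in E by (simpl; lra).
  apply Ceq_minus. rewrite E. ring.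
Qed.

Lemma frac_int_delta_phi_n (n : nat) (g : R -> C) :
  (forall j, (j < n)%nat -> differentiable_on T (delta_phi_n T phi' j g)) ->
  (forall j, (j < n)%nat -> delta_phi_n T phi' j g 0 = 0%C) ->
  cont_on T (delta_phi_n T phi' n g) ->
  forall t, inI T t -> g t = I (RtoC (INR n)) (delta_phi_n T phi' n g) t.
Proof.
  induction n as [|n IH]; intros Hd H0 Hc t Ht.
  - simpl. symmetry. apply frac_int_zero.
  - assert (E : forall s, inI T s -> delta_phi_n T phi' n g s = I 1 (delta_phi_n T phi' (S n) g) s).
    { apply frac_int_delta_phi; auto. }
    rewrite IH; auto.
    + rewrite (frac_int_ext _ _ _ t Ht E). rewrite frac_int_comp; auto using is_order_1.
      * f_equal. rewrite S_INR, RtoC_plus. reflexivity.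
      * apply is_order_INR.
    + apply cont_on_ext with (I 1 (delta_phi_n T phi' (S n) g)).
      * intros; symmetry; auto.
      * apply frac_int_cont_on; [apply is_order_1|exact Hc].
Qed.

End FracInt.

(** * Caputo derivatives of fractional integrals *)

Lemma nceil_spec (x : R) : 0 <= x -> INR (nceil x) - 1 < x <= INR (nceil x).
Proof.
  intro Hx. destruct (base_Int_part (- x)) as [H1 H2].
  assert (E : INR (nceil x) = - IZR (Int_part (- x))).
  { unfold nceil. rewrite <- opp_IZR, INR_IZR_INZ, Z2Nat.id; [reflexivity|].
    apply le_IZR. rewrite opp_IZR. lra. }
  rewrite E. lra.
Qed.

Lemma nceil_le (x y : R) : 0 <= x <= y -> (nceil x <= nceil y)%nat.
Proof.
  intro H. pose proof (nceil_spec x ltac:(lra)). pose proof (nceil_spec y ltac:(lra)).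
  apply Nat.lt_succ_r, INR_lt. rewrite S_INR. lra.
Qed.

Lemma is_order_nceil (b : C) : 0 <= Re b -> (forall k, Re b = INR k -> Im b = 0) ->
  is_order (RtoC (INR (nceil (Re b))) - b)%C.
Proof.
  intros Hb Hint. pose proof (nceil_spec (Re b) Hb) as [_ [H|H]].
  - right. unfold Cminus. rewrite Re_plus. simpl. unfold Re in *. simpl. lra.
  - left. specialize (Hint _ H). destruct b as [x y]. unfold Re, Im in *; simpl in *. subst y.
    rewrite <- H. unfold Cminus, Cplus, Copp, RtoC; simpl. f_equal; ring.
Qed.

Lemma taylor_zero (T : R) (phi phi' : R -> R) (n : nat) (f : R -> C) (s : R) :
  (forall j, (j < n)%nat -> delta_phi_n T phi' j f 0 = 0%C) -> taylor T phi phi' n f s = 0%C.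
Proof.
  unfold taylor. induction n as [|n IH]; intro H; simpl; [reflexivity|].
  rewrite IH by auto. rewrite H by auto.
  change (0 + 0 * RtoC ((phi s - phi 0) ^ n / INR (fact n)) = 0)%C. ring.
Qed.

Section Caputo.

Variables (T : R) (phi phi' : R -> R).
Hypothesis HT : 0 < T.
Hypothesis Hphi : increasing_C1 phi phi'.

Let I := frac_int phi phi'.

Lemma inI_0 : inI T 0.
Proof. unfold inI; lra. Qed.

Lemma delta_phi_n_frac_int_lt (b0 : C) (w x : R -> C) (j : nat) : 0 < Re b0 -> cont_on T w ->
  (forall t, inI T t -> x t = I b0 w t) -> (j < nceil (Re b0))%nat ->
  0 < Re (b0 - RtoC (INR j))%C /\
  forall t, inI T t -> delta_phi_n T phi' j x t = I (b0 - RtoC (INR j)) w t.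
Proof.
  intros Hb0 Hw Hx Hj.
  assert (Hp : 0 < Re (b0 - RtoC (INR j))%C).
  { unfold Cminus. rewrite Re_plus, <- RtoC_opp, Re_RtoC.
    pose proof (nceil_spec (Re b0) ltac:(lra)). apply le_INR in Hj. rewrite S_INR in Hj. lra. }
  split; [exact Hp|]. intros t Ht.
  rewrite (delta_phi_n_ext T phi' phi' j x (I b0 w)); auto.
  apply delta_phi_n_frac_int; auto; [right; exact Hp|ring].
Qed.

Lemma delta_phi_n_frac_int_0 (b0 : C) (w x : R -> C) (j : nat) : 0 < Re b0 -> cont_on T w ->
  (forall t, inI T t -> x t = I b0 w t) -> (j < nceil (Re b0))%nat ->
  delta_phi_n T phi' j x 0 = 0%C.
Proof.
  intros Hb0 Hw Hx Hj.
  destruct (delta_phi_n_frac_int_lt b0 w x j Hb0 Hw Hx Hj) as [Hp E].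
  rewrite E by apply inI_0. apply frac_int_at_0, Hp.
Qed.

Lemma caputo_inner (b0 b : C) (w x : R -> C) : 0 < Re b0 -> 0 <= Re b <= Re b0 ->
  is_order (RtoC (INR (nceil (Re b))) - b)%C -> cont_on T w ->
  (forall t, inI T t -> x t = I b0 w t) -> forall t, inI T t ->
  I (RtoC (INR (nceil (Re b))) - b) (fun s => x s - taylor T phi phi' (nceil (Re b)) x s)%C t =
  I (RtoC (INR (nceil (Re b))) - b + b0) w t.
Proof.
  intros Hb0 Hb Ho Hw Hx t Ht.
  rewrite <- (frac_int_comp T phi phi' HT Hphi); auto; [|right; exact Hb0].
  apply (frac_int_ext T); [exact Ht|]. intros s Hs.
  rewrite taylor_zero; [rewrite Hx by exact Hs; unfold I; ring|].
  intros j Hj. apply (delta_phi_n_frac_int_0 b0 w); auto.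
  eapply Nat.lt_le_trans; [exact Hj|apply nceil_le; lra].
Qed.

Lemma caputo_frac_int (b0 b : C) (w x : R -> C) : 0 < Re b0 -> 0 <= Re b <= Re b0 ->
  is_order (RtoC (INR (nceil (Re b))) - b)%C -> is_order (b0 - b)%C -> cont_on T w ->
  (forall t, inI T t -> x t = I b0 w t) -> forall t, inI T t ->
  caputo T phi phi' b x t = I (b0 - b) w t.
Proof.
  intros Hb0 Hb Ho Ho' Hw Hx t Ht. unfold caputo, RL_der.
  rewrite (delta_phi_n_ext T phi' phi' _ _ (I (RtoC (INR (nceil (Re b))) - b + b0) w)); auto.
  - apply delta_phi_n_frac_int; auto. ring.
  - apply caputo_inner; auto.
Qed.

Lemma in_space_frac_int (b0 : C) (w x : R -> C) : 0 < Re b0 ->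
  is_order (RtoC (INR (nceil (Re b0))) - b0)%C -> cont_on T w ->
  (forall t, inI T t -> x t = I b0 w t) -> in_space T phi phi' b0 x.
Proof.
  intros Hb0 Ho Hw Hx. set (n0 := nceil (Re b0)).
  assert (Ho0 : is_order (b0 - b0)%C) by (left; ring).
  split; [|split; [|split]].
  - intros k Hk. destruct (delta_phi_n_frac_int_lt b0 w x k Hb0 Hw Hx Hk) as [Hp E].
    apply cont_on_ext with (I (b0 - RtoC (INR k)) w); [intros; symmetry; auto|].
    apply frac_int_cont_on; auto. right; exact Hp.
  - intros k Hk. destruct (delta_phi_n_frac_int_lt b0 w x (S k) Hb0 Hw Hx Hk) as [Hp _].
    apply differentiable_on_ext with (delta_phi_n T phi' k (I b0 w)).
    + apply delta_phi_n_ext; auto. intros; symmetry; auto.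
    + apply (differentiable_on_delta_phi_n_frac_int T phi phi' HT Hphi k (b0 - RtoC (INR (S k)))%C); auto; [right; exact Hp|ring].
  - intros j Hj.
    apply differentiable_on_ext with (delta_phi_n T phi' j (I (RtoC (INR n0) - b0 + b0) w)).
    + apply delta_phi_n_ext; auto. intros s Hs. symmetry. apply caputo_inner; auto; lra.
    + apply (differentiable_on_delta_phi_n_frac_int T phi phi' HT Hphi j (RtoC (INR (n0 - S j)))); auto using is_order_INR.
      rewrite <- RtoC_plus, <- plus_INR. replace (n0 - S j + S j)%nat with n0 by (unfold n0 in *; lia). ring.
  - apply cont_on_ext with (I (b0 - b0) w).
    + intros t Ht. symmetry. apply caputo_frac_int; auto; lra.
    + apply frac_int_cont_on; auto.
Qed.

Lemma frac_int_caputo (b0 : C) (x : R -> C) : 0 < Re b0 ->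
  is_order (RtoC (INR (nceil (Re b0))) - b0)%C -> in_space T phi phi' b0 x ->
  (forall k, (k < nceil (Re b0))%nat -> delta_phi_n T phi' k x 0 = 0%C) ->
  forall t, inI T t -> x t = I b0 (caputo T phi phi' b0 x) t.
Proof.
  intros Hb0 Ho [Hc [Hd [Hg Hcap]]] H0.
  set (n0 := nceil (Re b0)) in *. set (w := caputo T phi phi' b0 x) in *.
  set (sg := (RtoC (INR n0) - b0)%C) in *.
  pose proof (nceil_spec (Re b0) ltac:(lra)) as Hn0. fold n0 in Hn0.
  destruct n0 as [|p] eqn:En; [simpl in Hn0; lra|].
  set (u := delta_phi_n T phi' p x).
  assert (Hu : cont_on T u) by (apply Hc; lia).
  assert (Hxu : forall t, inI T t -> x t = I (RtoC (INR p)) u t).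
  { apply frac_int_delta_phi_n; auto. intros j Hj. apply Hd. lia. }
  assert (Hxc : cont_on T x).
  { apply cont_on_ext with (I (RtoC (INR p)) u); [intros; symmetry; auto|].
    apply frac_int_cont_on; auto using is_order_INR. }
  set (g := I sg (fun s => x s - taylor T phi phi' (S p) x s)%C).
  assert (Hgx : forall t, inI T t -> g t = I sg x t).
  { intros t Ht. apply (frac_int_ext T); [exact Ht|]. intros s Hs. rewrite taylor_zero by exact H0. ring. }
  assert (Hgu : forall t, inI T t -> g t = I (sg + RtoC (INR p)) u t).
  { intros t Ht. rewrite Hgx by exact Ht. rewrite <- (frac_int_comp T phi phi' HT Hphi); auto using is_order_INR.
    apply (frac_int_ext T); auto. }
  assert (Hwg : w = delta_phi_n T phi' (S p) g).
  { unfold w, caputo, RL_der. fold n0. rewrite En. reflexivity. }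
  assert (Hg0 : forall j, (j < S p)%nat -> delta_phi_n T phi' j g 0 = 0%C).
  { intros j Hj.
    rewrite (delta_phi_n_ext T phi' phi' j g _ (fun _ _ => eq_refl) Hgu 0 inI_0).
    assert (Ej : (sg + RtoC (INR p))%C = (sg + RtoC (INR (p - j)) + RtoC (INR j))%C).
    { rewrite <- Cplus_assoc, <- RtoC_plus, <- plus_INR. do 3 f_equal. lia. }
    assert (Hoj : is_order (sg + RtoC (INR (p - j)))%C).
    { destruct Ho as [Ho|Ho].
      - rewrite Ho. replace (0 + RtoC (INR (p - j)))%C with (RtoC (INR (p - j))) by ring. apply is_order_INR.
      - right. rewrite Re_plus, Re_RtoC. pose proof (pos_INR (p - j)). lra. }
    rewrite (delta_phi_n_frac_int T phi phi' HT Hphi j (sg + RtoC (INR (p - j)))%C); auto using inI_0.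
    destruct Hoj as [Hoj|Hoj]; [|apply frac_int_at_0, Hoj].
    rewrite Hoj, frac_int_zero. apply H0. lia. }
  assert (Hgw : forall t, inI T t -> g t = I (RtoC (INR (S p))) w t).
  { rewrite Hwg. apply frac_int_delta_phi_n; auto. rewrite <- Hwg. exact Hcap. }
  assert (E : forall t, inI T t -> I (RtoC (INR (S p))) x t = I (RtoC (INR (S p))) (I b0 w) t).
  { intros t Ht.
    assert (Hob0 : is_order b0) by (right; exact Hb0).
    unfold I at 2. rewrite (frac_int_comp T phi phi' HT Hphi); auto using is_order_INR.
    rewrite Cplus_comm. rewrite <- (frac_int_comp T phi phi' HT Hphi); auto using is_order_INR.
    transitivity (I b0 g t).
    - transitivity (I b0 (I sg x) t).
      + unfold I. rewrite (frac_int_comp T phi phi' HT Hphi); auto. f_equal. unfold sg. ring.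
      + apply (frac_int_ext T); [exact Ht|]. intros; symmetry; auto.
    - apply (frac_int_ext T); auto. }
  intros t Ht.
  assert (Hid : forall f, cont_on T f -> delta_phi_n T phi' (S p) (I (RtoC (INR (S p))) f) t = f t).
  { intros f Hf. unfold I. rewrite (delta_phi_n_frac_int T phi phi' HT Hphi (S p) 0%C); auto.
    - apply frac_int_zero.
    - left; reflexivity.
    - ring. }
  rewrite <- (Hid x Hxc), <- (Hid (I b0 w)).
  - apply delta_phi_n_ext; auto.
  - apply frac_int_cont_on; auto. right; exact Hb0.
Qed.

End Caputo.

(** * The Neumann series *)

Lemma gsum_ext {G : AbelianGroup} (n : nat) (f g : nat -> G) :
  (forall j, (j < n)%nat -> f j = g j) -> gsum n f = gsum n g.
Proof.
  induction n as [|n IH]; intro H; simpl; [reflexivity|].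
  rewrite IH, H by auto. reflexivity.
Qed.

Lemma gsum_C_plus (n : nat) (f g : nat -> C) :
  @gsum C_AbelianGroup n (fun j => f j + g j)%C =
  (@gsum C_AbelianGroup n f + @gsum C_AbelianGroup n g)%C.
Proof.
  induction n as [|n IH]; simpl; [change (RtoC 0 = 0 + 0)%C; ring|].
  rewrite IH. change (@gsum C_AbelianGroup n f + @gsum C_AbelianGroup n g + (f n + g n) =
    @gsum C_AbelianGroup n f + f n + (@gsum C_AbelianGroup n g + g n))%C. Cring.
Qed.

Lemma gsum_C_scal (n : nat) (c : C) (f : nat -> C) :
  @gsum C_AbelianGroup n (fun j => c * f j)%C = (c * @gsum C_AbelianGroup n f)%C.
Proof.
  induction n as [|n IH]; simpl; [change (RtoC 0 = c * 0)%C; ring|].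
  rewrite IH. change (c * @gsum C_AbelianGroup n f + c * f n = c * (@gsum C_AbelianGroup n f + f n))%C. Cring.
Qed.

Lemma Cmod_gsum_le (n : nat) (f : nat -> C) (b : nat -> R) (M : R) :
  (forall j, (j < n)%nat -> Cmod (f j) <= M * b j) ->
  Cmod (@gsum C_AbelianGroup n f) <= M * @gsum R_AbelianGroup n b.
Proof.
  induction n as [|n IH]; intro H; simpl.
  - change (Cmod 0 <= M * 0). rewrite Cmod_0. lra.
  - change (Cmod (@gsum C_AbelianGroup n f + f n)%C <= M * (@gsum R_AbelianGroup n b + b n)).
    eapply Rle_trans; [apply Cmod_triangle|]. rewrite Rmult_plus_distr_l.
    apply Rplus_le_compat; auto.
Qed.

Section Neumann.

Variables (T : R) (phi phi' : R -> R) (m : nat) (beta : nat -> C) (d : nat -> R -> C) (h : R -> C).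
Hypothesis HT : 0 < T.
Hypothesis Hphi : increasing_C1 phi phi'.
Hypothesis Hbeta : forall j, (j < m)%nat -> 0 < Re (beta O - beta (S j))%C.
Hypothesis Hd : forall i, (1 <= i <= m)%nat -> cont_on T (d i).

Let A := opA phi phi' m beta d.
Let I := frac_int phi phi'.

Lemma opA_ext (f g : R -> C) (t : R) : inI T t -> (forall s, inI T s -> f s = g s) -> A f t = A g t.
Proof.
  intros Ht E. unfold A, opA. apply (gsum_ext (G := C_AbelianGroup)). intros j _. f_equal.
  apply (frac_int_ext T); auto.
Qed.

Lemma opA_cont_on (f : R -> C) : cont_on T f -> cont_on T (A f).
Proof.
  intro Hf. apply cont_on_gsum. intros j Hj. apply cont_on_mult; [apply Hd; lia|].
  apply frac_int_cont_on; auto. right; auto.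
Qed.

Lemma opA_plus (f g : R -> C) (t : R) : inI T t -> cont_on T f -> cont_on T g ->
  A (fun s => f s + g s)%C t = (A f t + A g t)%C.
Proof.
  intros Ht Hf Hg. unfold A, opA. rewrite <- gsum_C_plus. apply (gsum_ext (G := C_AbelianGroup)).
  intros j Hj. rewrite (frac_int_plus T phi phi' HT Hphi); auto; [|right; auto].
  change (d (S j) t * (I (beta O - beta (S j)) f t + I (beta O - beta (S j)) g t) =
    d (S j) t * I (beta O - beta (S j)) f t + d (S j) t * I (beta O - beta (S j)) g t)%C. ring.
Qed.

Lemma opA_scal (c : C) (f : R -> C) (t : R) : inI T t -> cont_on T f ->
  A (fun s => c * f s)%C t = (c * A f t)%C.
Proof.
  intros Ht Hf. unfold A, opA. rewrite <- gsum_C_scal. apply (gsum_ext (G := C_AbelianGroup)).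
  intros j Hj. rewrite (frac_int_scal T phi phi' HT Hphi); auto; [|right; auto].
  change (d (S j) t * (c * I (beta O - beta (S j)) f t) = c * (d (S j) t * I (beta O - beta (S j)) f t))%C. ring.
Qed.

Lemma opA_minus (f g : R -> C) (t : R) : inI T t -> cont_on T f -> cont_on T g ->
  A (fun s => f s - g s)%C t = (A f t - A g t)%C.
Proof.
  intros Ht Hf Hg.
  rewrite (opA_ext _ (fun s => f s + (-(1)) * g s)%C t Ht) by (intros; ring).
  rewrite opA_plus, opA_scal by auto using cont_on_scal. ring.
Qed.

Lemma opA_contraction : condC T phi phi' m beta d ->
  exists nu q, 0 < nu /\ 0 < q < 1 /\ forall f M, cont_on T f -> 0 <= M ->
    (forall s, inI T s -> Cmod (f s) <= M * exp (nu * s)) ->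
    forall t, inI T t -> Cmod (A f t) <= M * q * exp (nu * t).
Proof.
  intros [nu [q [Hnu [Hq HC]]]]. exists nu, q. split; [exact Hnu|]. split; [exact Hq|].
  intros f M Hf HM0 HM t Ht.
  rewrite Rmult_assoc. eapply Rle_trans; [|apply Rmult_le_compat_l; [exact HM0|apply HC, Ht]].
  apply Cmod_gsum_le. intros j Hj.
  pose proof (Hbeta j Hj) as Hb. set (al := (beta O - beta (S j))%C) in *.
  rewrite Cmod_mult. rewrite (frac_int_pos phi phi') by exact Hb. rewrite Cmod_mult, Cmod_inv by (apply CGamma_neq_0, Hb).
  set (r := rint0 _ t).
  assert (HJ : Cmod (Jint phi phi' al f t) <= M * r).
  { unfold inI in Ht. destruct (Req_dec t 0) as [E|H0].
    - unfold r. rewrite E, J_0, Cmod_0. unfold rint0. destruct Rlt_dec; lra.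
    - apply (Cmod_J_exp_le phi phi' Hphi T); auto; [lra|apply admissible_cont_on; [lra|exact Hf]|].
      intros s Hs. apply HM. unfold inI; lra. }
  pose proof (norm_max_ge T (d (S j)) t (Hd (S j) ltac:(lia)) Ht) as Hdm.
  assert (0 < / Cmod (CGamma al)) by (apply Rinv_0_lt_compat, Cmod_gt_0, CGamma_neq_0, Hb).
  replace (M * (norm_max T (d (S j)) / Cmod (CGamma al) * r)) with
    (norm_max T (d (S j)) * (/ Cmod (CGamma al) * (M * r))) by (unfold Rdiv; ring).
  apply Rmult_le_compat; [apply Cmod_ge_0| |exact Hdm|].
  - apply Rmult_le_pos; [lra|apply Cmod_ge_0].
  - apply Rmult_le_compat_l; [lra|exact HJ].
Qed.

Lemma weighted_bound (nu : R) (f : R -> C) : 0 < nu -> cont_on T f ->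
  exists M, 0 <= M /\ forall s, inI T s -> Cmod (f s) <= M * exp (nu * s).
Proof.
  intros Hnu Hf. destruct (cont_on_bounded T f ltac:(lra) Hf) as [M [HM0 HM]].
  exists M. split; [exact HM0|]. intros s Hs. eapply Rle_trans; [apply HM, Hs|].
  rewrite <- (Rmult_1_r M) at 1. apply Rmult_le_compat_l; [exact HM0|].
  rewrite <- exp_0. apply exp_monotone. apply Rmult_le_pos; unfold inI in Hs; lra.
Qed.

Lemma pow_small_mult (q K eps : R) : 0 < q < 1 -> 0 <= K -> 0 < eps ->
  exists N, forall n, (N <= n)%nat -> K * q ^ n < eps.
Proof.
  intros Hq HK He.
  destruct (pow_lt_1_zero q ltac:(rewrite Rabs_right; lra) (eps / (K + 1)) ltac:(apply Rdiv_lt_0_compat; lra)) as [N HN].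
  exists N. intros n Hn. specialize (HN n Hn).
  assert (0 < q ^ n) by (apply pow_lt; lra). rewrite Rabs_right in HN by lra.
  apply Rle_lt_trans with ((K + 1) * q ^ n); [lra|].
  replace eps with ((K + 1) * (eps / (K + 1))) by (field; lra). apply Rmult_lt_compat_l; lra.
Qed.

Lemma opA_unique (w v : R -> C) : condC T phi phi' m beta d -> cont_on T w -> cont_on T v ->
  (forall t, inI T t -> w t + A w t = v t + A v t)%C -> forall t, inI T t -> w t = v t.
Proof.
  intros HC Hw Hv E t Ht.
  destruct (opA_contraction HC) as [nu [q [Hnu [Hq Hcon]]]].
  set (z := fun s => (w s - v s)%C).
  assert (Hz : cont_on T z) by (apply cont_on_minus; assumption).
  assert (Ez : forall s, inI T s -> z s = (- A z s)%C).
  { intros s Hs. unfold z at 2. rewrite opA_minus by assumption. specialize (E s Hs). unfold z.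
    replace (w s) with (w s + A w s - A w s)%C by ring. rewrite E. ring. }
  destruct (weighted_bound nu z Hnu Hz) as [M [HM0 HM]].
  assert (Hk : forall k s, inI T s -> Cmod (z s) <= M * q ^ k * exp (nu * s)).
  { induction k as [|k IH]; intros s Hs; [simpl; rewrite Rmult_1_r; auto|].
    rewrite Ez, Cmod_opp by exact Hs. simpl. rewrite (Rmult_comm q), <- Rmult_assoc.
    apply Hcon; auto. apply Rmult_le_pos; [exact HM0|apply pow_le; lra]. }
  apply Ceq_minus, Cmod_eq_0, Rle_antisym; [|apply Cmod_ge_0].
  apply le_epsilon. intros eps He. rewrite Rplus_0_l.
  destruct (pow_small_mult q (M * exp (nu * t)) eps Hq) as [N HN]; [apply Rmult_le_pos; [exact HM0|left; apply exp_pos]|exact He|].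
  specialize (HN N (le_n N)). specialize (Hk N t Ht). unfold z in Hk. lra.
Qed.

Definition neumann_term (k : nat) (t : R) : C := (RtoC ((-1) ^ k) * opA_pow phi phi' m beta d k h t)%C.

Fixpoint neumann_sum (n : nat) (t : R) : C :=
  match n with
  | O => h t
  | S k => (neumann_sum k t + neumann_term (S k) t)%C
  end.

Hypothesis Hh : cont_on T h.

Lemma opA_pow_cont_on (k : nat) : cont_on T (opA_pow phi phi' m beta d k h).
Proof. induction k as [|k IH]; simpl; [exact Hh|apply opA_cont_on, IH]. Qed.

Lemma neumann_sum_cont_on (n : nat) : cont_on T (neumann_sum n).
Proof.
  induction n as [|n IH]; simpl; [exact Hh|].
  apply cont_on_plus; [exact IH|]. apply cont_on_scal, opA_pow_cont_on.
Qed.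

Lemma opA_neumann_sum (n : nat) (t : R) : inI T t -> A (neumann_sum n) t = (h t - neumann_sum (S n) t)%C.
Proof.
  intro Ht. induction n as [|n IH].
  - change (neumann_sum 0) with h. simpl. unfold neumann_term. simpl. rewrite Rmult_1_r. fold A.
    rewrite RtoC_m1. ring.
  - change (neumann_sum (S n)) with (fun t => neumann_sum n t + neumann_term (S n) t)%C.
    rewrite opA_plus; [|exact Ht|apply neumann_sum_cont_on|apply cont_on_scal, opA_pow_cont_on].
    rewrite IH. unfold neumann_term at 1. rewrite opA_scal by (exact Ht || apply opA_pow_cont_on).
    simpl neumann_sum. unfold neumann_term. simpl. unfold A. rewrite !RtoC_mult, RtoC_m1. ring.
Qed.

Lemma frac_int_neumann_sum (al : C) (n : nat) (t : R) : 0 < Re al -> inI T t ->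
  I al (neumann_sum n) t =
  @sum_n C_AbelianGroup (fun k => RtoC ((-1) ^ k) * I al (opA_pow phi phi' m beta d k h) t)%C n.
Proof.
  intros Ha Ht. induction n as [|n IH].
  - rewrite sum_O. change (neumann_sum 0) with h. simpl. Cring.
  - rewrite sum_Sn, <- IH.
    change (neumann_sum (S n)) with (fun t => neumann_sum n t + neumann_term (S n) t)%C.
    unfold I. rewrite (frac_int_plus T phi phi' HT Hphi); [|right; exact Ha|exact Ht|apply neumann_sum_cont_on|apply cont_on_scal, opA_pow_cont_on].
    unfold neumann_term. rewrite (frac_int_scal T phi phi' HT Hphi); [reflexivity|right; exact Ha|exact Ht|apply opA_pow_cont_on].
Qed.

Lemma neumann_series : condC T phi phi' m beta d ->
  exists y, cont_on T y /\ (forall t, inI T t -> y t + A y t = h t)%C /\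
    forall eps, 0 < eps -> exists N, forall n, (N <= n)%nat ->
      forall t, inI T t -> Cmod (y t - neumann_sum n t) <= eps.
Proof.
  intro HC. destruct (opA_contraction HC) as [nu [q [Hnu [Hq Hcon]]]].
  destruct (weighted_bound nu h Hnu Hh) as [M [HM0 HM]].
  assert (Hpow : forall k t, inI T t -> Cmod (opA_pow phi phi' m beta d k h t) <= M * q ^ k * exp (nu * t)).
  { induction k as [|k IH]; intros t Ht; simpl; [rewrite Rmult_1_r; auto|].
    rewrite (Rmult_comm q), <- Rmult_assoc. apply Hcon; auto using opA_pow_cont_on.
    apply Rmult_le_pos; [exact HM0|apply pow_le; lra]. }
  assert (Hterm : forall k t, inI T t -> Cmod (neumann_term k t) <= M * q ^ k * exp (nu * t)).
  { intros k t Ht. unfold neumann_term. rewrite Cmod_mult, Cmod_R, pow_1_abs, Rmult_1_l. auto. }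
  set (B := M * exp (nu * T) / (1 - q)).
  assert (HB : 0 <= B).
  { unfold B. apply Rmult_le_pos; [apply Rmult_le_pos; [exact HM0|left; apply exp_pos]|left; apply Rinv_0_lt_compat; lra]. }
  assert (Hdiff : forall n p t, inI T t -> Cmod (neumann_sum (n + p) t - neumann_sum n t) <= B * (q ^ n - q ^ (n + p))).
  { intros n p t Ht. induction p as [|p IH].
    - rewrite Nat.add_0_r. replace (neumann_sum n t - neumann_sum n t)%C with (RtoC 0) by ring. rewrite Cmod_0. lra.
    - replace (n + S p)%nat with (S (n + p)) by lia. simpl neumann_sum.
      replace (neumann_sum (n + p) t + neumann_term (S (n + p)) t - neumann_sum n t)%C
        with ((neumann_sum (n + p) t - neumann_sum n t) + neumann_term (S (n + p)) t)%C by ring.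
      eapply Rle_trans; [apply Cmod_triangle|].
      assert (Hq1 : 0 <= q ^ (n + p)) by (apply pow_le; lra).
      assert (Hq2 : q ^ S (n + p) = q * q ^ (n + p)) by reflexivity.
      assert (Ht2 : Cmod (neumann_term (S (n + p)) t) <= B * (q ^ (n + p) - q ^ S (n + p))).
      { eapply Rle_trans; [apply Hterm, Ht|].
        replace (B * (q ^ (n + p) - q ^ S (n + p))) with (M * q ^ (n + p) * exp (nu * T)).
        2:{ rewrite Hq2. unfold B. field. lra. }
        apply Rmult_le_compat; [apply Rmult_le_pos; [exact HM0|apply pow_le; lra]|left; apply exp_pos| |].
        - apply Rmult_le_compat_l; [exact HM0|]. rewrite Hq2. nra.
        - apply exp_monotone. apply Rmult_le_compat_l; unfold inI in Ht; lra. }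
      lra. }
  assert (HBq : forall n p t, inI T t -> Cmod (neumann_sum (n + p) t - neumann_sum n t) <= B * q ^ n).
  { intros n p t Ht. eapply Rle_trans; [apply Hdiff, Ht|]. apply Rmult_le_compat_l; [exact HB|].
    assert (0 <= q ^ (n + p)) by (apply pow_le; lra). lra. }
  assert (Hlim : forall t, inI T t -> exists l : C, filterlim (fun n => neumann_sum n t) eventually (locally l)).
  { intros t Ht. apply (filterlim_locally_cauchy (U := C_R_CompleteNormedModule)). intro eps.
    destruct (pow_small_mult q B (eps / 2) Hq HB) as [N HN]; [pose proof (cond_pos eps); lra|].
    specialize (HN N (le_n N)).
    exists (fun n => (N <= n)%nat). split; [exists N; auto|]. intros u v Hu Hv.
    apply (@norm_compat1 R_AbsRing C_R_NormedModule). rewrite norm_C_R.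
    change (Cmod (neumann_sum v t - neumann_sum u t)%C < eps).
    replace u with (N + (u - N))%nat by lia. replace v with (N + (v - N))%nat by lia.
    replace (neumann_sum (N + (v - N)) t - neumann_sum (N + (u - N)) t)%C with
      ((neumann_sum (N + (v - N)) t - neumann_sum N t) + - (neumann_sum (N + (u - N)) t - neumann_sum N t))%C by ring.
    eapply Rle_lt_trans; [apply Cmod_triangle|]. rewrite Cmod_opp.
    pose proof (HBq N (v - N)%nat t Ht). pose proof (HBq N (u - N)%nat t Ht). lra. }
  set (y := fun t => epsilon (inhabits (RtoC 0)) (fun l : C => filterlim (fun n => neumann_sum n t) eventually (locally l))).
  assert (Hy : forall t, inI T t -> filterlim (fun n => neumann_sum n t) eventually (locally (y t))).
  { intros t Ht. unfold y. apply epsilon_spec, Hlim, Ht. }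
  assert (Hrem : forall n t, inI T t -> Cmod (y t - neumann_sum n t) <= B * q ^ n).
  { intros n t Ht. apply le_epsilon. intros eps He.
    destruct (proj1 (filterlim_C_Cmod _ _ _) (Hy t Ht) eps He) as [N HN].
    specialize (HN (n + N)%nat ltac:(lia)).
    replace (y t - neumann_sum n t)%C with ((neumann_sum (n + N) t - neumann_sum n t) + - (neumann_sum (n + N) t - y t))%C by ring.
    eapply Rle_trans; [apply Cmod_triangle|]. rewrite Cmod_opp.
    pose proof (HBq n N t Ht). lra. }
  assert (Huni : forall eps, 0 < eps -> exists N, forall n, (N <= n)%nat ->
      forall t, inI T t -> Cmod (y t - neumann_sum n t) <= eps).
  { intros eps He. destruct (pow_small_mult q B eps Hq HB He) as [N HN].
    exists N. intros n Hn t Ht. eapply Rle_trans; [apply Hrem, Ht|]. left; apply HN, Hn. }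
  assert (Hyc : cont_on T y).
  { apply cont_on_uniform_limit. intros eps He. destruct (Huni eps He) as [N HN].
    exists (neumann_sum N). split; [apply neumann_sum_cont_on|]. apply HN. lia. }
  exists y. split; [exact Hyc|]. split; [|exact Huni].
  intros t Ht. apply Ceq_minus, Cmod_eq_0, Rle_antisym; [|apply Cmod_ge_0].
  apply le_epsilon. intros eps He. rewrite Rplus_0_l.
  pose proof (exp_pos (nu * T)) as HeT.
  assert (He1 : 0 < eps / (1 + exp (nu * T))) by (apply Rdiv_lt_0_compat; lra).
  destruct (Huni _ He1) as [N HN].
  set (e := eps / (1 + exp (nu * T))) in *.
  assert (HA : Cmod (A (fun s => y s - neumann_sum N s)%C t) <= e * exp (nu * T)).
  { apply Rle_trans with (e * q * exp (nu * t)).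
    - apply Hcon; auto; [apply cont_on_minus; [exact Hyc|apply neumann_sum_cont_on]|lra|].
      intros s Hs. eapply Rle_trans; [apply (HN N); [lia|exact Hs]|].
      rewrite <- (Rmult_1_r e) at 1. apply Rmult_le_compat_l; [lra|].
      rewrite <- exp_0. apply exp_monotone. apply Rmult_le_pos; unfold inI in Hs; lra.
    - apply Rmult_le_compat; [apply Rmult_le_pos; lra|left; apply exp_pos|nra|].
      apply exp_monotone. apply Rmult_le_compat_l; unfold inI in Ht; lra. }
  rewrite opA_minus, opA_neumann_sum in HA; [|assumption..|apply neumann_sum_cont_on].
  replace (y t + A y t - h t)%C with ((y t - neumann_sum (S N) t) + (A y t - (h t - neumann_sum (S N) t)))%C by ring.
  eapply Rle_trans; [apply Cmod_triangle|].
  pose proof (HN (S N) ltac:(lia) t Ht) as H1.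
  replace eps with (e + e * exp (nu * T)) by (unfold e; field; lra). lra.
Qed.

End Neumann.

(** * The initial value problem *)

Lemma filterlim_at_right_0 (T : R) (f : R -> C) (l : C) : 0 < T -> cont_on T f ->
  filterlim f (at_right 0) (locally l) <-> f 0 = l.
Proof.
  intros HT Hf.
  assert (H0 : filterlim f (at_right 0) (locally (f 0))).
  { apply filterlim_C_Cmod; [typeclasses eauto|]. intros eps He.
    destruct (proj1 (cont_on_eps _ _) Hf 0 eps) as [d [Hd K]]; [unfold inI; lra|exact He|].
    generalize (at_right_between 0 (Rmin d T) (Rmin_pos _ _ Hd HT)). apply filter_imp. intros s Hs.
    pose proof (Rmin_l d T). pose proof (Rmin_r d T).
    apply K; [unfold inI; lra|]. rewrite Rminus_0_r, Rabs_right; lra. }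
  split; [|intros <-; exact H0].
  intro H. apply (@filterlim_locally_unique _ R_AbsRing C_R_NormedModule (at_right 0) _ f); assumption.
Qed.

Section Problem.

Variables (T : R) (phi phi' : R -> R) (m : nat) (beta : nat -> C) (d : nat -> R -> C) (h : R -> C).
Hypothesis HT : 0 < T.
Hypothesis Hphi : increasing_C1 phi phi'.
Hypothesis Hm : (1 <= m)%nat.
Hypothesis Hdecr : forall i, (i < m)%nat -> Re (beta (S i)) < Re (beta i).
Hypothesis Hlast : 0 <= Re (beta m).
Hypothesis Hwd : forall i (k : nat), (i <= m)%nat -> Re (beta i) = INR k -> Im (beta i) = 0.
Hypothesis Hh : cont_on T h.
Hypothesis Hd : forall i, (1 <= i <= m)%nat -> cont_on T (d i).
Hypothesis HC : condC T phi phi' m beta d.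

Let A := opA phi phi' m beta d.
Let I := frac_int phi phi'.

Lemma Re_beta_decr (i j : nat) : (i <= m)%nat -> (j < i)%nat -> Re (beta i) < Re (beta j).
Proof.
  induction i as [|i IH]; intros Hi Hj; [lia|].
  pose proof (Hdecr i ltac:(lia)).
  destruct (Nat.eq_dec j i) as [->|Hne]; [assumption|].
  specialize (IH ltac:(lia) ltac:(lia)). lra.
Qed.

Lemma Re_beta_nonneg (i : nat) : (i <= m)%nat -> 0 <= Re (beta i).
Proof.
  intro Hi. destruct (Nat.eq_dec i m) as [->|Hne]; [exact Hlast|].
  pose proof (Re_beta_decr m i (le_n m) ltac:(lia)). lra.
Qed.

Lemma Re_beta_0_pos : 0 < Re (beta O).
Proof. pose proof (Re_beta_decr m 0 (le_n m) ltac:(lia)). lra. Qed.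

Lemma is_order_nceil_beta (i : nat) : (i <= m)%nat ->
  is_order (RtoC (INR (nceil (Re (beta i)))) - beta i)%C.
Proof. intro Hi. apply is_order_nceil; [apply Re_beta_nonneg, Hi|]. intros k. apply Hwd, Hi. Qed.

Lemma Re_beta_diff_pos (j : nat) : (j < m)%nat -> 0 < Re (beta O - beta (S j))%C.
Proof.
  intro Hj. pose proof (Re_beta_decr (S j) 0 ltac:(lia) ltac:(lia)).
  unfold Cminus. rewrite Re_plus. unfold Re in *. simpl. lra.
Qed.

Lemma caputo_sum_frac_int (w x : R -> C) (t : R) : cont_on T w ->
  (forall t, inI T t -> x t = I (beta O) w t) -> inI T t ->
  (caputo T phi phi' (beta O) x t + @gsum C_AbelianGroup m (fun j =>
     d (S j) t * caputo T phi phi' (beta (S j)) x t))%C = (w t + A w t)%C.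
Proof.
  intros Hw Hx Ht. pose proof Re_beta_0_pos as Hb0. f_equal.
  - rewrite (caputo_frac_int T phi phi' HT Hphi (beta O) (beta O) w x); auto.
    + replace (beta O - beta O)%C with (RtoC 0) by ring. apply frac_int_zero.
    + lra.
    + apply is_order_nceil_beta. lia.
    + left; ring.
  - apply (gsum_ext (G := C_AbelianGroup)). intros j Hj. f_equal.
    apply (caputo_frac_int T phi phi' HT Hphi); auto.
    + pose proof (Re_beta_nonneg (S j) ltac:(lia)). pose proof (Re_beta_decr (S j) 0 ltac:(lia) ltac:(lia)). lra.
    + apply is_order_nceil_beta. lia.
    + right. apply Re_beta_diff_pos, Hj.
Qed.

Lemma solution_exists : exists x : R -> C,
  solves_ivp T phi phi' m beta d h x /\
  forall t, inI T t ->
    is_series (fun k => Cmult (RtoC ((-1) ^ k))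
                 (frac_int phi phi' (beta O) (opA_pow phi phi' m beta d k h) t)) (x t).
Proof.
  pose proof Re_beta_0_pos as Hb0.
  destruct (neumann_series T phi phi' m beta d h HT Hphi Re_beta_diff_pos Hd Hh HC) as [y [Hy [Ey Uy]]].
  exists (I (beta O) y).
  assert (Hx : forall t, inI T t -> I (beta O) y t = I (beta O) y t) by reflexivity.
  assert (Hsp : in_space T phi phi' (beta O) (I (beta O) y)).
  { apply (in_space_frac_int T phi phi' HT Hphi (beta O) y); auto. apply is_order_nceil_beta. lia. }
  split; [split; [exact Hsp|split]|].
  - intros k Hk. apply (filterlim_at_right_0 T); [exact HT|apply Hsp, Hk|].
    apply (delta_phi_n_frac_int_0 T phi phi' HT Hphi (beta O) y); auto.
  - intros t Ht. rewrite <- Ey by exact Ht. apply caputo_sum_frac_int; auto.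
  - intros t Ht. apply (filterlim_C_Cmod eventually). intros eps He.
    destruct (Cmod_J_le_uniform phi phi' Hphi T (beta O) HT Hb0) as [K [HK HKb]].
    set (L := Cmod (/ CGamma (beta O))).
    assert (HL : 0 <= L) by apply Cmod_ge_0.
    assert (HLK : 0 < (L + 1) * K) by (apply Rmult_lt_0_compat; lra).
    destruct (Uy (eps / (2 * ((L + 1) * K)))) as [N HN]; [apply Rdiv_lt_0_compat; lra|].
    exists N. intros n Hn.
    match goal with |- Cmod (?a - ?b)%C < eps => replace a with (I (beta O) (neumann_sum phi phi' m beta d h n) t) end.
    2:{ apply (frac_int_neumann_sum T phi phi' m beta d h HT Hphi Re_beta_diff_pos Hd Hh); assumption. }
    unfold I. rewrite !(frac_int_pos phi phi') by exact Hb0.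
    assert (Hsc : cont_on T (neumann_sum phi phi' m beta d h n)).
    { apply (neumann_sum_cont_on T phi phi' m beta d h HT Hphi Re_beta_diff_pos Hd Hh). }
    set (J := Jint phi phi' (beta O)).
    replace (/ CGamma (beta O) * J (neumann_sum phi phi' m beta d h n) t - / CGamma (beta O) * J y t)%C
      with (- (/ CGamma (beta O) * (J y t - J (neumann_sum phi phi' m beta d h n) t)))%C by ring.
    unfold J. rewrite <- (J_minus phi phi' Hphi T); auto using admissible_cont_on, Rlt_le.
    rewrite Cmod_opp, Cmod_mult. fold L.
    assert (HJ : Cmod (Jint phi phi' (beta O) (fun s => y s - neumann_sum phi phi' m beta d h n s)%C t) <= eps / (2 * ((L + 1) * K)) * K).
    { apply HKb; auto.
      - apply admissible_minus; apply admissible_cont_on; auto; lra.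
      - left. apply Rdiv_lt_0_compat; lra. }
    apply Rle_lt_trans with ((L + 1) * (eps / (2 * ((L + 1) * K)) * K)).
    + apply Rmult_le_compat; [exact HL|apply Cmod_ge_0|lra|exact HJ].
    + replace ((L + 1) * (eps / (2 * ((L + 1) * K)) * K)) with (eps / 2) by (field; lra). lra.
Qed.

Lemma solution_repr (x : R -> C) : solves_ivp T phi phi' m beta d h x ->
  exists w, cont_on T w /\ (forall t, inI T t -> x t = I (beta O) w t) /\
    forall t, inI T t -> (w t + A w t = h t)%C.
Proof.
  intros [Hsp [Hini Heq]]. pose proof Re_beta_0_pos as Hb0.
  exists (caputo T phi phi' (beta O) x).
  assert (Hw : cont_on T (caputo T phi phi' (beta O) x)) by apply Hsp.
  assert (Hx : forall t, inI T t -> x t = I (beta O) (caputo T phi phi' (beta O) x) t).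
  { apply (frac_int_caputo T phi phi' HT Hphi); auto.
    - apply is_order_nceil_beta. lia.
    - intros k Hk. apply (filterlim_at_right_0 T (delta_phi_n T phi' k x)); auto. apply Hsp, Hk. }
  split; [exact Hw|]. split; [exact Hx|].
  intros t Ht. rewrite <- Heq by exact Ht. symmetry. apply caputo_sum_frac_int; auto.
Qed.

Lemma solution_unique (x y : R -> C) : solves_ivp T phi phi' m beta d h x ->
  solves_ivp T phi phi' m beta d h y -> forall t, inI T t -> x t = y t.
Proof.
  intros Sx Sy t Ht.
  destruct (solution_repr x Sx) as [w [Hw [Hxw Ew]]].
  destruct (solution_repr y Sy) as [v [Hv [Hyv Ev]]].
  rewrite Hxw, Hyv by exact Ht. apply (frac_int_ext T); [exact Ht|].
  apply (opA_unique T phi phi' m beta d HT Hphi Re_beta_diff_pos Hd w v HC Hw Hv).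
  intros s Hs. etransitivity; [apply Ew, Hs|symmetry; apply Ev, Hs].
Qed.

End Problem.

Section Transfer.

Variables (T : R) (p p' q q' : R -> R).
Hypothesis HT : 0 < T.
Hypothesis Hpq : forall t, inI T t -> p t = q t.
Hypothesis Hpq' : forall t, inI T t -> p' t = q' t.

Lemma frac_int_transfer (alpha : C) (f g : R -> C) : (forall s, inI T s -> f s = g s) ->
  forall t, inI T t -> frac_int p p' alpha f t = frac_int q q' alpha g t.
Proof.
  intros E t Ht. unfold frac_int. destruct C_eq_dec; [auto|]. f_equal.
  apply cint0_ext. intros s Hs. assert (inI T s) by (unfold inI in *; lra).
  rewrite E, Hpq', !Hpq by assumption. reflexivity.
Qed.

Lemma opA_pow_transfer (m : nat) (beta : nat -> C) (d : nat -> R -> C) (k : nat) (h : R -> C) (t : R) :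
  inI T t -> opA_pow p p' m beta d k h t = opA_pow q q' m beta d k h t.
Proof.
  revert t. induction k as [|k IH]; intros t Ht; simpl; [reflexivity|].
  apply (gsum_ext (G := C_AbelianGroup)). intros j _. f_equal. apply frac_int_transfer; auto.
Qed.

Lemma taylor_transfer (n : nat) (f : R -> C) (s : R) : inI T s -> taylor T p p' n f s = taylor T q q' n f s.
Proof.
  intro Hs. assert (H0 : inI T 0) by (unfold inI; lra).
  apply (gsum_ext (G := C_AbelianGroup)). intros j _.
  rewrite (delta_phi_n_ext T p' q' j f f), !Hpq by auto. reflexivity.
Qed.

Lemma caputo_inner_transfer (sg : C) (n : nat) (f : R -> C) (t : R) : inI T t ->
  frac_int p p' sg (fun s => f s - taylor T p p' n f s)%C t =
  frac_int q q' sg (fun s => f s - taylor T q q' n f s)%C t.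
Proof.
  intro Ht. apply frac_int_transfer; [|exact Ht]. intros s Hs. rewrite taylor_transfer by exact Hs. reflexivity.
Qed.

Lemma caputo_transfer (alpha : C) (f : R -> C) (t : R) : inI T t ->
  caputo T p p' alpha f t = caputo T q q' alpha f t.
Proof.
  intro Ht. apply delta_phi_n_ext; auto. intros s Hs. apply caputo_inner_transfer, Hs.
Qed.

Lemma solves_ivp_transfer (m : nat) (beta : nat -> C) (d : nat -> R -> C) (h x : R -> C) :
  solves_ivp T p p' m beta d h x -> solves_ivp T q q' m beta d h x.
Proof.
  intros [[H1 [H2 [H3 H4]]] [H5 H6]].
  assert (E : forall k t, inI T t -> delta_phi_n T p' k x t = delta_phi_n T q' k x t).
  { intros k. apply delta_phi_n_ext; auto. }
  split; [split; [|split; [|split]]|split].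
  - intros k Hk. apply cont_on_ext with (delta_phi_n T p' k x); auto.
  - intros k Hk. apply differentiable_on_ext with (delta_phi_n T p' k x); auto.
  - intros j Hj. eapply differentiable_on_ext; [|apply (H3 j Hj)].
    apply delta_phi_n_ext; auto. intros s Hs. apply caputo_inner_transfer, Hs.
  - eapply cont_on_ext; [|exact H4]. intros; apply caputo_transfer; assumption.
  - intros k Hk. eapply filterlim_ext_loc; [|apply (H5 k Hk)].
    generalize (at_right_between 0 T HT). apply filter_imp. intros s Hs. apply E. unfold inI; lra.
  - intros t Ht. rewrite <- H6 by exact Ht. rewrite caputo_transfer by exact Ht. f_equal.
    apply (gsum_ext (G := C_AbelianGroup)). intros j _. rewrite caputo_transfer by exact Ht. reflexivity.
Qed.

Lemma condC_transfer (m : nat) (beta : nat -> C) (d : nat -> R -> C) :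
  condC T p p' m beta d -> condC T q q' m beta d.
Proof.
  intros [nu [c [Hnu [Hc H]]]]. exists nu, c. split; [exact Hnu|]. split; [exact Hc|].
  intros t Ht. eapply Rle_trans; [right|apply H, Ht].
  apply (gsum_ext (G := R_AbelianGroup)). intros j _. f_equal.
  apply rint0_ext. intros s Hs. assert (inI T s) by (unfold inI in *; lra).
  rewrite Hpq', !Hpq by assumption. reflexivity.
Qed.

End Transfer.

Lemma increasing_C1_extension (T : R) (phi phi' : R -> R) : 0 < T ->
  (forall t, inI T t -> is_rderiv_on_at T phi t (phi' t)) ->
  (forall t, inI T t -> filterlim phi' (within (inI T) (locally t)) (locally (phi' t))) ->
  (forall t, inI T t -> 0 < phi' t) ->
  exists psi psi', increasing_C1 psi psi' /\
    (forall t, inI T t -> phi t = psi t) /\ (forall t, inI T t -> phi' t = psi' t).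
Proof.
  intros HT Hphi Hc Hpos.
  set (psi' := fun s => phi' (clamp T s)).
  set (psi := fun s => phi 0 + RInt psi' 0 s).
  assert (Hc' : forall s, continuous psi' s).
  { intro s. apply (filterlim_comp _ _ _ (clamp T) phi' _ (within (inI T) (locally (clamp T s)))).
    - apply clamp_filterlim. lra.
    - apply Hc, clamp_inI. lra. }
  assert (HD : forall s, is_derive psi s (psi' s)).
  { intro s. unfold psi.
    replace (psi' s) with (@plus R_AbelianGroup 0 (psi' s)) by (unfold plus; simpl; ring).
    apply (is_derive_plus (V := R_NormedModule) (fun _ => phi 0) (fun s => RInt psi' 0 s)); [apply @is_derive_const|].
    apply (is_derive_RInt (V := R_NormedModule) psi' (fun x => RInt psi' 0 x) 0 s); [|apply Hc'].
    apply filter_forall. intro b. apply (RInt_correct (V := R_CompleteNormedModule)).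
    apply (ex_RInt_continuous (V := R_CompleteNormedModule)). intros; apply Hc'. }
  exists psi, psi'. split; [|split].
  - intro s. split; [apply HD|]. split; [apply Hc'|]. apply Hpos, clamp_inI. lra.
  - intros t Ht.
    assert (E : phi t - psi t = phi 0 - psi 0).
    { apply (rderiv_zero_const T (fun s => phi s - psi s) HT); [|exact Ht].
      intros s Hs. apply is_rderiv_on_at_eps. intros eps He.
      destruct (proj1 (is_rderiv_on_at_eps _ _ _ _) (Hphi s Hs) (eps / 2)) as [d1 [Hd1 K1]]; [lra|].
      pose proof (proj1 (is_derive_Reals _ _ _) (HD s)) as HD'.
      destruct (HD' (eps / 2)) as [d2 K2]; [lra|].
      exists (Rmin d1 d2). split; [apply Rmin_pos; [exact Hd1|apply cond_pos]|].
      intros u Hu Hne Hus.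
      specialize (K1 u Hu Hne (Rlt_le_trans _ _ _ Hus (Rmin_l _ _))).
      specialize (K2 (u - s) ltac:(lra) (Rlt_le_trans _ _ _ Hus (Rmin_r _ _))).
      replace (s + (u - s)) with u in K2 by ring.
      unfold psi' in K2. rewrite clamp_id in K2 by exact Hs.
      replace ((phi u - psi u - (phi s - psi s)) / (u - s) - 0) with
        (((phi u - phi s) / (u - s) - phi' s) - ((psi u - psi s) / (u - s) - phi' s)) by (field; lra).
      eapply Rle_lt_trans; [apply Rabs_triang|]. rewrite Rabs_Ropp. lra. }
    assert (psi 0 = phi 0); [|lra].
    unfold psi. rewrite RInt_point. unfold zero; simpl. ring.
  - intros t Ht. unfold psi'. rewrite clamp_id by exact Ht. reflexivity.
Qed.

Theorem theorem3p1
  (T : R) (phi phi' : R -> R) (m : nat) (beta : nat -> C)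
  (d : nat -> R -> C) (h : R -> C)
  (HT : 0 < T)
  (* phi in C^1[0,T] with phi' > 0 *)
  (Hphi : forall t, inI T t -> is_rderiv_on_at T phi t (phi' t))
  (Hphi'c : forall t, inI T t ->
     filterlim phi' (within (inI T) (locally t)) (locally (phi' t)))
  (Hphi'pos : forall t, inI T t -> 0 < phi' t)
  (* the orders *)
  (Hm : (1 <= m)%nat)
  (Hdecr : forall i, (i < m)%nat -> Re (beta (S i)) < Re (beta i))
  (Hlast : 0 <= Re (beta m))
  (Hpos : forall i, (i < m)%nat -> 0 < Re (beta i))
  (Hzero : Re (beta m) = 0 -> beta m = RtoC 0)
  (* the fractional operators of the paper are only defined when an order with
     integer real part is real (see NOTES.md, FIDELITY) *)
  (Hwd : forall i (k : nat), (i <= m)%nat -> Re (beta i) = INR k -> Im (beta i) = 0)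
  (* data *)
  (Hh : cont_on T h)
  (Hd : forall i, (1 <= i <= m)%nat -> cont_on T (d i))
  (HC : condC T phi phi' m beta d) :
  (exists x : R -> C,
     solves_ivp T phi phi' m beta d h x /\
     forall t, inI T t ->
       is_series (fun k => Cmult (RtoC ((-1) ^ k))
                    (frac_int phi phi' (beta O) (opA_pow phi phi' m beta d k h) t))
                 (x t)) /\
  (forall x y : R -> C,
     solves_ivp T phi phi' m beta d h x -> solves_ivp T phi phi' m beta d h y ->
     forall t, inI T t -> x t = y t).
Proof.
  destruct (increasing_C1_extension T phi phi' HT Hphi Hphi'c Hphi'pos) as [psi [psi' [Hpsi [E E']]]].
  assert (F : forall t, inI T t -> psi t = phi t) by (intros; symmetry; auto).
  assert (F' : forall t, inI T t -> psi' t = phi' t) by (intros; symmetry; auto).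
  pose proof (condC_transfer T phi phi' psi psi' E E' m beta d HC) as HC'.
  split.
  - destruct (solution_exists T psi psi' m beta d h HT Hpsi Hm Hdecr Hlast Hwd Hh Hd HC') as [x [Sx Hx]].
    exists x. split; [apply (solves_ivp_transfer T psi psi' phi phi' HT F F'), Sx|].
    intros t Ht. eapply is_series_ext; [|apply Hx, Ht].
    intro k. simpl. f_equal. apply (frac_int_transfer T psi psi' phi phi' F F'); [|exact Ht].
    intros s Hs. apply (opA_pow_transfer T psi psi' phi phi' F F'), Hs.
  - intros x y Sx Sy.
    apply (solution_unique T psi psi' m beta d h HT Hpsi Hm Hdecr Hlast Hwd Hd HC');
      apply (solves_ivp_transfer T phi phi' psi psi' HT E E'); assumption.
Qed.
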